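(* There are constants $c_0,\alpha_0>0$ and a scalar ($d=1$) instance $(f,\mathsf{Z},P,\pi,\xi)$ satisfying the assumptions (A1)--(A3) listed in the context such that, for the stationary scaled iterate $Y_\alpha=(X_\alpha-x_\star)/\sqrt\alpha$, $$W_1\bigl(\mathcal{L}(Y_\alpha),\mathcal{N}(0,5/4)\bigr)\ge c_0\sqrt\alpha,\qquad 0<\alpha\le\alpha_0 .$$ The stationary noise marginal (the law of $\xi(Z_0)$) is symmetric, $\mathbb{E}[\xi(Z_0)^3]=0$, and $\mathbb{E}[\xi(Z_0)\xi(Z_\ell)]=0$ for every $\ell\in\mathbb{Z}\setminus\{0\}$. The leading correction is generated by the mixed moment $\mathbb{E}[\xi(Z_0)\xi(Z_1)^2]=-9/4$. Independent sampling from the same marginal gives zero expectation for the bounded $1$-Lipschitz test function $h(x)=\sin x$.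
   Context: The recursion is constant-stepsize SGD with stepsize $\alpha>0$ and exogenous Markovian noise, $$Z_{k+1}\mid (X_j,Z_j)_{j\le k}\sim P(Z_k,\cdot),\qquad X_{k+1}=X_k-\alpha f'(X_k)+\alpha\,\xi(Z_k),$$ and $(X_\alpha,Z_\alpha)$ is distributed according to the (unique) invariant probability measure of this joint recursion. In the moment statements, $(Z_k)_{k\in\mathbb{Z}}$ is the stationary chain with kernel $P$ and marginal $\pi$. Assumptions (in dimension $d=1$): (A1) $f:\mathbb{R}\to\mathbb{R}$ is twice continuously differentiable and there are constants $0<m\le L$, $0\le M<\infty$ with $m\le f''(x)\le L$ and $|f''(x)-f''(y)|\le M|x-y|$ for all $x,y\in\mathbb{R}$. Its unique minimizer is $x_\star$. (A2) $P$ is a Markov kernel on a Polish space $\mathsf{Z}$ with invariant probability measure $\pi$, and there are $C_Z<\infty$, $\rho\in(0,1)$ with $\sup_{z\in\mathsf{Z}}\|P^k(z,\cdot)-\pi\|_{\mathrm{TV}}\le C_Z\rho^k$ for all integers $k\ge0$, where $\|\mu-\nu\|_{\mathrm{TV}}=\sup_B|\mu(B)-\nu(B)|$ over Borel sets. (A3) $\xi:\mathsf{Z}\to\mathbb{R}$ is measurable, $\int\xi\,d\pi=0$, and $\sup_z|\xi(z)|\le b$ for some $b<\infty$. $\mathcal{L}(U)$ denotes the law of $U$. For probability measures on $\mathbb{R}$ with finite first moments, $W_1(\mu,\nu)=\sup\{|\int h\,d\mu-\int h\,d\nu| : h:\mathbb{R}\to\mathbb{R}\ 1\text{-Lipschitz}\}$.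 ''Leading correction'' means the leading, order-$\sqrt\alpha$, deviation of the law of $Y_\alpha$ from its Gaussian limit $\mathcal{N}(0,5/4)$. ''Independent sampling from the same marginal'' means that the noise sequence $(\xi(Z_k))_k$ is replaced in the recursion by an i.i.d. sequence with the same law as $\xi(Z_0)$; the expectation of $h$ is then that of $\sin(\widetilde Y_\alpha)$, where $\widetilde Y_\alpha$ is the corresponding stationary scaled iterate. *)

(* Defs.v *)
From HB Require Import structures.
From mathcomp Require Import all_boot all_order all_algebra.
From mathcomp Require Import all_classical all_reals all_analysis.
From mathcomp Require Import measurable_realfun.

Set Implicit Arguments.
Unset Strict Implicit.
Unset Printing Implicit Defensive.

Import Order.TTheory GRing.Theory Num.Theory.
Import numFieldNormedType.Exports.

Local Open Scope classical_set_scope.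
Local Open Scope ring_scope.

Notation borelType T := (g_sigma_algebraType (@open T)).

(* A complete pseudometric space is a complete metric space exactly when it is
   Hausdorff. *)
Definition polish (R : realType) (T : completePseudoMetricType R) : Prop :=
  hausdorff_space T /\ exists2 D : set T, countable D & dense D.

Definition strongly_convex_C2 (R : realType) (f : R -> R) : Prop :=
  let f'' := f^`(2)%classic in
  [/\ forall k x, (k < 2)%N -> derivable f^`(k)%classic x 1,
      continuous f''
    & exists m L M : R,
        [/\ 0 < m <= L, 0 <= M,
            forall x, m <= f'' x <= L
          & forall x y, `|f'' x - f'' y| <= M * `|x - y|]].

Definition unique_minimizer (R : realType) (f : R -> R) (xstar : R) : Prop :=
  (forall x, f xstar <= f x) /\
  (forall y, (forall x, f y <= f x) -> y = xstar).

Section markov_chain.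
Context d (T : measurableType d) (R : realType).
Implicit Types (P : T -> {measure set T -> \bar R}) (pi : probability T R).
Local Open Scope ereal_scope.

Fixpoint kernel_iter P (k : nat) (z : T) : set T -> \bar R :=
  if k is k'.+1 then fun B => \int[P z]_y kernel_iter P k' y B else \d_z.

Definition tv_dist (mu nu : set T -> \bar R) : \bar R :=
  ereal_sup [set `|mu B - nu B| | B in measurable].

Definition invariant_prob P pi : Prop :=
  forall B, measurable B -> \int[pi]_z P z B = pi B.

Definition uniformly_ergodic P pi : Prop :=
  invariant_prob P pi /\
  exists C rho : R, (0 < rho < 1)%R /\
    forall k : nat, ereal_sup [set tv_dist (kernel_iter P k z) pi | z in setT]
                    <= (C * rho ^+ k)%:E.

Definition centered_bounded_noise pi (xi : T -> R) : Prop :=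
  [/\ measurable_fun setT xi, \int[pi]_z (xi z)%:E = 0
    & exists b : R, forall z, (`|xi z| <= b)%R].

Definition past d' (Omega : measurableType d') (Zs : int -> Omega -> T)
    (k : int) : set (set Omega) :=
  <<s [set A | exists j B, [/\ (j <= k)%R, measurable B & A = Zs j @^-1` B]] >>.

Definition stationary_chain P pi d' (Omega : measurableType d')
    (Pr : probability Omega R) (Zs : int -> Omega -> T) : Prop :=
  [/\ forall k, measurable_fun setT (Zs k),
      forall k B, measurable B -> Pr (Zs k @^-1` B) = pi B
    & forall k A B, past Zs k A -> measurable B ->
        Pr (A `&` Zs (k + 1)%R @^-1` B) = \int[Pr]_(w in A) P (Zs k w) B].

(* From (x, z) the recursion moves to (sgd_step (x, z), z') with z' ~ P z.  The
   constant kernel P = (fun=> pi) makes the noise i.i.d. with law xi(pi). *)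
Definition sgd_step (f : R -> R) (xi : T -> R) (alpha : R) (w : R * T) : R :=
  (w.1 - alpha * f^`()%classic w.1 + alpha * xi w.2)%R.

Definition sgd_invariant (f : R -> R) (xi : T -> R) P (alpha : R)
    (mu : probability (R * T)%type R) : Prop :=
  forall A, measurable A ->
    \int[mu]_w P w.2 (xsection A (sgd_step f xi alpha w)) = mu A.

Definition sgd_stationary_law (f : R -> R) (xi : T -> R) P (alpha : R)
    (mu : probability (R * T)%type R) : Prop :=
  sgd_invariant f xi P alpha mu /\
  forall nu : probability (R * T)%type R, sgd_invariant f xi P alpha nu ->
    forall A, measurable A -> nu A = mu A.

Definition scaled_iterate (xstar alpha : R) (w : R * T) : measurableTypeR R :=
  ((w.1 - xstar) / Num.sqrt alpha)%R.

Lemma measurable_scaled_iterate xstar alpha :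
  measurable_fun setT (scaled_iterate xstar alpha).
Proof.
by apply: measurable_funM => //; apply: measurable_funB => //;
  exact: measurable_fst.
Qed.

HB.instance Definition _ xstar alpha :=
  isMeasurableFun.Build _ _ _ _ (scaled_iterate xstar alpha)
    (measurable_scaled_iterate xstar alpha).

End markov_chain.

Section wasserstein.
Context (R : realType).
Implicit Types mu nu : probability (measurableTypeR R) R.
Local Open Scope ereal_scope.

Definition finite_first_moment mu : Prop :=
  mu.-integrable setT (fun y => y%:E).

Definition W1 mu nu : \bar R :=
  ereal_sup [set `|\int[mu]_y (h y)%:E - \int[nu]_y (h y)%:E|
            | h in [set h : R -> R | 1.-lipschitz_setT h]].

End wasserstein.

Definition C4_bounded_derivatives (R : realType) (h : R -> R) : Prop :=
  [/\ forall k x, (k < 4)%N -> derivable h^`(k)%classic x 1,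
      continuous h^`(4)%classic
    & forall k, (0 < k <= 4)%N -> exists C : R, forall x, `|h^`(k)%classic x| <= C].

(* One-term Edgeworth expansion, tested against smooth functions: a law with
   mean 0, variance that of gauss up to o(sqrt alpha), and third cumulant
   kappa3 * sqrt alpha + o(sqrt alpha) deviates from gauss, at order
   sqrt alpha, by the functional h |-> kappa3 / 6 * E[h'''(G)], G ~ gauss.
   For the scaled SGD iterate with f''(xstar) = a and white noise (xi_k) whose
   only nonzero third-order joint moment is m = E[xi_k xi_(k+1)^2], summing
   over the positions of the repeated index gives kappa3 = 3 m / (3 a). *)
Definition leading_correction (R : realType)
    (law : R -> probability (measurableTypeR R) R)
    (gauss : probability (measurableTypeR R) R) (kappa3 : R) : Prop :=
  forall h : R -> R, C4_bounded_derivatives h ->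
    (\int[law alpha]_y h y - \int[gauss]_y h y) / Num.sqrt alpha
      @[alpha --> 0^'+] -->
    kappa3 / 6 * \int[gauss]_y h^`(3)%classic y.

(* Main.v *)
Require Import Defs.
From HB Require Import structures.
From mathcomp Require Import all_boot all_order all_algebra.
From mathcomp Require Import all_classical all_reals all_analysis.
From mathcomp Require Import measurable_realfun.
From mathcomp Require Import ring lra zify.

Set Implicit Arguments.
Unset Strict Implicit.
Unset Printing Implicit Defensive.

Import Order.TTheory GRing.Theory Num.Theory.
Import numFieldNormedType.Exports.

Local Open Scope classical_set_scope.
Local Open Scope ring_scope.

(* Take fair coins s_k and the noise xi_k = s_k c(s_(k-1)) with c = 1 after heads and
   c = 2 after tails, a function of the chain Z_k = (s_(k-1), s_k).  It is white with a
   symmetric marginal, but E[xi_0 xi_1^2] = -9/4.  With f(x) = x^2 / 2 the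
   scaled iterate satisfies Y' = q Y + sqrt(alpha) xi, q = 1 - alpha.  To compare E h(Y)
   with E h(G), G ~ N(0, 5/4), interpolate by a_i = E h(q^i Y + sigma_i N), where N is an
   independent standard Gaussian and sigma_i^2 = 5/4 (1 - q^(2 i)): a_0 = E h(Y), a_i
   tends to E h(G), and by stationarity a_i - a_(i+1) compares one step of the recursion
   with a Gaussian step of the same variance.  Conditioning successively on the last two
   coins and Taylor expanding leaves the term
   - 9/8 alpha^(3/2) q^(3 i + 1) E h'''(q^(i+2) Y + sigma_i N), and summing over i gives
   E h(Y) = E h(G) - 3/8 sqrt(alpha) E h'''(G) + o(sqrt(alpha)).  For h = sin this
   bounds W1 from below, since - E h'''(G) = E cos G >= 1 - 5/8.

   The invariant law of the recursion is that of an iterated function system; it is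
   realised as a function of the coin sequence, and is unique because the maps contract in
   the first coordinate and forget the second one after two steps.  For i.i.d.
   noise the reflection (x, (a, b)) -> (-x, (a, -b)) preserves the recursion, hence
   its unique invariant law, so that the odd function sin has mean 0. *)

(** With s = 1 or -1, the constants come from c(s) = 3/2 - s/2 and c(s)^2 = 5/2 - 3/2 s. The mean
    5/2 of c^2 gives the stationary variance (5/2) / (2 - alpha), hence the limit 5/4. The
    fluctuation of c^2 enters as - 3/4 alpha E[s h'']; since Y contains the noise that carries s,
    conditioning once more turns E[s h''] into 3/2 sqrt(alpha) E h''' up to smaller terms. Hence 9/8
    = 3/4 * 3/2, and 3/8 because alpha times the sum of q^(3 i) tends to 1/3.

    The obstacle is the replacement of E h''' along the interpolation by E h'''(G): the first-order
    comparison consumes four derivatives of its test function, and h''' has only one left. So E h'''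
    is recovered from third differences of h, with an error of order alpha^(1/8), which still leaves
    o(sqrt(alpha)) in the expansion. Smoothing by N is treated as an operator on test functions, so
    that Y and N never have to live on a common space. *)

Section pushforward_measure.
Context d d' (T : measurableType d) (T' : measurableType d') (R : realType).
Variables (m : {measure set T -> \bar R}) (f : T -> T').
Hypothesis mf : measurable_fun setT f.

Definition push_measure : {measure set T' -> \bar R} :=
  measure_function_pushforward__canonical__measure_function_Measure m mf.

End pushforward_measure.

(** * Lebesgue and Gaussian integrals under affine maps *)

Section lebesgue_affine.
Context {R : realType}.
Local Notation mu := (@lebesgue_measure R).
Implicit Types a b : R.

Definition affine a b : measurableTypeR R -> measurableTypeR R :=
  fun x => a * x + b.

Lemma measurable_affine a b : measurable_fun setT (affine a b).
Proof. by apply: measurable_funD => //; apply: measurable_funM. Qed.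

HB.instance Definition _ a b :=
  isMeasurableFun.Build _ _ _ _ (affine a b) (measurable_affine a b).

(** The pushforward multiplied by [a] agrees with Lebesgue measure on bounded half-open intervals,
    and these determine it. *)
Lemma lebesgue_measure_affine a b A : 0 < a -> measurable A ->
  mu (affine a b @^-1` A) = (a^-1%:E * mu A)%E.
Proof.
move=> a0 mA.
pose p : {measure set (measurableTypeR R) -> \bar R} := push_measure mu (@measurable_affine a b).
pose m : {measure set (measurableTypeR R) -> \bar R} := mscale (NngNum (ltW a0)) p.
suff -> : mu A = m A.
  by rewrite /m/= /mscale/= muleA -EFinM mulVf ?gt_eqF// mul1e.
have := @lebesgue_measure_unique R m _ A mA; apply.
move=> _ [[c d]] _ <-.
rewrite /m /= /mscale /= /pushforward/=.
rewrite (_ : _ @^-1` _ = `]((c - b) / a), ((d - b) / a)]%classic); last first.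
  by apply/seteqP; split => x /=; rewrite /affine !in_itv/= ltr_pdivrMr// ler_pdivlMr//
    ltrBlDr lerBrDr (mulrC x).
rewrite !lebesgue_measure_itv/= !lte_fin ltr_pM2r ?invr_gt0// ltrD2r.
case: ifPn => _; last by rewrite mule0.
by rewrite -!EFinD -EFinM; congr EFin; field; rewrite gt_eqF.
Qed.

Lemma ge0_integral_affine a b (f : measurableTypeR R -> \bar R) : 0 < a ->
  measurable_fun setT f -> (forall x, 0 <= f x)%E ->
  (\int[mu]_x f (affine a b x) = a^-1%:E * \int[mu]_x f x)%E.
Proof.
move=> a0 mf f0.
have mm := measurable_affine a b.
have ai0 : 0 <= a^-1 by rewrite invr_ge0 ltW.
transitivity (\int[mscale (NngNum ai0) mu]_x f x)%E; last first.
  by rewrite ge0_integral_mscale.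
transitivity (\int[pushforward mu (affine a b)]_x f x)%E.
  by rewrite ge0_integral_pushforward.
apply: eq_measure_integral => A mA _.
exact: lebesgue_measure_affine.
Qed.

End lebesgue_affine.

Section normal_integral.
Context {R : realType}.
Local Notation mu := (@lebesgue_measure R).
Implicit Types (m s : R).

(** The Radon-Nikodym derivative and [normal_pdf] have the same integral over every measurable set,
    so they agree almost everywhere. *)
Lemma ge0_integral_normal_prob m s (f : measurableTypeR R -> \bar R) :
  measurable_fun setT f -> (forall x, 0 <= f x)%E ->
  (\int[normal_prob m s]_x f x = \int[mu]_x (f x * (normal_pdf m s x)%:E))%E.
Proof.
move=> mf f0.
have dom := normal_prob_dominates m s.
rewrite -(Radon_Nikodym_SigmaFinite.change_of_variables dom)//.
apply: ae_eq_integral => //.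
- apply: emeasurable_funM => //.
  exact: measurable_int (Radon_Nikodym_SigmaFinite.f_integrable dom).
- apply: emeasurable_funM => //; apply/measurable_EFinP.
  exact: measurable_normal_pdf.
- apply: ae_eqe_mul2l; apply: integral_ae_eq => //.
  + exact: Radon_Nikodym_SigmaFinite.f_integrable.
  + apply/measurable_EFinP; exact: measurable_normal_pdf.
  + by move=> A _ mA; rewrite -Radon_Nikodym_SigmaFinite.f_integral.
Qed.

End normal_integral.

(** * Scaling, reflection and convolution of Gaussian laws *)

Section gaussian.
Context {R : realType}.
Local Notation mu := (@lebesgue_measure R).
Local Notation gamma := (normal_prob (0:R) 1).
Implicit Types a b s : R.

Lemma normal_pdf_scale s x : 0 < s ->
  normal_pdf 0 s x = s^-1 * normal_pdf 0 1 (s^-1 * x).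
Proof.
move=> s0; rewrite !normal_pdfE ?gt_eqF// /normal_peak /normal_fun !subr0.
rewrite expr1n mul1r mulrA; congr (_ * expR _).
  by rewrite -mulrnAr sqrtrM ?sqr_ge0// sqrtr_sqr gtr0_norm// invfM.
by field; rewrite gt_eqF.
Qed.

Lemma ge0_integral_normal_scale s (f : measurableTypeR R -> \bar R) : 0 < s ->
  measurable_fun setT f -> (forall x, 0 <= f x)%E ->
  (\int[gamma]_x f (s * x)%R = \int[normal_prob 0 s]_x f x)%E.
Proof.
move=> s0 mf f0; have mfs : measurable_fun setT (fun x => f (s * x)%R).
  by apply: measurableT_comp => //; exact: measurable_funM.
rewrite [LHS](ge0_integral_normal_prob 0 1 mfs (fun=> f0 _)).
rewrite [RHS](ge0_integral_normal_prob 0 s mf f0).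
have mg : measurable_fun setT
    (fun x : measurableTypeR R => f x * (normal_pdf 0 1 (s^-1 * x)%R)%:E)%E.
  apply: emeasurable_funM => //; apply/measurable_EFinP.
  apply: (measurableT_comp (@measurable_normal_pdf R 0 1)).
  exact: measurable_funM.
have := @ge0_integral_affine R s 0 _ s0 mg.
move=> H; transitivity (s^-1%:E * \int[mu]_x (f x * (normal_pdf 0 1 (s^-1 * x)%R)%:E))%E.
  rewrite -H; last by move=> x; rewrite mule_ge0// lee_fin normal_pdf_ge0.
  by apply: eq_integral => x _; rewrite /affine !addr0 mulKf// gt_eqF.
rewrite -ge0_integralZl.
- by apply: eq_integral => x _; rewrite muleCA -EFinM -normal_pdf_scale.
- by [].
- by [].
- by move=> x _; rewrite mule_ge0// lee_fin normal_pdf_ge0.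
- by rewrite lee_fin invr_ge0 ltW.
Qed.

Lemma ge0_integral_normalN (f : measurableTypeR R -> \bar R) :
  measurable_fun setT f -> (forall x, 0 <= f x)%E ->
  (\int[gamma]_x f (- x)%R = \int[gamma]_x f x)%E.
Proof.
move=> mf f0.
have mfs : measurable_fun setT (fun x : measurableTypeR R => f (- x)%R).
  by apply: measurableT_comp.
rewrite [LHS](ge0_integral_normal_prob 0 1 mfs (fun=> f0 _)).
rewrite [RHS](ge0_integral_normal_prob 0 1 mf f0).
pose g x := (f x * (normal_pdf 0 1 x)%:E)%E.
have mg : measurable_fun setT g.
  apply: emeasurable_funM => //; apply/measurable_EFinP.
  exact: measurable_normal_pdf.
transitivity (\int[pushforward mu (-%R : _ -> measurableTypeR R)]_x g x)%E.
  have mN : measurable_fun setT (-%R : measurableTypeR R -> measurableTypeR R).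
    exact: oppr_measurable.
  have g0 : {in [set: measurableTypeR R], forall y, (0 <= g y)%E}.
    by move=> x _; rewrite /g mule_ge0// lee_fin normal_pdf_ge0.
  rewrite (ge0_integral_pushforward mN mu measurableT mg g0).
  apply: eq_integral => x _ /=; rewrite /g; congr (_ * _%:E)%E.
  by rewrite !normal_pdfE ?oner_neq0// /normal_fun !subr0 sqrrN.
apply: eq_measure_integral => A mA _; exact: lebesgue_measureN.
Qed.

(** Completing the square: the joint density of a summand y and the sum z is the density of the sum
    times the conditional density of y given z. *)
Lemma normal_pdf_conv a b y z : 0 < a -> 0 < b ->
  let c := Num.sqrt (a ^+ 2 + b ^+ 2) in
  normal_pdf 0 a y * normal_pdf 0 b (z - y) =
  normal_pdf 0 c z * normal_pdf (a ^+ 2 / c ^+ 2 * z) (a * b / c) y.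
Proof.
move=> a0 b0 c.
have c2 : c ^+ 2 = a ^+ 2 + b ^+ 2.
  by rewrite sqr_sqrtr// addr_ge0 ?sqr_ge0.
have ab0 : 0 < a ^+ 2 + b ^+ 2 by rewrite addr_gt0 ?exprn_gt0.
have c0 : 0 < c by rewrite sqrtr_gt0.
have d0 : 0 < a * b / c by rewrite divr_gt0 ?mulr_gt0.
rewrite !normal_pdfE ?gt_eqF// /normal_peak /normal_fun.
rewrite mulrACA [RHS]mulrACA -!expRD; congr (_ * expR _).
  rewrite -!invfM -!sqrtrM ?mulrn_wge0 ?mulr_ge0 ?sqr_ge0 ?pi_ge0 ?(ltW a0) ?(ltW b0) ?(ltW c0)//.
  congr (Num.sqrt _)^-1.
  by rewrite -[_ *+ 2]mulr_natr; field; rewrite gt_eqF.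
rewrite !subr0 !(expr_div_n, mulr2n) c2 exprMn.
field.
by rewrite ?(gt_eqF, addr_gt0, exprn_gt0, mulr_gt0).
Qed.

(** Tonelli, then [normal_pdf_conv]: for fixed z the conditional density integrates to 1 in y. *)
Lemma ge0_integral_normal_conv a b (f : measurableTypeR R -> \bar R) :
  0 < a -> 0 < b -> measurable_fun setT f -> (forall x, 0 <= f x)%E ->
  (\int[gamma]_y \int[gamma]_z f (a * y + b * z)%R =
   \int[gamma]_y f (Num.sqrt (a ^+ 2 + b ^+ 2) * y)%R)%E.
Proof.
move=> a0 b0 mf f0.
set c := Num.sqrt _.
have c0 : 0 < c by rewrite sqrtr_gt0 addr_gt0 ?exprn_gt0.
have mD (g h : (measurableTypeR R * measurableTypeR R)%type -> measurableTypeR R) :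
    measurable_fun setT g -> measurable_fun setT h ->
    measurable_fun setT (fun x => (g x + h x)%R : measurableTypeR R).
  by move=> mg mh; exact: measurable_funD.
have msh y : measurable_fun setT (fun z : measurableTypeR R => f (y + z)%R).
  by apply: measurableT_comp => //; exact: measurable_funD.
pose F2 (x : measurableTypeR R * measurableTypeR R) := f (x.1 + x.2)%R.
have mF2 : measurable_fun setT F2.
  by apply: (measurableT_comp mf); apply: mD.
pose F y := (\int[normal_prob 0 b]_z f (y + z)%R)%E.
have mF : measurable_fun setT F.
  apply: (@measurable_fun_fubini_tonelli_F _ _ _ _ R (normal_prob 0 b) F2) => // x.
  exact: f0.
have F0 y : (0 <= F y)%E by apply: integral_ge0.
transitivity (\int[gamma]_y F (a * y)%R)%E.
  apply: eq_integral => y _.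
  exact: (ge0_integral_normal_scale b0 (msh (a * y)%R)).
rewrite [LHS](ge0_integral_normal_scale a0 mF F0).
rewrite [RHS](ge0_integral_normal_scale c0 mf f0).
rewrite [LHS](ge0_integral_normal_prob 0 a mF F0).
rewrite [RHS](ge0_integral_normal_prob 0 c mf f0).
have mp m s : measurable_fun setT (fun x : measurableTypeR R => (normal_pdf m s x)%:E).
  by apply/measurable_EFinP; exact: measurable_normal_pdf.
have p0 m s (x : R) : (0 <= (normal_pdf m s x)%:E)%E.
  by rewrite lee_fin normal_pdf_ge0.
pose H (x : measurableTypeR R * measurableTypeR R) :=
  (f x.2 * (normal_pdf 0 b (x.2 - x.1)%R * normal_pdf 0 a x.1)%:E)%E.
have mH : measurable_fun setT H.
  apply: emeasurable_funM; first exact: measurableT_comp.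
  apply/measurable_EFinP; apply: measurable_funM.
    apply: (measurableT_comp (@measurable_normal_pdf R 0 b)).
    exact: measurable_funB.
  exact: (measurableT_comp (@measurable_normal_pdf R 0 a)).
have H0 x : (0 <= H x)%E.
  by rewrite /H mule_ge0// lee_fin mulr_ge0// normal_pdf_ge0.
transitivity (\int[mu]_y \int[mu]_z H (y, z))%E.
  apply: eq_integral => y _; rewrite /F (ge0_integral_normal_prob 0 b (msh y) (fun=> f0 _)).
  pose g (z : measurableTypeR R) := (f z * (normal_pdf 0 b (z - y)%R)%:E)%E.
  have mg : measurable_fun setT g.
    apply: emeasurable_funM => //; apply/measurable_EFinP.
    apply: (measurableT_comp (@measurable_normal_pdf R 0 b)).
    exact: measurable_funB.
  have g0 z : (0 <= g z)%E by rewrite mule_ge0.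
  have := @ge0_integral_affine R 1 y g ltr01 mg g0.
  rewrite invr1 mul1e => E.
  under eq_integral => z _.
    rewrite (_ : _ * _ = g (affine 1 y z))%E; last first.
      by rewrite /g /affine mul1r addrK addrC.
    over.
  rewrite /= E muleC -(ge0_integralZl mu measurableT mg (fun z _ => g0 z) (p0 0 a y)).
  by apply: eq_integral => z _; rewrite /g /H/= EFinM muleC muleA.
rewrite (fubini_tonelli _ mH H0).
apply: eq_integral => z _; rewrite /H/=.
transitivity (\int[mu]_y (f z * (normal_pdf 0 c z)%:E *
    (normal_pdf (a ^+ 2 / c ^+ 2 * z) (a * b / c) y)%:E))%E.
  apply: eq_integral => y _; by rewrite mulrC normal_pdf_conv// EFinM muleA.
rewrite (ge0_integralZl mu measurableT (mp _ _) (fun z _ => p0 _ _ z)).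
  by rewrite integral_normal_pdf mule1.
by rewrite mule_ge0.
Qed.

End gaussian.

(** * Moments of the standard Gaussian *)

Section gaussian_moments.
Context {R : realType}.
Local Notation mu := (@lebesgue_measure R).
Local Notation gamma := (normal_prob (0:R) 1).
Implicit Types a b s : R.

(** With v = x^2 / 8 the exponentials are exp(- 4 v) and exp(- v), and v^2 <= 2 exp(v). The wider
    density is integrable, which makes the fourth moment finite. *)
Lemma normal_quartic_tail (x : R) :
  x ^+ 4 * normal_pdf 0 1 x <=
  128 * (normal_peak 1 / normal_peak 2) * normal_pdf 0 2 x.
Proof.
have p2 : 0 < normal_peak (2 : R) by exact: normal_peak_gt0.
have p1 := normal_peak_ge0 (1 : R).
rewrite !normal_pdfE ?oner_neq0// /normal_fun !subr0 expr1n.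
have -> : - x ^+ 2 / (1 *+ 2) = - (4 * (x ^+ 2 / 8)) :> R by field.
have -> : - x ^+ 2 / (2 ^+ 2 *+ 2) = - (x ^+ 2 / 8) :> R by field.
have -> : x ^+ 4 = 64 * (x ^+ 2 / 8) ^+ 2 :> R by field.
have : 0 <= x ^+ 2 / 8 by rewrite divr_ge0 ?sqr_ge0.
move: (x ^+ 2 / 8) => v v0.
have -> : 128 * (normal_peak 1 / normal_peak 2) * (normal_peak 2 * expR (- v)) = normal_peak 1 * (128 * expR (- v)).
  by field; rewrite gt_eqF.
rewrite mulrCA ler_wpM2l//.
have := expR_ge1Dxn 1 v0; rewrite (_ : 2`!%:R = 2 :> R)// => h.
have -> : - (4 * v) = - v + (- v + (- v + - v)) by ring.
rewrite !expRD; have e0 := expR_gt0 (- v).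
have e1 : expR (- v) <= 1 by rewrite -expR0 ler_expR oppr_le0.
have h2 : v ^+ 2 * expR (- v) <= 2.
  have H : v ^+ 2 <= 2 * expR v by lra.
  by rewrite expRN ler_pdivrMr// expR_gt0.
have e2 : 0 <= v ^+ 2 * expR (- v) by rewrite mulr_ge0 ?sqr_ge0 ?ltW.
move: (expR (- v)) e0 e1 (v ^+ 2) h2 e2 => e e0 e1 w h2 e2.
have -> : 64 * w * (e * (e * (e * e))) = 64 * ((w * e) * (e * e)) * e by ring.
rewrite ler_wpM2r ?(ltW e0)//.
have ee0 : 0 <= e * e by rewrite mulr_ge0 ?ltW.
have ee1 : e * e <= 1 by rewrite mulr_ile1 ?(ltW e0).
by have := ler_pM e2 ee0 h2 ee1; lra.
Qed.

Lemma integrable_normal_quartic (f : R -> R) (A B : R) :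
  measurable_fun setT f -> (forall x, `|f x| <= A + B * x ^+ 4) ->
  gamma.-integrable setT (EFin \o f).
Proof.
move=> mf fAB.
have i4 : gamma.-integrable setT (EFin \o (fun x => x ^+ 4)).
  apply/integrableP; split.
    by apply/measurable_EFinP; exact: measurable_funX.
  have m4 : measurable_fun setT (fun x : measurableTypeR R => `|(x ^+ 4)%:E|)%E.
    apply/measurable_EFinP; apply: measurableT_comp => //; exact: measurable_funX.
  rewrite (ge0_integral_normal_prob 0 1 m4 (fun=> abse_ge0 _)).
  apply: (@le_lt_trans _ _ (\int[mu]_x ((128 * (normal_peak 1 / normal_peak 2))%:E * (normal_pdf 0 2 x)%:E))%E).
    apply: ge0_le_integral.
    - by [].
    - by move=> x _; rewrite mule_ge0// lee_fin normal_pdf_ge0.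
    - apply: emeasurable_funM => //; apply/measurable_EFinP.
      exact: measurable_normal_pdf.
    - apply: emeasurable_funM => //; apply/measurable_EFinP.
      exact: measurable_normal_pdf.
    - move=> x _; rewrite /= ger0_norm ?exprn_even_ge0// -!EFinM lee_fin.
      exact: normal_quartic_tail.
  rewrite (integralZl measurableT (integrable_normal_pdf 0 2)).
  by rewrite integral_normal_pdf mule1 ltry.
apply: (@le_integrable _ _ _ gamma setT measurableT _ (EFin \o (fun x => A + B * x ^+ 4))).
- exact/measurable_EFinP.
- by move=> x _; rewrite lee_fin (le_trans (fAB x))// ler_norm.
- rewrite /comp; under eq_fun do rewrite EFinD EFinM.
  apply: integrableD => //; first exact: finite_measure_integrable_cst.
  exact: integrableZl.
Qed.

Lemma Rintegral_normalN (f : R -> R) (A B : R) :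
  measurable_fun setT f -> (forall x, `|f x| <= A + B * x ^+ 4) ->
  (forall x, f (- x) = - f x) -> \int[gamma]_x f x = 0.
Proof.
move=> mf fAB fN.
have If := integrable_normal_quartic mf fAB.
have mN := oppr_measurable (D := [set: R]).
suff H : \int[gamma]_x f x = \int[gamma]_x f (- x).
  have E : \int[gamma]_x f (- x) = - \int[gamma]_x f x.
    rewrite -mulN1r -RintegralZl//; apply: eq_Rintegral => x _.
    by rewrite mulN1r.
  by apply/eqP; rewrite -eqNr -E H.
have mE : measurable_fun setT (EFin \o f) by exact/measurable_EFinP.
have mp : measurable_fun setT ((EFin \o f)^\+)%E by exact: measurable_funepos.
have mn : measurable_fun setT ((EFin \o f)^\-)%E by exact: measurable_funeneg.
rewrite /Rintegral; congr fine.
rewrite integralE [RHS]integralE; congr (_ - _)%E.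
  rewrite -(ge0_integral_normalN mp); last by move=> x; exact: funepos_ge0.
  by apply: eq_integral => x _; rewrite !funeposE.
rewrite -(ge0_integral_normalN mn); last by move=> x; exact: funeneg_ge0.
by apply: eq_integral => x _; rewrite !funenegE.
Qed.

Let g (y : R) := expR (- (y ^+ 2 / 2)).

Let dg (y : R) : is_derive y 1 (fun y : R => - y * g y) ((y ^+ 2 - 1) * g y).
Proof.
rewrite /g; apply: is_derive_eq; rewrite /GRing.scale/=.
by field.
Qed.

Let cg : continuous (fun y : R => (y ^+ 2 - 1) * g y).
Proof.
move=> x; apply: differentiable_continuous; apply/derivable1_diffP.
by rewrite /g; apply: ex_derive.
Qed.

Let FTC n : (\int[mu]_(y in `[(- n.+1%:R)%R, n.+1%:R]) ((y ^+ 2 - 1) * g y)%:E =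
  (- 2 * (n.+1%:R * g n.+1%:R))%:E)%E.
Proof.
have dF y : derivable (fun y : R => - y * g y) y 1 by have [] := dg y.
have cF : continuous (fun y : R => - y * g y).
  by move=> y; exact/differentiable_continuous/derivable1_diffP.
rewrite (@continuous_FTC2 _ _ (fun y : R => - y * g y)).
- by rewrite -EFinB /g sqrrN; congr EFin; ring.
- by rewrite (@lt_trans _ _ 0)// ?oppr_lt0.
- exact: continuous_subspaceT.
- split.
  + by move=> y _.
  + exact/cvg_at_right_filter/cF.
  + exact/cvg_at_left_filter/cF.
- by move=> y _; rewrite derive1E; have [_ ->] := dg y.
Qed.

(** (y^2 - 1) [g] y is the derivative of - y [g] y, so its integral over growing symmetric intervals
    tends to 0; dominated convergence then makes the second moment equal to the total mass. *)
Lemma Rintegral_normal_sqr : \int[gamma]_x (x ^+ 2) = 1.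
Proof.
have msq : measurable_fun setT (fun x : measurableTypeR R => x ^+ 2).
  exact: measurable_funX.
have i2 : gamma.-integrable setT (EFin \o (fun x : R => x ^+ 2)).
  apply: (@integrable_normal_quartic _ 1 1) => // x.
  by rewrite ger0_norm ?sqr_ge0//; nra.
pose p : measurableTypeR R -> R := normal_pdf 0 1.
have mp : measurable_fun setT p by exact: measurable_normal_pdf.
have p0 x : 0 <= p x by exact: normal_pdf_ge0.
have pE x : p x = normal_peak 1 * g x.
  rewrite /p normal_pdfE ?oner_neq0// /normal_fun subr0 expr1n /g.
  by rewrite mulNr.
have iE : (\int[gamma]_x (x ^+ 2)%:E = \int[mu]_x (x ^+ 2 * p x)%:E)%E.
  rewrite (ge0_integral_normal_prob 0 1).
  - by apply: eq_integral => x _; rewrite EFinM.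
  - exact/measurable_EFinP.
  - by move=> x; rewrite lee_fin sqr_ge0.
have ifin : (\int[gamma]_x (x ^+ 2)%:E \is a fin_num)%E.
  exact: integrable_fin_num.
have i2p : mu.-integrable setT (EFin \o (fun x : R => x ^+ 2 * p x)).
  apply/integrableP; split; first exact/measurable_EFinP/measurable_funM.
  rewrite (_ : (\int[mu]_x _)%E = (\int[gamma]_x (x ^+ 2)%:E)%E).
    by rewrite -ge0_fin_numE// integral_ge0// => x _; rewrite lee_fin sqr_ge0.
  rewrite iE; apply: eq_integral => x _.
  by rewrite /= ger0_norm// mulr_ge0 ?sqr_ge0.
pose f x := (x ^+ 2 - 1) * p x.
have ip : mu.-integrable setT (EFin \o p) by exact: integrable_normal_pdf.
have fE x : (f x)%:E = ((x ^+ 2 * p x)%:E - (p x)%:E)%E.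
  by rewrite -EFinB /f mulrBl mul1r.
have if_ : mu.-integrable setT (EFin \o f).
  rewrite (_ : EFin \o f = (fun x => (x ^+ 2 * p x)%:E - (p x)%:E)%E).
    exact: integrableB.
  exact/funext.
have mf : measurable_fun setT (EFin \o f) by case/integrableP : if_.
pose D n : set (measurableTypeR R) := `[(- n.+1%:R), n.+1%:R]%classic.
have mD n : measurable (D n) by exact: measurable_itv.
have fn n : (\int[mu]_x ((EFin \o f) \_ (D n)) x =
    (- 2 * normal_peak 1 * (n.+1%:R * g n.+1%:R))%:E)%E.
  rewrite -integral_mkcond (_ : - 2 * _ * _ =
    normal_peak 1 * (- 2 * (n.+1%:R * g n.+1%:R))); last by ring.
  rewrite EFinM -FTC -integralZl//; last first.
    by apply: continuous_compact_integrable;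
      [exact: segment_compact|exact: continuous_subspaceT].
  by apply: eq_integral => x _; rewrite /= -EFinM /f pE mulrCA.
have cv0 : ((\int[mu]_x ((EFin \o f) \_ (D n)) x)%E @[n --> \oo] --> 0%E)%classic.
  under eq_fun do rewrite fn.
  apply: cvg_EFin; first exact: nearW.
  rewrite (_ : _ \o _ = fun n => - 2 * normal_peak 1 * (n.+1%:R * g n.+1%:R)); last exact/funext.
  rewrite -[X in _ --> X](mulr0 (- 2 * normal_peak 1)); apply: cvgM; first exact: cvg_cst.
  (* The boundary term satisfies n exp(- n^2 / 2) <= 2 / n because exp(u) >= 1 + u. *)
  apply: (@squeeze_cvgr _ _ _ _ (fun=> 0) (fun n => 2 * harmonic n)).
  - apply: nearW => n; rewrite mulr_ge0 ?expR_ge0//= /harmonic ler_pdivlMr//.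
    rewrite /g expRN mulrAC ler_pdivrMr ?expR_gt0//.
    by have := expR_ge1Dx (n.+1%:R ^+ 2 / 2 : R); rewrite expr2; lra.
  - exact: cvg_cst.
  - rewrite -[X in _ --> X](mulr0 2); apply: cvgM; first exact: cvg_cst.
    exact: cvg_harmonic.
have fcv x : setT x -> ((EFin \o f) \_ (D n)) x @[n --> \oo] --> (EFin \o f) x.
  move=> _; apply: cvg_near_cst; exists (Num.truncn `|x|).+1 => // n /= xn.
  rewrite patchE mem_set//= /D/= in_itv/= -ler_norml.
  rewrite ltW// (lt_le_trans (truncnS_gt _))// ler_nat.
  exact: leqW.
have fdom x : forall n, setT x -> (`|((EFin \o f) \_ (D n)) x| <= `|(f x)%:E|)%E.
  by move=> n _; rewrite patchE; case: ifPn => // _; rewrite abse0.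
have [_ _ cv] := @dominated_convergence _ _ _ mu setT measurableT
  (fun n => (EFin \o f) \_ (D n)) (EFin \o f) (fun x => `|(f x)%:E|)%E
  (fun n => (measurable_restrictT _ (mD n)).1 (measurable_funTS mf)) mf
  (aeW _ fcv) (integrable_abse if_) (aeW _ fdom).
have f0 : (\int[mu]_x (f x)%:E = 0)%E by apply: (cvg_unique _ cv cv0).
move: f0; under eq_integral do rewrite fE.
rewrite integralB// integral_normal_pdf -iE /Rintegral.
rewrite -(fineK ifin) -EFinB => -[] /eqP; rewrite subr_eq0 => /eqP ->//.
Qed.

End gaussian_moments.

(** * Gaussian smoothing and Taylor jets *)

Section Rintegral_comb.
Context d (T : measurableType d) (R : realType) (P : probability T R).

(** Linear combinations are encoded as lists of weighted functions, so that a pointwise bound on a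
    linear expression passes to its integral in a single application. *)
Fixpoint integrable_seq (s : seq (R * (T -> R))) : Prop :=
  if s is p :: s' then P.-integrable setT (EFin \o p.2) /\ integrable_seq s'
  else True.

Lemma Rintegral_comb s : integrable_seq s ->
  P.-integrable setT (EFin \o (fun x => \sum_(p <- s) p.1 * p.2 x)) /\
  \int[P]_x (\sum_(p <- s) p.1 * p.2 x) = \sum_(p <- s) p.1 * \int[P]_x p.2 x.
Proof.
elim: s => [_|p s IH [ip /IH[Is Es]]].
  split.
    rewrite (_ : _ \o _ = cst 0%E); first exact: integrable0.
    by apply/funext => x; rewrite /= big_nil.
  under eq_Rintegral do rewrite big_nil.
  by rewrite big_nil Rintegral_cst// mul0r.
have ipp : P.-integrable setT (EFin \o (fun x => p.1 * p.2 x)).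
  rewrite (_ : _ \o _ = (fun x => p.1%:E * (EFin \o p.2) x)%E).
    exact: integrableZl.
  by apply/funext => x; rewrite /= EFinM.
split.
  rewrite (_ : _ \o _ = (fun x => ((p.1 * p.2 x)%R%:E +
     (\sum_(p <- s) p.1 * p.2 x)%R%:E)%E)).
    exact: integrableD.
  by apply/funext => x; rewrite /= big_cons EFinD.
under eq_Rintegral do rewrite big_cons.
by rewrite RintegralD// big_cons RintegralZl// Es.
Qed.

Lemma Rintegral_comb_le s (g : T -> R) : integrable_seq s ->
  P.-integrable setT (EFin \o g) ->
  (forall x, `|\sum_(p <- s) p.1 * p.2 x| <= g x) ->
  `|\sum_(p <- s) p.1 * \int[P]_x p.2 x| <= \int[P]_x g x.
Proof.
move=> /Rintegral_comb[Is <-] ig sg.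
apply: (le_trans (le_normr_Rintegral measurableT Is)).
apply: le_Rintegral => //; exact: (integrable_norm Is).
Qed.

Lemma integrable_cst (K : R) : P.-integrable setT (EFin \o (fun=> K)).
Proof. exact: finite_measure_integrable_cst. Qed.

Lemma Rintegral_cstP (K : R) : \int[P]_x K = K.
Proof. rewrite Rintegral_cst//.
set p := fine _; have -> : p = 1 by rewrite /p; have /= -> := probability_setT P.
by rewrite mulr1. Qed.

Lemma Rintegral_comb_le_cst s (K : R) : integrable_seq s ->
  (forall x, `|\sum_(p <- s) p.1 * p.2 x| <= K) ->
  `|\sum_(p <- s) p.1 * \int[P]_x p.2 x| <= K.
Proof.
move=> Is sK; rewrite -[leRHS]Rintegral_cstP.
by apply: Rintegral_comb_le => //; exact: integrable_cst.
Qed.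

End Rintegral_comb.

Section lip.
Context {R : realType}.
Implicit Types (h : R -> R) (C s x y : R).

Definition lip C h := forall x y, `|h x - h y| <= C * `|x - y|.

Lemma lip_ge0 C h : lip C h -> 0 <= C.
Proof.
by move=> /(_ 1 0); rewrite subr0 normr1 mulr1; apply: le_trans.
Qed.

Lemma lip_continuous C h : lip C h -> continuous h.
Proof.
move=> hC x; apply/cvgrPdist_lt => e e0.
have C1 : 0 < C + 1 by have := lip_ge0 hC; lra.
near=> y; apply: le_lt_trans (hC x y) _.
apply: (@le_lt_trans _ _ ((C + 1) * `|x - y|)).
  by rewrite ler_wpM2r// lerDl.
rewrite -ltr_pdivlMl//; near: y.
by apply: (@cvgr_dist_lt _ R^o); [exact: cvg_id|rewrite mulr_gt0 ?invr_gt0].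
Unshelve. all: by end_near. Qed.

Lemma lip_measurable C h : lip C h -> measurable_fun setT h.
Proof. by move=> /lip_continuous; exact: continuous_measurable_fun. Qed.

Lemma lip_affine C h x s : lip C h -> lip (C * `|s|) (fun y => h (x + s * y)).
Proof.
move=> hC y z; apply: le_trans (hC _ _) _.
by rewrite -mulrA -normrM (_ : x + s * y - (x + s * z) = s * (y - z)); last by ring.
Qed.

Lemma lip_growth C h y : lip C h -> `|h y| <= `|h 0| + C * `|y|.
Proof.
move=> hC; have := hC y 0; rewrite subr0 => H.
rewrite -[X in `|X|](subrK (h 0)); apply: le_trans (ler_normD _ _) _.
by rewrite addrC lerD.
Qed.

Lemma lipN C h : lip C h -> lip C (fun y => `|h y|).
Proof. by move=> hC x y; apply: le_trans (hC x y); exact: ler_dist_dist. Qed.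

Lemma lipD C D h g : lip C h -> lip D g -> lip (C + D) (fun y => h y + g y).
Proof.
move=> hC gD x y; rewrite opprD addrACA mulrDl.
by apply: le_trans (ler_normD _ _) _; rewrite lerD.
Qed.

Lemma lipZ C h a : lip C h -> lip (`|a| * C) (fun y => a * h y).
Proof. by move=> hC x y; rewrite -mulrBr normrM -mulrA ler_wpM2l. Qed.

End lip.

Section gauss_smooth.
Context {R : realType}.
Local Notation gamma := (normal_prob (0:R) 1).
Implicit Types (h : R -> R) (C s x y : R).

Lemma lip_integrable C h : lip C h -> gamma.-integrable setT (EFin \o h).
Proof.
move=> hC; apply: (@integrable_normal_quartic _ _ (`|h 0| + C) C).
  exact: lip_measurable hC.
move=> x; apply: le_trans (lip_growth x hC) _.
have C0 := lip_ge0 hC; rewrite -addrA lerD2l -[X in X + _]mulr1 -mulrDr ler_wpM2l//.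
rewrite (_ : x ^+ 4 = `|x| ^+ 4); last by rewrite -normrX ger0_norm// exprn_even_ge0.
have : 0 <= `|x| by []. move: `|x| => u u0.
have [u1|/ltW u1] := leP u 1; first by rewrite (le_trans u1)// lerDl exprn_ge0.
by rewrite (@le_trans _ _ (u ^+ 4)) ?lerDr// -[leLHS]expr1 ler_weXn2l.
Qed.

(* [gs s h x] is E h(x + s N) with N standard Gaussian. *)
Definition gs s h x := \int[gamma]_y h (x + s * y).

Lemma gs_integrable C h s x : lip C h ->
  gamma.-integrable setT (EFin \o (fun y => h (x + s * y))).
Proof. by move=> /(lip_affine x s)/lip_integrable. Qed.

Lemma gs0 h x : gs 0 h x = h x.
Proof.
rewrite /gs; under eq_Rintegral do rewrite mul0r addr0.
exact: Rintegral_cstP.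
Qed.

Lemma lip_gs C h s : lip C h -> lip C (gs s h).
Proof.
move=> hC x y; rewrite /gs.
have := @Rintegral_comb_le_cst _ _ _ gamma
  [:: (1, fun z => h (x + s * z)); (-1, fun z => h (y + s * z))]
  (C * `|x - y|).
rewrite !big_cons big_nil/= addr0 mul1r mulN1r; apply.
  by do !split => //; exact: gs_integrable hC.
move=> z; rewrite !big_cons big_nil/= addr0 mul1r mulN1r.
by apply: le_trans (hC _ _) _; rewrite opprD addrACA subrr addr0.
Qed.

Lemma ge0_gs_conv C h a b x : 0 < a -> 0 < b -> lip C h -> (forall y, 0 <= h y) ->
  gs a (gs b h) x = gs (Num.sqrt (a ^+ 2 + b ^+ 2)) h x.
Proof.
move=> a0 b0 hC h0; rewrite /gs /Rintegral; congr fine.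
pose f (y : measurableTypeR R) : \bar R := (h (x + y))%:E.
have mf : measurable_fun setT f.
  apply/measurable_EFinP; apply: measurableT_comp; first exact: lip_measurable hC.
  exact: measurable_funD.
have f0 y : (0 <= f y)%E by rewrite lee_fin.
have := ge0_integral_normal_conv a0 b0 mf f0; rewrite /f => <-.
apply: eq_integral => y _.
rewrite fineK; last by apply: (integrable_fin_num measurableT (gs_integrable _ _ hC)).
by apply: eq_integral => z _; rewrite addrA.
Qed.

Lemma gs_comb C D h g s x a b : lip C h -> lip D g ->
  gs s (fun y => a * h y + b * g y) x = a * gs s h x + b * gs s g x.
Proof.
move=> hC gD; have := @Rintegral_comb _ _ _ gamma
  [:: (a, fun z => h (x + s * z)); (b, fun z => g (x + s * z))].
case; first by do !split => //; [exact: gs_integrable hC|exact: gs_integrable gD].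
rewrite !big_cons big_nil/= addr0 => _ <-.
by apply: eq_Rintegral => z _; rewrite !big_cons big_nil/= addr0.
Qed.

(** [h] is the difference of the nonnegative Lipschitz functions h + |h| and |h|, which reduces the
    claim to [ge0_gs_conv]. The case b = 0 occurs at the start of the interpolation, where nothing
    has been smoothed yet. *)
Lemma gs_conv C h a b x : 0 < a -> 0 <= b -> lip C h ->
  gs a (gs b h) x = gs (Num.sqrt (a ^+ 2 + b ^+ 2)) h x.
Proof.
move=> a0; rewrite le_eqVlt => /predU1P[<- hC|b0 hC].
  rewrite expr0n addr0 sqrtr_sqr gtr0_norm//.
  by apply: eq_Rintegral => y _; rewrite gs0.
have nC := lipN hC; have pC := lipD hC nC.
have hE : h = (fun y => 1 * (h y + `|h y|) + (-1) * `|h y|).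
  by apply/funext => y; rewrite mul1r mulN1r addrK.
rewrite hE (_ : gs b _ = fun y => 1 * gs b (fun y => h y + `|h y|) y +
    (-1) * gs b (fun y => `|h y|) y); last first.
  by apply/funext => y; rewrite (gs_comb _ _ _ _ pC nC).
rewrite (gs_comb _ _ _ _ (lip_gs b pC) (lip_gs b nC)) (gs_comb _ _ _ _ pC nC).
rewrite (ge0_gs_conv _ a0 b0 pC) ?(ge0_gs_conv _ a0 b0 nC)// => y.
by rewrite -lerBlDl sub0r -normrN ler_norm.
Qed.

End gauss_smooth.

Section jets.
Context {R : realType}.
Local Notation gamma := (normal_prob (0:R) 1).
Implicit Types (h : nat -> R -> R) (C s x t : R).

(* The [h k] play the role of the derivatives of [h 0]; unlike derivatives, such
   families are readily closed under translation and Gaussian smoothing. *)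
Record jet C h : Prop := Jet {
  jet_lip : forall k, (k < 4)%N -> lip C (h k);
  jet_bnd2 : forall x, `|h 2%N x| <= C;
  jet_bnd3 : forall x, `|h 3%N x| <= C;
  jet_taylor4 : forall x t,
    `|h 0%N (x + t) - (h 0%N x + t * h 1%N x + t ^+ 2 / 2 * h 2%N x + t ^+ 3 / 6 * h 3%N x)|
    <= C * t ^+ 4;
  jet_taylor2 : forall x t, `|h 2%N (x + t) - (h 2%N x + t * h 3%N x)| <= C * t ^+ 2
}.

Lemma jet_translate C h c : jet C h -> jet C (fun k x => h k (x + c)).
Proof.
case=> hL h2 h3 T4 T2; split => [k k4 x y|x|x|x t|x t] //.
- by have := hL k k4 (x + c) (y + c); rewrite opprD addrACA subrr addr0.
- by have := T4 (x + c) t; rewrite addrAC.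
- by have := T2 (x + c) t; rewrite addrAC.
Qed.

(** Every clause of [jet] is linear in the family and uniform in the base point, so it survives
    averaging over x + s y with the same [C]. This takes the place of differentiation under the
    integral sign. *)
Lemma jet_gs C h s : jet C h -> jet C (fun k => gs s (h k)).
Proof.
case=> hL h2 h3 T4 T2.
have I k x : (k < 4)%N -> gamma.-integrable setT (EFin \o (fun y => h k (x + s * y))).
  by move=> k4; apply: gs_integrable (hL k k4).
split => [k k4|x|x|x t|x t].
- exact: lip_gs (hL k k4).
- have := @Rintegral_comb_le_cst _ _ _ gamma [:: (1, fun y => h 2%N (x + s * y))] C.
  rewrite big_seq1 mul1r; apply; first by split => //; exact: I.
  by move=> y; rewrite big_seq1/= mul1r; exact: h2.
- have := @Rintegral_comb_le_cst _ _ _ gamma [:: (1, fun y => h 3%N (x + s * y))] C.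
  rewrite big_seq1 mul1r; apply; first by split => //; exact: I.
  by move=> y; rewrite big_seq1/= mul1r; exact: h3.
- have := @Rintegral_comb_le_cst _ _ _ gamma
    [:: (1, fun y => h 0%N (x + t + s * y)); (-1, fun y => h 0%N (x + s * y));
        (- t, fun y => h 1%N (x + s * y)); (- (t ^+ 2 / 2), fun y => h 2%N (x + s * y));
        (- (t ^+ 3 / 6), fun y => h 3%N (x + s * y))] (C * t ^+ 4).
  rewrite !big_cons big_nil/= => H.
  rewrite (_ : _ - _ = 1 * gs s (h 0%N) (x + t) + (-1 * gs s (h 0%N) x +
    (- t * gs s (h 1%N) x + (- (t ^+ 2 / 2) * gs s (h 2%N) x +
    (- (t ^+ 3 / 6) * gs s (h 3%N) x + 0))))); last by ring.
  apply: H; first by do !split; exact: I.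
  move=> y; rewrite !big_cons big_nil/=; have := T4 (x + s * y) t.
  by rewrite (addrAC x t); congr (`|_| <= _); ring.
- have := @Rintegral_comb_le_cst _ _ _ gamma
    [:: (1, fun y => h 2%N (x + t + s * y)); (-1, fun y => h 2%N (x + s * y));
        (- t, fun y => h 3%N (x + s * y))] (C * t ^+ 2).
  rewrite !big_cons big_nil/= => H.
  rewrite (_ : _ - _ = 1 * gs s (h 2%N) (x + t) + (-1 * gs s (h 2%N) x +
    (- t * gs s (h 3%N) x + 0))); last by ring.
  apply: H; first by do !split; exact: I.
  move=> y; rewrite !big_cons big_nil/=; have := T2 (x + s * y) t.
  by rewrite (addrAC x t); congr (`|_| <= _); ring.
Qed.

Definition m4 : R := \int[gamma]_y (y ^+ 4).

Lemma norm_exp_le_quartic k (x : R) : (k <= 4)%N -> `|x ^+ k| <= 1 + 1 * x ^+ 4.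
Proof.
move=> k4; rewrite mul1r normrX (_ : x ^+ 4 = `|x| ^+ 4); last first.
  by rewrite -normrX ger0_norm// exprn_even_ge0.
have : 0 <= `|x| by []. move: `|x| => u u0.
have [u1|/ltW u1] := leP u 1.
  by rewrite (@le_trans _ _ 1) ?exprn_ile1// lerDl exprn_ge0.
by rewrite (@le_trans _ _ (u ^+ 4)) ?lerDr// ler_weXn2l.
Qed.

Lemma integrable_gauss_exp k : (k <= 4)%N ->
  gamma.-integrable setT (EFin \o (fun y : R => y ^+ k)).
Proof.
move=> k4; apply: (@integrable_normal_quartic _ _ 1 1).
  exact: measurable_funX.
by move=> x; exact: norm_exp_le_quartic.
Qed.

Lemma m4_ge0 : 0 <= m4.
Proof. by apply: Rintegral_ge0 => x _; rewrite exprn_even_ge0. Qed.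

(** The fourth-order Taylor bound is integrated against the Gaussian, whose first and third moments
    vanish and whose second moment is 1. *)
Lemma jet_gs_taylor C h s x : jet C h ->
  `|gs s (h 0%N) x - (h 0%N x + s ^+ 2 / 2 * h 2%N x)| <= C * s ^+ 4 * m4.
Proof.
move=> hj; have [hL h2 h3 T4 T2] := hj.
have m1 : \int[gamma]_y y = 0.
  by apply: (@Rintegral_normalN _ _ 1 1) => // y; exact: (@norm_exp_le_quartic 1).
have m3 : \int[gamma]_y (y ^+ 3) = 0.
  apply: (@Rintegral_normalN _ _ 1 1) => [|y|y].
  - exact: measurable_funX.
  - exact: norm_exp_le_quartic.
  - by rewrite exprNn -signr_odd/= mulN1r.
have := @Rintegral_comb_le _ _ _ gamma
  [:: (1, fun y => h 0%N (x + s * y)); (-1, fun=> h 0%N x);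
      (- (s * h 1%N x), fun y => y); (- (s ^+ 2 / 2 * h 2%N x), fun y => y ^+ 2);
      (- (s ^+ 3 / 6 * h 3%N x), fun y => y ^+ 3)]
  (fun y => C * s ^+ 4 * y ^+ 4).
rewrite !big_cons big_nil/= m1 m3 Rintegral_normal_sqr Rintegral_cstP.
rewrite RintegralZl// ?integrable_gauss_exp// -/m4 => H.
rewrite (_ : _ - _ = 1 * gs s (h 0%N) x + (-1 * h 0%N x +
  (- (s * h 1%N x) * 0 + (- (s ^+ 2 / 2 * h 2%N x) * 1 +
  (- (s ^+ 3 / 6 * h 3%N x) * 0 + 0))))); last by ring.
apply: H.
- have e1 := @integrable_gauss_exp 1 isT.
  have e2 := @integrable_gauss_exp 2 isT.
  have e3 := @integrable_gauss_exp 3 isT.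
  by do !split => //; [exact: gs_integrable (hL 0%N isT)|exact: integrable_cst].
- rewrite (_ : _ \o _ = (fun y : R => ((C * s ^+ 4)%R%:E * (y ^+ 4)%R%:E)%E)).
    by apply: integrableZl => //; exact: (@integrable_gauss_exp 4).
  by apply/funext => y; rewrite /= EFinM.
- move=> y; rewrite !big_cons big_nil/=; have := T4 x (s * y).
  rewrite !exprMn (mulrA C); congr (`|_| <= _); ring.
Qed.

End jets.

(** * One step of the recursion against one Gaussian step *)

Section expansion.
Context {R : realType} d (Omega : measurableType d) (P : probability Omega R).
Variables (alpha : R) (Y : Omega -> R) (D : Omega -> bool).
Implicit Types (h : nat -> R -> R) (C r x y : R) (F : R -> bool -> R).

Let s := Num.sqrt alpha.
Let q := 1 - alpha.

(** [scl] is the amplitude c that follows a coin. The computations rest on [scl] = 3/2 - 1/2 [sgb]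
    and on the square of [scl] being 5/2 - 3/2 [sgb]. *)
Definition sgb (b : bool) : R := if b then 1 else -1.
Definition scl (b : bool) : R := if b then 1 else 2.

Definition okF F := forall b, exists C, lip C (F^~ b).

(** [Y] is the scaled iterate and [D] the last coin it has absorbed; the pair holds all that the
    next step depends on, since the next noise is a fresh sign times [scl] of [D]. *)
Definition pair_mean F := \int[P]_w F (Y w) (D w).

Hypothesis alpha01 : 0 < alpha < 1.
Hypothesis mY : measurable_fun setT Y.
Hypothesis mD : measurable_fun setT D.
Hypothesis Yb : forall w, `|Y w| <= 2 / s.
Hypothesis stat : forall F, okF F ->
  pair_mean F = pair_mean (fun y b => (F (q * y + s * scl b) true + F (q * y - s * scl b) false) / 2).

Let a0 : 0 < alpha. Proof. by case/andP: alpha01. Qed.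
Let a1 : alpha < 1. Proof. by case/andP: alpha01. Qed.
Let s0 : 0 < s. Proof. by rewrite sqrtr_gt0. Qed.
Let s2 : s ^+ 2 = alpha. Proof. by rewrite sqr_sqrtr// ltW. Qed.
Let q0 : 0 < q. Proof. by rewrite subr_gt0. Qed.
Let q1 : q < 1. Proof. by rewrite /q ltrBlDr ltrDl. Qed.

Lemma okF_lip C f a e (c : bool -> R) : lip C f ->
  okF (fun y b => c b * f (e b + a * y)).
Proof. by move=> fC b; exists (`|c b| * (C * `|a|)); exact/lipZ/lip_affine. Qed.

Lemma okF_avg F : okF F ->
  okF (fun y b => (F (q * y + s * scl b) true + F (q * y - s * scl b) false) / 2).
Proof.
move=> oF b; have [C hC] := oF true; have [C' hC'] := oF false.
have L1 : lip (C * `|q|) (fun y => F (q * y + s * scl b) true).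
  by move=> x y; have := lip_affine (s * scl b) q hC x y; rewrite ![_ + q * _]addrC.
have L2 : lip (C' * `|q|) (fun y => F (q * y - s * scl b) false).
  by move=> x y; have := lip_affine (- (s * scl b)) q hC' x y; rewrite ![_ + q * _]addrC.
exists (`|2^-1| * (C * `|q| + C' * `|q|)) => x y.
by have := lipZ 2^-1 (lipD L1 L2) x y; rewrite !(mulrC 2^-1).
Qed.

Lemma pair_mean_integrable F : okF F ->
  P.-integrable setT (EFin \o (fun w => F (Y w) (D w))).
Proof.
move=> oF; have [C hC] := oF true; have [C' hC'] := oF false.
have FE : (fun w => F (Y w) (D w)) = (fun w => if D w then F (Y w) true else F (Y w) false).
  by apply/funext => w; case: (D w).
apply: (measurable_bounded_integrable measurableT).
- by rewrite (@le_lt_trans _ _ 1%E) ?probability_le1 ?ltry.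
- rewrite FE; apply: measurable_fun_ifT => //.
    exact: (measurableT_comp (lip_measurable hC) mY).
  exact: (measurableT_comp (lip_measurable hC') mY).
- exists (`|F 0 true| + C * (2 / s) + (`|F 0 false| + C' * (2 / s))).
  have C0 := lip_ge0 hC; have C0' := lip_ge0 hC'.
  have s20 : 0 <= 2 / s by rewrite divr_ge0 ?ltW.
  split; first exact: num_real.
  move=> M /ltW MM w _; apply: le_trans MM.
  case: (D w); [apply: (le_trans (lip_growth _ hC))|apply: (le_trans (lip_growth _ hC'))].
    apply: (@le_trans _ _ (`|F 0 true| + C * (2 / s))).
      by rewrite lerD2l ler_wpM2l.
    by rewrite lerDl; exact: addr_ge0 (normr_ge0 _) (mulr_ge0 C0' s20).
  apply: (@le_trans _ _ (`|F 0 false| + C' * (2 / s))).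
    by rewrite lerD2l ler_wpM2l.
  by rewrite lerDr; exact: addr_ge0 (normr_ge0 _) (mulr_ge0 C0 s20).
Qed.

Fixpoint okFs (l : seq (R * (R -> bool -> R))) : Prop :=
  if l is p :: l' then okF p.2 /\ okFs l' else True.

Lemma pair_mean_comb_le (l : seq (R * (R -> bool -> R))) (K : R) : okFs l ->
  (forall w, `|\sum_(p <- l) p.1 * p.2 (Y w) (D w)| <= K) ->
  `|\sum_(p <- l) p.1 * pair_mean p.2| <= K.
Proof.
move=> ol lK.
pose l' := [seq (p.1, fun w => p.2 (Y w) (D w)) | p <- l].
have := @Rintegral_comb_le_cst _ _ _ P l' K.
rewrite big_map; apply.
  rewrite /l'; elim: l ol {lK l'} => //= p l IH [op ol]; split.
    exact: pair_mean_integrable.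
  exact: IH.
by move=> w; rewrite big_map; exact: lK.
Qed.

Lemma okF_scale (c : bool -> R) a C f : lip C f -> okF (fun y b => c b * f (a * y)).
Proof.
move=> fC b; have [C' H] := @okF_lip _ _ a (fun=> 0) c fC b.
by exists C' => x y; have := H x y; rewrite !add0r.
Qed.

Lemma okF_scale1 a C f : lip C f -> okF (fun y _ => f (a * y)).
Proof.
move=> fC b; have [C' H] := okF_scale (fun=> 1) a fC b.
by exists C' => x y; have := H x y; rewrite !mul1r.
Qed.

(** The new coin is fair, so the odd orders of the expansion at r q y cancel. Half the squared
    amplitude is 5/4 - 3/4 [sgb], which gives the two second-order terms; 16 is the largest fourth
    power of [scl]. *)
Lemma pair_mean_jet C h r : jet C h -> 0 <= r <= 1 ->
  `|pair_mean (fun y _ => h 0%N (r * y)) - pair_mean (fun y _ => h 0%N (r * q * y))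
    - 5 / 4 * r ^+ 2 * alpha * pair_mean (fun y _ => h 2%N (r * q * y))
    + 3 / 4 * r ^+ 2 * alpha * pair_mean (fun y b => sgb b * h 2%N (r * q * y))|
  <= 16 * C * r ^+ 4 * alpha ^+ 2.
Proof.
case=> hL h2 h3 T4 T2 /andP[r0 r1].
have ok c a k (k4 : (k < 4)%N) := okF_scale c a (hL k k4).
have ok1 a k (k4 : (k < 4)%N) := okF_scale1 a (hL k k4).
rewrite (stat (ok1 r 0%N isT)).
set A := fun _ _ => _ / 2.
have := @pair_mean_comb_le [:: (1, A); (-1, fun y _ => h 0%N (r * q * y));
  (- (5 / 4 * r ^+ 2 * alpha), fun y _ => h 2%N (r * q * y));
  (3 / 4 * r ^+ 2 * alpha, fun y b => sgb b * h 2%N (r * q * y))]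
  (16 * C * r ^+ 4 * alpha ^+ 2).
rewrite !big_cons big_nil/= => H.
rewrite [X in `|X|](_ : _ = 1 * pair_mean A + (-1 * pair_mean (fun y _ => h 0%N (r * q * y)) +
  (- (5 / 4 * r ^+ 2 * alpha) * pair_mean (fun y _ => h 2%N (r * q * y)) +
  (3 / 4 * r ^+ 2 * alpha * pair_mean (fun y b => sgb b * h 2%N (r * q * y)) + 0)))); last by ring.
apply: H.
  do !split; try exact: ok; try exact: ok1.
  exact: (okF_avg (ok1 r 0%N isT)).
move=> w; rewrite !big_cons big_nil/= /A.
move: (Y w) => y; have C0 := lip_ge0 (hL 0%N isT).
have key (b : bool) : 5 / 4 * r ^+ 2 * alpha - 3 / 4 * r ^+ 2 * alpha * sgb b =
    (r * s * scl b) ^+ 2 / 2.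
  by rewrite !exprMn s2 /sgb /scl; case: b; field.
have kb (b : bool) : C * (r * s * scl b) ^+ 4 <= 16 * C * r ^+ 4 * alpha ^+ 2.
  rewrite (_ : _ ^+ 4 = r ^+ 4 * alpha ^+ 2 * scl b ^+ 4); last first.
    by rewrite -s2; ring.
  rewrite [leRHS](_ : _ = C * (r ^+ 4 * alpha ^+ 2 * 16)); last by ring.
  rewrite ler_wpM2l// ler_wpM2l ?mulr_ge0 ?exprn_ge0 ?(ltW a0)//.
  by rewrite /scl; case: b; [rewrite expr1n ler1n|rewrite -natrX ler_nat].
move: (D w) => b; have kb' := kb b; have key' := key b.
have p1 := T4 (r * q * y) (r * s * scl b).
have p2 := T4 (r * q * y) (- (r * s * scl b)).
have e4 : (- (r * s * scl b)) ^+ 4 = (r * s * scl b) ^+ 4 by ring.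
rewrite e4 in p2.
set t := r * s * scl b in kb' key' p1 p2.
rewrite (_ : r * (q * y + s * scl b) = r * q * y + t); last by rewrite /t; ring.
rewrite (_ : r * (q * y - s * scl b) = r * q * y - t); last by rewrite /t; ring.
set z := r * q * y in p1 p2 *.
rewrite [X in `|X|](_ : _ = 2^-1 *
   ((h 0%N (z + t) - (h 0%N z + t * h 1%N z + t ^+ 2 / 2 * h 2%N z + t ^+ 3 / 6 * h 3%N z)) +
    (h 0%N (z - t) - (h 0%N z + - t * h 1%N z + (- t) ^+ 2 / 2 * h 2%N z + (- t) ^+ 3 / 6 * h 3%N z)))).
  rewrite normrM ger0_norm ?invr_ge0// ler_pdivrMl// (le_trans (ler_normD _ _))//.
  by rewrite (_ : 2 * _ = 16 * C * r ^+ 4 * alpha ^+ 2 + 16 * C * r ^+ 4 * alpha ^+ 2);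
    [rewrite lerD// (le_trans _ kb')|ring].
transitivity ((h 0%N (z + t) + h 0%N (z - t)) / 2 - h 0%N z - (t ^+ 2 / 2) * h 2%N z).
  by rewrite -key'; ring.
by field.
Qed.

(** After one step the sign is that of the new coin, so the mean becomes half a difference of [h 3]
    at two points at distance 2 r s [scl], which is at most 4 r s. *)
Lemma pair_mean_sgn3 C h r : jet C h -> 0 <= r ->
  `|pair_mean (fun y b => sgb b * h 3%N (r * y))| <= 2 * C * r * s.
Proof.
move=> [hL h2 h3 T4 T2] r0.
have ok := okF_scale sgb r (hL 3%N isT).
rewrite (stat ok).
set A := fun _ _ => _ / 2.
have := @pair_mean_comb_le [:: (1, A)] (2 * C * r * s).
rewrite !big_cons big_nil/= mul1r addr0; apply.
  by split => //; exact: (okF_avg ok).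
move=> w; rewrite !big_cons big_nil/= mul1r addr0 /A /sgb mul1r mulN1r.
rewrite normrM (ger0_norm (_ : 0 <= 2^-1)) ?invr_ge0// ler_pdivrMr//.
apply: le_trans (hL 3%N isT _ _) _.
have C0 := lip_ge0 (hL 0%N isT).
rewrite (_ : _ - _ = 2 * (r * s) * scl (D w)); last by ring.
have rs0 : 0 <= r * s by rewrite mulr_ge0// ltW.
rewrite ger0_norm; last by apply: mulr_ge0; [rewrite mulr_ge0|rewrite /scl; case: (D w)].
rewrite (_ : 2 * C * r * s * 2 = C * (2 * (r * s) * 2)); last by ring.
rewrite ler_wpM2l//; apply: ler_wpM2l; first exact: mulr_ge0.
by rewrite /scl; case: (D w) => //; exact: ler1n.
Qed.

(** Weighted by the sign of the new coin, the expansion keeps its odd part, with leading term r s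
    [scl] times [h 3], and [scl] = 3/2 - 1/2 [sgb]. This is how the dependence between successive
    noises produces a third derivative. *)
Lemma pair_mean_sgn2 C h r : jet C h -> 0 <= r ->
  `|pair_mean (fun y b => sgb b * h 2%N (r * y)) -
    3 / 2 * r * s * pair_mean (fun y _ => h 3%N (r * q * y)) +
    2^-1 * r * s * pair_mean (fun y b => sgb b * h 3%N (r * q * y))|
  <= 4 * C * r ^+ 2 * alpha.
Proof.
move=> [hL h2 h3 T4 T2] r0.
have ok := okF_scale sgb r (hL 2%N isT).
rewrite (stat ok).
set A := fun _ _ => _ / 2.
have := @pair_mean_comb_le [:: (1, A); (- (3 / 2 * r * s), fun y _ => h 3%N (r * q * y));
  (2^-1 * r * s, fun y b => sgb b * h 3%N (r * q * y))] (4 * C * r ^+ 2 * alpha).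
rewrite !big_cons big_nil/= => H.
rewrite [X in `|X|](_ : _ = 1 * pair_mean A + (- (3 / 2 * r * s) * pair_mean (fun y _ => h 3%N (r * q * y))
  + (2^-1 * r * s * pair_mean (fun y b => sgb b * h 3%N (r * q * y)) + 0))); last by ring.
apply: H.
  split; first exact: (okF_avg ok).
  split; first exact: okF_scale1 (hL 3%N isT).
  by split => //; exact: okF_scale (hL 3%N isT).
move=> w; rewrite !big_cons big_nil/= /A.
move: (Y w) (D w) => y b.
have C0 := lip_ge0 (hL 0%N isT).
have p1 := T2 (r * q * y) (r * s * scl b).
have p2 := T2 (r * q * y) (- (r * s * scl b)).
have key : 3 / 2 * r * s - 2^-1 * r * s * sgb b = r * s * scl b.
  by rewrite /sgb /scl; case: b {p1 p2}; field.
have kb : C * (r * s * scl b) ^+ 2 <= 4 * C * r ^+ 2 * alpha.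
  rewrite !exprMn s2 [leRHS](_ : _ = C * (r ^+ 2 * alpha * 4)); last by ring.
  rewrite ler_wpM2l// ler_wpM2l ?mulr_ge0 ?exprn_ge0 ?(ltW a0)//.
  by rewrite /scl; case: b {p1 p2 key}; [rewrite expr1n ler1n|rewrite -natrX ler_nat].
rewrite sqrrN in p2.
rewrite (_ : r * (q * y + s * scl b) = r * q * y + r * s * scl b); last by ring.
rewrite (_ : r * (q * y - s * scl b) = r * q * y - r * s * scl b); last by ring.
rewrite [sgb true]/sgb [sgb false]/sgb.
move: kb key p1 p2; move: (r * s * scl b) (r * q * y) => t z kb key p1 p2.
rewrite [X in `|X|](_ : _ = 2^-1 *
   ((h 2%N (z + t) - (h 2%N z + t * h 3%N z)) -
    (h 2%N (z - t) - (h 2%N z + - t * h 3%N z)))).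
  rewrite normrM ger0_norm ?invr_ge0// ler_pdivrMl// (le_trans (ler_normB _ _))//.
  by rewrite (_ : 2 * _ = 4 * C * r ^+ 2 * alpha + 4 * C * r ^+ 2 * alpha);
    [rewrite lerD// (le_trans _ kb)|ring].
transitivity ((h 2%N (z + t) - h 2%N (z - t)) / 2 - t * h 3%N z).
  by rewrite -key; field.
by field.
Qed.

Lemma pair_mean_gs C h r t : jet C h ->
  `|pair_mean (fun y _ => gs t (h 0%N) (r * y)) - pair_mean (fun y _ => h 0%N (r * y))
    - t ^+ 2 / 2 * pair_mean (fun y _ => h 2%N (r * y))| <= C * t ^+ 4 * m4.
Proof.
move=> hj; have [hL _ _ _ _] := hj.
have := @pair_mean_comb_le [:: (1, fun y _ => gs t (h 0%N) (r * y));
  (-1, fun y _ => h 0%N (r * y)); (- (t ^+ 2 / 2), fun y _ => h 2%N (r * y))]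
  (C * t ^+ 4 * m4).
rewrite !big_cons big_nil/= => H.
rewrite [X in `|X|](_ : _ = 1 * pair_mean (fun y _ => gs t (h 0%N) (r * y)) +
  (-1 * pair_mean (fun y _ => h 0%N (r * y)) +
  (- (t ^+ 2 / 2) * pair_mean (fun y _ => h 2%N (r * y)) + 0))); last by ring.
apply: H.
  split; first exact: okF_scale1 (lip_gs t (hL 0%N isT)).
  split; first exact: okF_scale1 (hL 0%N isT).
  by split => //; exact: okF_scale1 (hL 2%N isT).
move=> w; rewrite !big_cons big_nil/=.
have := jet_gs_taylor t (r * Y w) hj.
by congr (`|_| <= _); ring.
Qed.

Lemma pair_mean_bnd C f r : lip C f -> (forall x, `|f x| <= C) ->
  `|pair_mean (fun y _ => f (r * y))| <= C.
Proof.
move=> fL fC; have := @pair_mean_comb_le [:: (1, fun y _ => f (r * y))] C.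
rewrite big_seq1 mul1r; apply; first by split => //; exact: okF_scale1 fL.
by move=> w; rewrite big_seq1/= mul1r.
Qed.

(** The remainders of [pair_mean_step] add up to 16 + 5/8 + 3 + 3/4, rounded up to 21; 7 bounds the
    square of 5/2 - 5/4 alpha. *)
Definition K0 : R := 21 + 7 * m4.

(** The prescribed t^2 equals 5/4 r^2 (1 - q^2), the variance lost when r is replaced by r q. It
    matches the mean noise variance 5/2 r^2 alpha up to order alpha^2, so the second derivatives
    cancel to leading order. *)
Lemma pair_mean_step C h r t : jet C h -> 0 <= r <= 1 ->
  t ^+ 2 = r ^+ 2 * alpha * (5 / 2 - 5 / 4 * alpha) ->
  `|pair_mean (fun y _ => h 0%N (r * y)) - pair_mean (fun y _ => gs t (h 0%N) (r * q * y))
    + 9 / 8 * r ^+ 3 * q * s * alpha * pair_mean (fun y _ => h 3%N (r * q ^+ 2 * y))|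
  <= K0 * C * r ^+ 2 * alpha ^+ 2.
Proof.
move=> hj r01 t2; have [hL h2 h3 T4 T2] := hj; have /andP[r0 r1] := r01.
have C0 := lip_ge0 (hL 0%N isT).
have rq0 : 0 <= r * q by rewrite mulr_ge0// ltW.
have rqq0 : 0 <= r * q * q by rewrite mulr_ge0// ltW.
have e1 := pair_mean_jet hj r01.
have e2 := pair_mean_gs (r * q) t hj.
have e3 := pair_mean_sgn2 hj rq0.
have e4 := pair_mean_sgn3 hj rqq0.
have e5 := pair_mean_bnd (r * q) (hL 2%N isT) h2.
rewrite expr2 (mulrA r).
move: e1 e2 e3 e4 e5.
set E1 := pair_mean _; set E2 := pair_mean _; set E3 := pair_mean _; set E4 := pair_mean _; set E5 := pair_mean _.
set E6 := pair_mean _; set E7 := pair_mean _.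
rewrite (_ : t ^+ 4 = (t ^+ 2) ^+ 2); last by rewrite -exprM.
rewrite t2 => e1 e2 e3 e4 e5.
set x1 := _ - _ - _ + _ in e1; set x2 := _ - _ - _ in e2; set x3 := _ - _ + _ in e3.
(* Half of t^2 is r^2 alpha (5/4 - 5/8 alpha), whose defect gives the term in [E3]. Inserting [x3]
   into the term 3/4 r^2 alpha [E4] yields the factors 9/8 = 3/4 * 3/2 and 3/8 = 3/4 * 1/2. *)
have -> : E1 - E5 + 9 / 8 * r ^+ 3 * q * s * alpha * E6 =
  x1 - x2 + (5 / 8 * r ^+ 2 * alpha ^+ 2) * E3 - (3 / 4 * r ^+ 2 * alpha) * x3
  + (3 / 8 * r ^+ 3 * q * s * alpha) * E7.
  by rewrite /x1 /x2 /x3; field.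
have r2 : 0 <= r ^+ 2 <= 1 by rewrite sqr_ge0 exprn_ile1.
have w0 : 0 <= C * r ^+ 2 * alpha ^+ 2.
  by rewrite mulr_ge0 ?sqr_ge0// mulr_ge0 ?sqr_ge0.
set w := C * r ^+ 2 * alpha ^+ 2 in w0.
have uw : 0 <= r ^+ 2 * w <= w by rewrite mulr_ge0 ?ler_piMl//; case/andP: r2.
have qn k : 0 <= q ^+ k <= 1 by rewrite exprn_ge0 ?exprn_ile1 ?(ltW q0) ?(ltW q1).
have m40 := @m4_ge0 R.
have n1 : `|x1| <= 16 * w.
  apply: le_trans e1 _; rewrite [leLHS](_ : _ = 16 * (r ^+ 2 * w)); last by rewrite /w; ring.
  by rewrite ler_wpM2l//; case/andP: uw.
have n2 : `|x2| <= 7 * m4 * w.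
  apply: le_trans e2 _.
  rewrite [leLHS](_ : _ = (5 / 2 - 5 / 4 * alpha) ^+ 2 * ((r ^+ 2 * w) * m4)); last first.
    by rewrite /w; ring.
  rewrite [leRHS](_ : _ = 7 * (w * m4)); last by ring.
  apply: ler_pM.
  - exact: sqr_ge0.
  - by rewrite mulr_ge0//; case/andP: uw.
  - by have := a0; have := a1; nra.
  - by rewrite ler_wpM2r//; case/andP: uw.
have n3 : `|5 / 8 * r ^+ 2 * alpha ^+ 2 * E3| <= 5 / 8 * w.
  rewrite normrM ger0_norm; last by rewrite -mulrA mulr_ge0// mulr_ge0 ?sqr_ge0.
  rewrite [leRHS](_ : _ = 5 / 8 * r ^+ 2 * alpha ^+ 2 * C); last by rewrite /w; ring.
  by rewrite ler_wpM2l// -mulrA mulr_ge0// mulr_ge0 ?sqr_ge0.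
have n4 : `|3 / 4 * r ^+ 2 * alpha * x3| <= 3 * w.
  have c0 : 0 <= 3 / 4 * r ^+ 2 * alpha by rewrite !mulr_ge0 ?sqr_ge0// ltW.
  rewrite normrM ger0_norm//; apply: le_trans (ler_wpM2l c0 e3) _.
  rewrite [leLHS](_ : _ = 3 * (q ^+ 2 * (r ^+ 2 * w))); last by rewrite /w; field.
  rewrite ler_wpM2l//; case/andP: uw => u0; apply: le_trans.
  by rewrite ler_piMl//; case/andP: (qn 2%N).
have n5 : `|3 / 8 * r ^+ 3 * q * s * alpha * E7| <= 3 / 4 * w.
  have c0 : 0 <= 3 / 8 * r ^+ 3 * q * s * alpha.
    by rewrite !mulr_ge0 ?exprn_ge0 ?(ltW q0) ?(ltW s0) ?(ltW a0).
  rewrite normrM ger0_norm//; apply: le_trans (ler_wpM2l c0 e4) _.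
  rewrite [leLHS](_ : _ = 3 / 4 * (q ^+ 3 * (r ^+ 2 * w))); last first.
    have aE : alpha ^+ 2 = alpha * s ^+ 2 by rewrite s2 expr2.
    by rewrite /w aE; field.
  rewrite ler_wpM2l//; case/andP: uw => u0; apply: le_trans.
  by rewrite ler_piMl//; case/andP: (qn 3%N).
rewrite (_ : K0 * C * r ^+ 2 * alpha ^+ 2 = (16 * w + 7 * m4 * w + 5 / 8 * w + 3 * w + 3 / 4 * w) + 5 / 8 * w); last first.
  by rewrite /K0 /w; field.
apply: (@le_trans _ _ (16 * w + 7 * m4 * w + 5 / 8 * w + 3 * w + 3 / 4 * w)); last first.
  by rewrite lerDl mulr_ge0.
do 2 (apply: le_trans (ler_normD _ _) _; rewrite lerD ?normrN//).
apply: le_trans (ler_normD _ _) _; rewrite lerD ?normrN//.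
by apply: le_trans (ler_normB _ _) _; rewrite lerD.
Qed.

End expansion.

(** * Summation of the interpolation steps *)

Section expansion_limit.
Context {R : realType} d (Omega : measurableType d) (P : probability Omega R).
Variables (alpha : R) (Y : Omega -> R) (D : Omega -> bool).
Implicit Types (h : nat -> R -> R) (C r x y : R) (F : R -> bool -> R).
Local Notation gamma := (normal_prob (0:R) 1).

Let s := Num.sqrt alpha.
Let q := 1 - alpha.

Local Notation pair_mean := (pair_mean P Y D).

Hypothesis alpha01 : 0 < alpha < 1.
Hypothesis mY : measurable_fun setT Y.
Hypothesis mD : measurable_fun setT D.
Hypothesis Yb : forall w, `|Y w| <= 2 / s.
Hypothesis stat : forall F, okF F ->
  pair_mean F = pair_mean (fun y b => (F (q * y + s * scl b) true + F (q * y - s * scl b) false) / 2).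

Let a0 : 0 < alpha. Proof. by case/andP: alpha01. Qed.
Let a1 : alpha < 1. Proof. by case/andP: alpha01. Qed.
Let s0 : 0 < s. Proof. by rewrite sqrtr_gt0. Qed.
Let s2 : s ^+ 2 = alpha. Proof. by rewrite sqr_sqrtr// ltW. Qed.
Let s1 : s < 1. Proof. by rewrite -sqrtr1 ltr_sqrt. Qed.
Let q0 : 0 < q. Proof. by rewrite subr_gt0. Qed.
Let q1 : q < 1. Proof. by rewrite /q ltrBlDr ltrDl. Qed.
Let qn k : 0 <= q ^+ k <= 1.
Proof. by rewrite exprn_ge0 ?exprn_ile1 ?(ltW q0) ?(ltW q1). Qed.

(* [interp h i] is the interpolant a_i; [interp_third] and [interp_third_next] carry the
   third derivative, at q^i Y and at q^(i+2) Y respectively. *)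
Definition sig i := Num.sqrt (5 / 4 * (1 - q ^+ (2 * i))).
Definition siginf : R := Num.sqrt (5 / 4).
Definition interp h i := pair_mean (fun y _ => gs (sig i) (h 0%N) (q ^+ i * y)).
Definition interp_third_next h i := pair_mean (fun y _ => gs (sig i) (h 3%N) (q ^+ i * q ^+ 2 * y)).
Definition interp_lim h := gs siginf (h 0%N) 0.

Lemma sig_sqr i : sig i ^+ 2 = 5 / 4 * (1 - q ^+ (2 * i)).
Proof. by rewrite sqr_sqrtr// mulr_ge0// subr_ge0; case/andP: (qn (2 * i)). Qed.

(* One Gaussian step of variance t^2 keeps the total variance at 5/4: sigma_(i+1)^2 =
   sigma_i^2 + t^2. *)
Lemma interp_step C h i : jet C h ->
  `|interp h i - interp h i.+1 + 9 / 8 * q * s * alpha * (q ^+ (3 * i) * interp_third_next h i)|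
  <= K0 * C * alpha ^+ 2 * q ^+ (2 * i).
Proof.
move=> hj; have hij := jet_gs (sig i) hj.
set t := Num.sqrt ((q ^+ i) ^+ 2 * alpha * (5 / 2 - 5 / 4 * alpha)).
have t0 : 0 < (q ^+ i) ^+ 2 * alpha * (5 / 2 - 5 / 4 * alpha).
  by rewrite mulr_gt0 ?mulr_gt0 ?exprn_gt0//; have := a1; lra.
have t2 : t ^+ 2 = (q ^+ i) ^+ 2 * alpha * (5 / 2 - 5 / 4 * alpha).
  by rewrite sqr_sqrtr// ltW.
have := pair_mean_step alpha01 mY mD Yb stat hij (qn i) t2.
rewrite /= -/s -/q -/(interp_third_next h i) -/(interp h i).
rewrite (_ : pair_mean (fun y _ => gs t (gs (sig i) (h 0%N)) (q ^+ i * q * y)) = interp h i.+1); last first.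
  rewrite /interp; congr pair_mean; apply/funext => y; apply/funext => b.
  have [hL _ _ _ _] := hj.
  have tp : 0 < t by rewrite sqrtr_gt0.
  rewrite (gs_conv _ tp (sqrtr_ge0 _) (hL 0%N isT)) (exprSr q i).
  suff -> : Num.sqrt (t ^+ 2 + sig i ^+ 2) = sig i.+1 by [].
  rewrite t2 sig_sqr /sig mulnS exprD -exprM mulnC; move: (q ^+ (2 * i)) => u.
  by congr Num.sqrt; rewrite /q; field.
rewrite [leRHS](_ : _ = K0 * C * alpha ^+ 2 * q ^+ (2 * i)); last first.
  by rewrite (mulnC 2 i) exprM; ring.
congr (`|_| <= _); congr (_ + _).
by rewrite (mulnC 3 i) exprM; ring.
Qed.

(** Telescoping of [interp_step]. The starting index j is arbitrary because [interp_bnd] has to hold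
    at every stage of the interpolation. *)
Lemma interp_sum C h j n : jet C h ->
  `|interp h j - interp h (j + n) +
    9 / 8 * q * s * alpha * \sum_(i < n) (q ^+ (3 * (j + i)) * interp_third_next h (j + i))|
  <= K0 * C * alpha ^+ 2 * \sum_(i < n) q ^+ (2 * (j + i)).
Proof.
move=> hj; elim: n => [|n IH].
  by rewrite !big_ord0 addn0 subrr !mulr0 addr0 normr0.
rewrite !big_ord_recr/= addnS.
have := interp_step (j + n) hj.
move: (\sum_(i < n) _) (\sum_(i < n) _) IH => S1 S2.
move: (interp h j) (interp h (j + n)) (interp h (j + n).+1) (interp_third_next h (j + n)) => x1 x2 x3 x4.
move: (q ^+ (3 * (j + n))) (q ^+ (2 * (j + n))) (9 / 8 * q * s * alpha) => y1 y2 y3 IH st.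
rewrite (mulrDr (K0 * C * alpha ^+ 2)).
apply: le_trans _ (lerD IH st).
apply: le_trans _ (ler_normD _ _).
by rewrite le_eqVlt; apply/orP; left; apply/eqP; congr (`|_|); ring.
Qed.

(** Since alpha = 1 - q, alpha times the sum of the first n powers of q is 1 - q^n, and the
    exponents here are larger. *)
Lemma geo_sum k j n : (0 < k)%N ->
  0 <= alpha * \sum_(i < n) q ^+ (k * (j + i)) <= 1.
Proof.
move=> k0; apply/andP; split.
  rewrite mulr_ge0 ?(ltW a0)//; apply: sumr_ge0 => i _.
  by case/andP: (qn (k * (j + i))).
apply: (@le_trans _ _ (alpha * \sum_(i < n) q ^+ i)).
  rewrite ler_wpM2l ?(ltW a0)//; apply: ler_sum => i _.
  rewrite ler_wiXn2l ?(ltW q0) ?(ltW q1)//.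
  by rewrite mulnDr (leq_trans (leq_pmull i k0))// leq_addl.
rewrite (_ : alpha = 1 - q); last by rewrite /q; ring.
rewrite [leLHS](_ : _ = 1 - q ^+ n); last by rewrite -[RHS]opprB subrX1; ring.
by rewrite lerBlDr lerDl; case/andP: (qn n).
Qed.

(** All sums stay finite and their tails are multiples of q^n, so the passage to the limit in the
    interpolation is confined to this lemma. *)
Lemma geo_le a X K : (forall n, a <= X + K * q ^+ n) -> a <= X.
Proof.
move=> H.
have cv : X + K * q ^+ n @[n --> \oo] --> X.
  rewrite -[X in _ --> X]addr0; apply: cvgD; first exact: cvg_cst.
  rewrite -[X in _ --> X](mulr0 K); apply: cvgM; first exact: cvg_cst.
  by apply: cvg_expr; rewrite ger0_norm ?ltW.
rewrite -(cvg_lim _ cv)//; apply: limr_ge; first by apply/cvg_ex; exists X.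
exact: nearW.
Qed.

Lemma siginf_ge1 : 1 <= siginf.
Proof. by rewrite -sqrtr1 ler_wsqrtr//; lra. Qed.

(** The squares differ by 5/4 q^(2 i), and the sum [sig i + siginf] by which this is divided is at
    least 1. *)
Lemma sig_cvg i : `|sig i - siginf| <= 5 / 4 * q ^+ i.
Proof.
have g1 := siginf_ge1; have si0 : 0 <= sig i by exact: sqrtr_ge0.
have sinf : siginf ^+ 2 = 5 / 4 by rewrite sqr_sqrtr.
have E : (sig i - siginf) * (sig i + siginf) = - (5 / 4 * q ^+ (2 * i)).
  by rewrite -subr_sqr sig_sqr sinf; ring.
have [u0 u1] := andP (qn i).
have : `|sig i - siginf| * (sig i + siginf) <= 5 / 4 * q ^+ i.
  rewrite -[X in _ * X]ger0_norm -?normrM ?E; last by lra.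
  rewrite normrN ger0_norm; last by rewrite mulr_ge0//; case/andP: (qn (2 * i)).
  rewrite ler_wpM2l// mulnC exprM expr2 ler_piMl//.
apply: le_trans; rewrite ler_peMr//; lra.
Qed.

(** Both the point q^i Y and the smoothing width approach their limits at rate q^i. The factor 2 /
    s, the bound on |Y|, is harmless because [geo_le] discards every multiple of q^n. *)
Lemma interp_cvg C h i : jet C h ->
  `|interp h i - interp_lim h| <= C * (2 / s + 5 / 4 * (1 + m4)) * q ^+ i.
Proof.
move=> [hL _ _ _ _].
have fL := hL 0%N isT; have C0 := lip_ge0 fL.
set c := C * `|sig i - siginf|.
have c0 : 0 <= c by rewrite mulr_ge0.
have K x : `|gs (sig i) (h 0%N) x - interp_lim h| <= C * `|x| + c * (1 + m4).
  set gl := [:: (C * `|x| + c, fun=> 1); (c, fun y : R => y ^+ 4)].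
  have [|Ig] := @Rintegral_comb _ _ _ gamma gl.
    by do !split => //; [exact: integrable_cst|exact: (@integrable_gauss_exp _ 4)].
  rewrite !big_cons big_nil/= Rintegral_cstP -/m4 => Eg.
  rewrite (_ : C * _ + _ = (C * `|x| + c) * 1 + (c * m4 + 0)); last by ring.
  rewrite -Eg.
  have := @Rintegral_comb_le _ _ _ gamma
    [:: (1, fun y => h 0%N (x + sig i * y)); (-1, fun y => h 0%N (0 + siginf * y))] _ _ Ig.
  rewrite !big_cons big_nil/= addr0 mul1r mulN1r; apply.
    by do !split => //; exact: gs_integrable fL.
  move=> y; rewrite !big_cons !big_nil/= !addr0 mul1r mulN1r mulr1.
  apply: le_trans (fL _ _) _.
  rewrite (_ : _ - _ = x + (sig i - siginf) * y); last by ring.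
  apply: (@le_trans _ _ (C * (`|x| + `|(sig i - siginf) * y|))).
    by rewrite ler_wpM2l// ler_normD.
  rewrite mulrDr -addrA lerD2l normrM mulrA -/c -[X in _ <= X + _]mulr1 -mulrDr ler_wpM2l//.
  by have := @norm_exp_le_quartic R 1 y isT; rewrite mul1r expr1.
have s20 : 0 <= 2 / s by rewrite divr_ge0 ?ltW.
have [u0 u1] := andP (qn i).
have m40 := @m4_ge0 R.
have := @pair_mean_comb_le _ _ _ P alpha Y D alpha01 mY mD Yb
  [:: (1, fun y _ => gs (sig i) (h 0%N) (q ^+ i * y)); (- interp_lim h, fun _ _ => 1)]
  (C * (2 / s + 5 / 4 * (1 + m4)) * q ^+ i).
rewrite !big_cons big_nil/= addr0 mul1r.
have -> : pair_mean (fun _ _ => 1) = 1 by exact: Rintegral_cstP.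
rewrite mulr1; apply.
  split; first exact: okF_scale1 (lip_gs (sig i) fL).
  by split => // b; exists 0 => x y /=; rewrite subrr normr0 mul0r.
move=> w; rewrite !big_cons big_nil/= addr0 mul1r mulr1.
apply: le_trans (K _) _.
rewrite normrM ger0_norm// (_ : _ * q ^+ i =
  C * (q ^+ i * (2 / s)) + C * (5 / 4 * q ^+ i) * (1 + m4)); last by ring.
rewrite lerD//.
  by rewrite ler_wpM2l// ler_wpM2l.
by rewrite ler_wpM2r ?addr_ge0// /c ler_wpM2l// sig_cvg.
Qed.

Definition K1 : R := 9 / 8 + K0.

Lemma interp_third_next_bnd C h i : jet C h -> `|interp_third_next h i| <= C.
Proof.
move=> hj; have [hL _ h3 _ _] := jet_gs (sig i) hj.
exact: (pair_mean_bnd P alpha01 mY mD Yb _ (hL 3%N isT) h3).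
Qed.

(** The third-derivative terms are merely bounded by [C] here; as alpha times the geometric sum is
    at most 1, they contribute O(s), and the remainders contribute O(alpha). *)
Lemma interp_bnd C h j : jet C h -> `|interp h j - interp_lim h| <= K1 * C * s.
Proof.
move=> hj; have [hL _ _ _ _] := hj; have C0 := lip_ge0 (hL 0%N isT).
have K00 : 0 <= K0 :> R by rewrite /K0 addr_ge0// mulr_ge0// m4_ge0.
apply: (@geo_le _ _ (C * (2 / s + 5 / 4 * (1 + m4)))) => n.
have := interp_cvg (j + n) hj; have := @interp_sum C h j n hj.
have [_ g2] := andP (@geo_sum 2 j n isT).
have [g30 g3] := andP (@geo_sum 3 j n isT).
set S2 := \sum_(i < n) q ^+ (2 * _) in g2 *; set S3 := \sum_(i < n) q ^+ (3 * _) in g30 g3.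
set SD := \sum_(i < n) _ => e1 e2.
have bD : `|alpha * SD| <= C.
  rewrite /SD mulr_sumr; apply: le_trans (ler_norm_sum _ _ _) _.
  apply: (@le_trans _ _ (alpha * S3 * C)); last by rewrite ler_piMl.
  rewrite /S3 mulr_sumr mulr_suml; apply: ler_sum => i _.
  rewrite mulrA normrM ger0_norm; last first.
    by rewrite mulr_ge0 ?(ltW a0)//; case/andP: (qn (3 * (j + i))).
  rewrite ler_wpM2l ?interp_third_next_bnd//.
  by rewrite mulr_ge0 ?(ltW a0)//; case/andP: (qn (3 * (j + i))).
have b1 : `|9 / 8 * q * s * alpha * SD| <= 9 / 8 * C * s.
  rewrite (_ : _ * SD = 9 / 8 * q * s * (alpha * SD)); last by ring.
  have c0 : 0 <= 9 / 8 * q * s by rewrite !mulr_ge0 ?ltW.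
  rewrite normrM ger0_norm// (le_trans (ler_wpM2l c0 bD))//.
  rewrite (_ : _ * C = q * (9 / 8 * C * s)); last by ring.
  by rewrite ler_piMl ?(ltW q1)// mulr_ge0 ?(ltW s0)// mulr_ge0.
have b2 : K0 * C * alpha ^+ 2 * S2 <= K0 * C * s.
  rewrite (_ : _ * S2 = K0 * C * s * (s * (alpha * S2))); last by rewrite -s2; ring.
  rewrite ler_piMr ?mulr_ge0 ?(ltW s0)//.
  by have := ltW s0; have := ltW s1; have := andP (@geo_sum 2 j n isT); rewrite -/S2 => -[]; nra.
have b3 : C * (2 / s + 5 / 4 * (1 + m4)) * q ^+ (j + n) <=
    C * (2 / s + 5 / 4 * (1 + m4)) * q ^+ n.
  rewrite ler_wpM2l ?ler_wiXn2l ?(ltW q0) ?(ltW q1) ?leq_addl//.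
  by rewrite mulr_ge0// addr_ge0 ?divr_ge0 ?(ltW s0)// mulr_ge0 ?addr_ge0// m4_ge0.
move: e1 e2 b1; move: (interp h j) (interp h (j + n)) (interp_lim h) (9 / 8 * q * s * alpha * SD) => x1 x2 x3 x4 e1 e2 b1.
rewrite (_ : x1 - x3 = (x1 - x2 + x4) - x4 + (x2 - x3)); last by ring.
apply: le_trans (ler_normD _ _) _; apply: lerD; last exact: le_trans e2 b3.
apply: le_trans (ler_normB _ _) _.
rewrite (_ : K1 * C * s = K0 * C * s + 9 / 8 * C * s); last by rewrite /K1; ring.
by rewrite lerD// (le_trans e1).
Qed.

(** The third difference kills polynomials of degree 2 and sends t^3 / 6 to e^3. The constant is 132
    = 3^4 + 3 * 2^4 + 3. *)
Lemma jet_third_diff C h x e : jet C h -> 0 <= e ->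
  `|h 0%N (x + 3 * e) - 3 * h 0%N (x + 2 * e) + 3 * h 0%N (x + e) - h 0%N x
    - e ^+ 3 * h 3%N x| <= 132 * C * e ^+ 4.
Proof.
move=> [_ _ _ T4 _] e0.
have := T4 x (3 * e); have := T4 x (2 * e); have := T4 x e.
move: (h 0%N (x + 3 * e)) (h 0%N (x + 2 * e)) (h 0%N (x + e)) (h 0%N x) (h 1%N x) (h 2%N x) (h 3%N x).
move=> z3 z2 z1 z y1 y2 y3 H1 H2 H3.
rewrite [X in `|X|](_ : _ =
  (z3 - (z + 3 * e * y1 + (3 * e) ^+ 2 / 2 * y2 + (3 * e) ^+ 3 / 6 * y3)) -
  3 * (z2 - (z + 2 * e * y1 + (2 * e) ^+ 2 / 2 * y2 + (2 * e) ^+ 3 / 6 * y3)) +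
  3 * (z1 - (z + e * y1 + e ^+ 2 / 2 * y2 + e ^+ 3 / 6 * y3))); last by field.
rewrite (_ : 132 * C * e ^+ 4 = C * (3 * e) ^+ 4 + 3 * (C * (2 * e) ^+ 4) + 3 * (C * e ^+ 4)); last by ring.
apply: le_trans (ler_normD _ _) _; apply: lerD; last first.
  by rewrite normrM ger0_norm// ler_wpM2l.
apply: le_trans (ler_normB _ _) _; apply: lerD => //.
by rewrite normrM ger0_norm// ler_wpM2l.
Qed.

Definition interp_third h i := pair_mean (fun y _ => gs (sig i) (h 3%N) (q ^+ i * y)).

Lemma gs_translate t (f : R -> R) c x : gs t (fun y => f (y + c)) x = gs t f (x + c).
Proof. by apply: eq_Rintegral => y _; rewrite addrAC. Qed.

Lemma interp_third_third_diff C h i e : jet C h -> 0 <= e ->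
  `|interp (fun k y => h k (y + 3 * e)) i - 3 * interp (fun k y => h k (y + 2 * e)) i
    + 3 * interp (fun k y => h k (y + e)) i - interp h i - e ^+ 3 * interp_third h i|
  <= 132 * C * e ^+ 4.
Proof.
move=> hj e0; have hij := jet_gs (sig i) hj; have [hL _ _ _ _] := hij.
pose G c : R -> bool -> R := fun y _ => gs (sig i) (h 0%N) (q ^+ i * y + c).
have GE c : interp (fun k y => h k (y + c)) i = pair_mean (G c).
  by rewrite /interp; congr pair_mean; apply/funext => y; apply/funext => b; rewrite gs_translate.
have G0 : interp h i = pair_mean (G 0).
  by rewrite /interp; congr pair_mean; apply/funext => y; apply/funext => b; rewrite /G addr0.
have := @pair_mean_comb_le _ _ _ P alpha Y D alpha01 mY mD Yb
  [:: (1, G (3 * e)); (-3, G (2 * e)); (3, G e); (-1, G 0);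
      (- e ^+ 3, fun y _ => gs (sig i) (h 3%N) (q ^+ i * y))] (132 * C * e ^+ 4).
rewrite !big_cons big_nil/= -/(interp_third h i) -(GE (3 * e)) -(GE (2 * e)) -(GE e) -G0 => H.
move: H; move: (interp (fun k y => h k (y + 3 * e)) i) (interp (fun k y => h k (y + 2 * e)) i)
  (interp (fun k y => h k (y + e)) i) (interp h i) (interp_third h i) => x2 x3 x4 x1 x5 H.
rewrite [X in `|X|](_ : _ = 1 * x2 + (-3 * x3 + (3 * x4 + (-1 * x1 + (- e ^+ 3 * x5 + 0))))); last by ring.
apply: H.
  have okG c : okF (G c).
    move=> b; exists (C * `|q ^+ i|) => x y.
    by have := lip_affine c (q ^+ i) (hL 0%N isT) x y; rewrite /G ![_ + c]addrC.
  do 4 (split; first exact: okG).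
  by split => //; exact: okF_scale1 (hL 3%N isT).
move=> w; rewrite !big_cons big_nil/= /G addr0.
have := jet_third_diff (q ^+ i * Y w) hij e0.
move: (gs _ _ _) (gs _ _ _) (gs _ _ _) (gs _ _ _) (gs _ _ _) => z1 z2 z3 z4 z5.
by congr (`|_| <= _); ring.
Qed.

(** 264 = 2 * 132 and 8 = 1 + 3 + 3 + 1 come from [interp_third_bnd], the remaining 4 from
    [interp_third_next_sub]. *)
Definition K2 : R := 268 + 8 * K1.

Lemma K1_ge0 : 0 <= K1.
Proof. by rewrite /K1 /K0 !addr_ge0// mulr_ge0// m4_ge0. Qed.

(* The bound on [interp h i - interp_lim h] only involves a jet of [h], so applying
   it to translates of [h] by 0, e, 2e, 3e and taking the third difference bounds
   the deviation for h''' at scale e = s^(1/4). *)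
Lemma interp_third_bnd C h i e : jet C h -> 0 < e -> e ^+ 4 = s ->
  `|interp_third h i - gs siginf (h 3%N) 0| <= (264 + 8 * K1) * C * e.
Proof.
move=> hj e0 e4.
have b c := interp_bnd i (jet_translate c hj).
have B := interp_third_third_diff i hj (ltW e0).
have T := jet_third_diff 0 (jet_gs siginf hj) (ltW e0).
have b0 := interp_bnd i hj; have b1 := b e; have b2 := b (2 * e); have b3 := b (3 * e).
move: b0 b1 b2 b3; rewrite /interp_lim !gs_translate.
move: B T; rewrite -e4.
move: (gs siginf (h 0%N) (0 + 3 * e)) (gs siginf (h 0%N) (0 + 2 * e))
  (gs siginf (h 0%N) (0 + e)) (gs siginf (h 0%N) 0) (gs siginf (h 3%N) 0)
  (interp (fun k y => h k (y + 3 * e)) i) (interp (fun k y => h k (y + 2 * e)) i)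
  (interp (fun k y => h k (y + e)) i) (interp h i) (interp_third h i).
move=> y3 y2 y1 y0 y x3 x2 x1 x0 x B T b0 b1 b2 b3.
have [hL _ _ _ _] := hj; have C0 := lip_ge0 (hL 0%N isT).
have e30 : 0 < e ^+ 3 by rewrite exprn_gt0.
rewrite -(ler_pM2l e30).
rewrite -[X in X * `|_|](gtr0_norm e30) -normrM.
rewrite (_ : e ^+ 3 * (x - y) = - (x3 - 3 * x2 + 3 * x1 - x0 - e ^+ 3 * x) +
  (y3 - 3 * y2 + 3 * y1 - y0 - e ^+ 3 * y) + ((x3 - y3) + -3 * (x2 - y2) + 3 * (x1 - y1) - (x0 - y0))); last by ring.
rewrite [leRHS](_ : _ = 132 * C * e ^+ 4 + 132 * C * e ^+ 4 + (K1 * C * e ^+ 4 + 3 * (K1 * C * e ^+ 4) + 3 * (K1 * C * e ^+ 4) + K1 * C * e ^+ 4)); last by ring.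
apply: le_trans (ler_normD _ _) _; apply: lerD.
  apply: le_trans (ler_normD _ _) _; rewrite normrN; exact: lerD.
apply: le_trans (ler_normB _ _) _; apply: lerD => //.
apply: le_trans (ler_normD _ _) _; apply: lerD; last by rewrite normrM ger0_norm// ler_wpM2l.
apply: le_trans (ler_normD _ _) _; apply: lerD => //.
by rewrite mulNr normrN normrM ger0_norm// ler_wpM2l.
Qed.

(** The two arguments differ by at most (1 - q^2) |Y|, where 1 - q^2 <= 2 s^2 and |Y| <= 2 / s. *)
Lemma interp_third_next_sub C h i : jet C h -> `|interp_third_next h i - interp_third h i| <= 4 * C * s.
Proof.
move=> hj; have [hL _ _ _ _] := jet_gs (sig i) hj.
have C0 := lip_ge0 (hL 3%N isT).
have := @pair_mean_comb_le _ _ _ P alpha Y D alpha01 mY mD Yb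
  [:: (1, fun y _ => gs (sig i) (h 3%N) (q ^+ i * q ^+ 2 * y));
     (-1, fun y _ => gs (sig i) (h 3%N) (q ^+ i * y))] (4 * C * s).
rewrite !big_cons big_nil/= -/(interp_third h i) -/(interp_third_next h i) addr0 mul1r mulN1r; apply.
  by do !split => //; exact: okF_scale1 (hL 3%N isT).
move=> w; rewrite !big_cons big_nil/= addr0 mul1r mulN1r.
apply: le_trans (hL 3%N isT _ _) _.
rewrite (_ : 4 * C * s = C * (4 * s)); last by ring.
rewrite ler_wpM2l//.
rewrite (_ : _ - _ = - (q ^+ i * (1 - q ^+ 2) * Y w)); last by ring.
rewrite normrN normrM ger0_norm; last first.
  by rewrite mulr_ge0 ?subr_ge0//; [case/andP: (qn i)|case/andP: (qn 2%N)].
have [u0 u1] := andP (qn i).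
have q2 : 0 <= 1 - q ^+ 2 <= 2 * s ^+ 2.
  by rewrite subr_ge0; case/andP: (qn 2%N) => _ ->; rewrite s2 /q; have := a0; nra.
have [v0 v1] := andP q2.
apply: (@le_trans _ _ ((2 * s ^+ 2) * (2 / s))).
  apply: ler_pM => //; first exact: mulr_ge0.
  by apply: le_trans v1; rewrite ler_piMl.
by rewrite le_eqVlt; apply/orP; left; apply/eqP; field; rewrite gt_eqF.
Qed.

Definition K3 : R := K0 + 9 / 8 * K2 + 3 / 8.

(** Each [interp_third_next] lies within [K2 * C * e] of the Gaussian value [kap], so [kap] can be
    taken out of the weighted sum. What is left is alpha times the sum of q^(3 i), close to 1/3, and
    9/8 * 1/3 = 3/8. *)
Lemma interp_expansion C h e : jet C h -> 0 < e -> e ^+ 4 = s ->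
  `|interp h 0 - interp_lim h + 3 / 8 * s * gs siginf (h 3%N) 0| <= K3 * C * s * e.
Proof.
move=> hj e0 e4; have [hL _ _ _ _] := hj; have C0 := lip_ge0 (hL 0%N isT).
have K00 : 0 <= K0 :> R by rewrite /K0 addr_ge0// mulr_ge0// m4_ge0.
have K10 := K1_ge0.
set kap := gs siginf (h 3%N) 0.
have kC : `|kap| <= C by have [_ _ h3 _ _] := jet_gs siginf hj; exact: h3.
have e1 : e <= 1.
  by have := expr_le1 (isT : (0 < 4)%N) (ltW e0); rewrite e4 (ltW s1) => <-.
have se : s <= e by rewrite -e4 exprS ler_piMr ?(ltW e0)// exprn_ile1// ltW.
have Dk i : `|interp_third_next h i - kap| <= K2 * C * e.
  have := interp_third_next_sub i hj; have := interp_third_bnd i hj e0 e4; rewrite -/kap.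
  move: (interp_third_next h i) (interp_third h i) => x y H1 H2.
  rewrite (_ : x - kap = (x - y) + (y - kap)); last by ring.
  apply: le_trans (ler_normD _ _) _.
  rewrite (_ : K2 * C * e = 4 * C * e + (264 + 8 * K1) * C * e); last by rewrite /K2; ring.
  by apply: lerD => //; apply: le_trans H2 _; rewrite ler_wpM2l// mulr_ge0.
apply: (@geo_le _ _ (9 / 8 * s * C + C * (2 / s + 5 / 4 * (1 + m4)))) => n.
have := interp_cvg n hj; have := @interp_sum C h 0 n hj; rewrite add0n.
have [_ g2] := andP (@geo_sum 2 0 n isT).
have [g30 g3] := andP (@geo_sum 3 0 n isT).
set S2 := \sum_(i < n) q ^+ (2 * _) in g2 *; set S3 := \sum_(i < n) q ^+ (3 * _) in g30 g3.
set SD := \sum_(i < n) _ => H1 H2.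
have bD : `|alpha * SD - alpha * S3 * kap| <= K2 * C * e.
  rewrite /SD /S3 !mulr_sumr mulr_suml -sumrB; apply: le_trans (ler_norm_sum _ _ _) _.
  apply: (@le_trans _ _ (alpha * S3 * (K2 * C * e))); last first.
    by rewrite ler_piMl// !mulr_ge0 ?(ltW e0)// /K2 addr_ge0// mulr_ge0.
  rewrite /S3 mulr_sumr mulr_suml; apply: ler_sum => i _.
  rewrite (mulrA alpha) -mulrBr normrM ger0_norm; last first.
    by rewrite mulr_ge0 ?(ltW a0)//; case/andP: (qn (3 * (0 + i))).
  rewrite ler_wpM2l ?Dk//.
  by rewrite mulr_ge0 ?(ltW a0)//; case/andP: (qn (3 * (0 + i))).
(* Geometric sum of ratio q^3, with 1 - q^3 = alpha (3 - 3 alpha + alpha^2). *)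
have S3E : (3 - 3 * alpha + alpha ^+ 2) * (alpha * S3) = 1 - q ^+ (3 * n).
  have -> : S3 = \sum_(i < n) (q ^+ 3) ^+ i.
    by apply: eq_bigr => i _; rewrite add0n exprM.
  rewrite exprM -[RHS]opprB subrX1 /q; ring.
have [un0 un1] := andP (qn (3 * n)).
have uq : q ^+ (3 * n) <= q ^+ n.
  by rewrite ler_wiXn2l ?(ltW q0) ?(ltW q1)// leq_pmull.
have sa : alpha <= s by rewrite -s2 expr2 ler_piMl ?(ltW s0) ?(ltW s1).
have aa : alpha ^+ 2 <= e.
  apply: le_trans se; apply: le_trans sa.
  by rewrite expr2 ler_piMl ?(ltW a0) ?(ltW a1).
have bS : `|9 / 8 * q * (alpha * S3) - 3 / 8| <= 3 / 8 * e + 9 / 8 * q ^+ n.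
  have v1 : 1 <= 3 - 3 * alpha + alpha ^+ 2 by have := ltW a0; have := ltW a1; nra.
  apply: (@le_trans _ _ ((3 - 3 * alpha + alpha ^+ 2) * `|9 / 8 * q * (alpha * S3) - 3 / 8|)).
    by rewrite ler_peMl.
  rewrite -[X in X * `|_|]ger0_norm; last by lra.
  rewrite -normrM (_ : _ * (_ - _) = - (3 / 8 * alpha ^+ 2 + 9 / 8 * (q * q ^+ (3 * n)))); last first.
    rewrite (_ : _ * (_ - _) = 9 / 8 * q * ((3 - 3 * alpha + alpha ^+ 2) * (alpha * S3)) - 3 / 8 * (3 - 3 * alpha + alpha ^+ 2)); last by ring.
    by rewrite S3E; move: (q ^+ (3 * n)) => u; rewrite /q; field.
  rewrite normrN ger0_norm; last first.
    apply: addr_ge0; first by rewrite mulr_ge0 ?sqr_ge0.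
    by rewrite mulr_ge0// mulr_ge0// ltW.
  rewrite lerD// ler_wpM2l//; apply: le_trans uq.
  by rewrite ler_piMl ?(ltW q1).
have [g20 _] := andP (@geo_sum 2 0 n isT).
have T1 : K0 * C * alpha ^+ 2 * S2 <= K0 * C * s * e.
  rewrite (_ : _ * S2 = K0 * C * (alpha * (alpha * S2))); last by ring.
  rewrite -(mulrA (K0 * C)) ler_wpM2l ?mulr_ge0//.
  apply: (@le_trans _ _ alpha); first by rewrite ler_piMr ?(ltW a0).
  by rewrite -s2 expr2 ler_wpM2l ?(ltW s0).
have T2 : `|9 / 8 * q * s * (alpha * SD - alpha * S3 * kap)| <= 9 / 8 * K2 * C * s * e.
  have c0 : 0 <= 9 / 8 * q * s by rewrite !mulr_ge0 ?ltW.
  rewrite normrM ger0_norm// (le_trans (ler_wpM2l c0 bD))//.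
  rewrite (_ : _ * (K2 * C * e) = q * (9 / 8 * K2 * C * s * e)); last by ring.
  by rewrite ler_piMl ?(ltW q1)// !mulr_ge0 ?(ltW s0) ?(ltW e0)// /K2 addr_ge0// mulr_ge0.
have T3 : `|s * kap * (9 / 8 * q * (alpha * S3) - 3 / 8)| <= s * C * (3 / 8 * e + 9 / 8 * q ^+ n).
  by rewrite !normrM (ger0_norm (ltW s0)) ler_pM ?mulr_ge0 ?(ltW s0)// ler_wpM2l ?(ltW s0).
move: H1 H2 T2 T3 T1; move: (interp h 0) (interp h n) (interp_lim h) (q ^+ n) => x0 xn xi qq H1 H2 T2 T3 T1.
rewrite (_ : x0 - xi + 3 / 8 * s * kap = (x0 - xn + 9 / 8 * q * s * alpha * SD) + (xn - xi)
  - 9 / 8 * q * s * (alpha * SD - alpha * S3 * kap) - s * kap * (9 / 8 * q * (alpha * S3) - 3 / 8)); last by field.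
rewrite (_ : K3 * C * s * e + _ = K0 * C * s * e + C * (2 / s + 5 / 4 * (1 + m4)) * qq
  + 9 / 8 * K2 * C * s * e + s * C * (3 / 8 * e + 9 / 8 * qq)); last first.
  by rewrite /K3; move: (2 / s) => ss; field.
apply: le_trans (ler_normB _ _) _; apply: lerD => //.
apply: le_trans (ler_normB _ _) _; apply: lerD => //.
by apply: le_trans (ler_normD _ _) _; apply: lerD => //; exact: le_trans T1.
Qed.

End expansion_limit.

(** * Taylor bounds for test functions with four bounded derivatives *)

Section C4_jet.
Context {R : realType}.
Implicit Types (h g : R -> R) (C x t : R).

(** One use of the mean value theorem raises the power by one and keeps [C]. Descending from the
    fourth derivative, it yields all the Taylor bounds of a jet with one constant and no
    factorials. *)
Lemma taylor_bound g g' C (n : nat) t :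
  g 0 = 0 -> (forall u : R, is_derive u 1 g (g' u)) ->
  (forall u : R, `|g' u| <= C * `|u| ^+ n) -> `|g t| <= C * `|t| ^+ n.+1.
Proof.
move=> g0 dg g'C.
have cg : continuous g.
  by move=> u; apply/differentiable_continuous/derivable1_diffP.
have C0 : 0 <= C.
  by have := le_trans (normr_ge0 _) (g'C 1); rewrite normr1 expr1n mulr1.
have key a b : a <= b -> exists2 c, c \in `[a, b] & g b - g a = g' c * (b - a).
  move=> ab; apply: (@MVT_segment R g g' a b ab) .
  exact: continuous_subspaceT.
have [t0|/ltW t0] := leP 0 t.
  have [c] := key _ _ t0; rewrite in_itv/= g0 !subr0 => /andP[c0 ct] ->.
  rewrite normrM exprSr mulrA ler_wpM2r//; apply: le_trans (g'C c) _.
  by rewrite ler_wpM2l// lerXn2r ?nnegrE// !ger0_norm.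
have [c] := key _ _ t0; rewrite in_itv/= g0 !sub0r => /andP[tc c0] E.
rewrite -normrN E normrM normrN exprSr mulrA ler_wpM2r//; apply: le_trans (g'C c) _.
by rewrite ler_wpM2l// lerXn2r ?nnegrE// !ler0_norm ?lerN2.
Qed.

(** A cubic serves for the lower Taylor polynomials as well, with zero leading coefficients. *)
Lemma is_derive_sub_cubic (f : R -> R) (f' a b c d u : R) :
  is_derive u 1 f f' ->
  is_derive u 1 (fun t => f t - (a + t * b + t ^+ 2 / 2 * c + t ^+ 3 / 6 * d))
    (f' - (b + u * c + u ^+ 2 / 2 * d)).
Proof.
move=> df; apply: is_deriveB; clear df.
apply: is_derive_eq; rewrite /GRing.scale/=.
by field.
Qed.

Lemma taylor_jet (H : nat -> R -> R) C :
  (forall k, (k < 4)%N -> forall x : R, is_derive x 1 (H k) (H k.+1 x)) ->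
  (forall k, (k < 4)%N -> forall x, `|H k.+1 x| <= C) -> jet C H.
Proof.
move=> dH hC.
have dHs k (x u : R) : (k < 4)%N -> is_derive u 1 (fun t : R => H k (x + t)) (H k.+1 (x + u)).
  move=> k4; have := dH k k4 (x + u) => dd.
  have := @is_derive1_comp R (H k) (fun t : R => x + t) u (H k.+1 (x + u)) 1.
  rewrite mulr1; apply => //.
  by apply: is_derive_eq (is_deriveD (is_derive_cst x u 1) (is_derive_id u 1)) _; rewrite add0r.
have g3 x t : `|H 3%N (x + t) - H 3%N x| <= C * `|t| ^+ 1.
  apply: (@taylor_bound (fun t => H 3%N (x + t) - H 3%N x) (fun u => H 4 (x + u))).
  - by rewrite addr0 subrr.
  - move=> u; exact: is_derive_eq (is_deriveB (dHs 3%N x u isT) (is_derive_cst _ _ _)) (subr0 _).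
  - by move=> u; rewrite expr0 mulr1; exact: hC.
have g2 x t : `|H 2%N (x + t) - (H 2%N x + t * H 3%N x)| <= C * `|t| ^+ 2.
  apply: (@taylor_bound (fun t => H 2%N (x + t) - (H 2%N x + t * H 3%N x))
    (fun u => H 3%N (x + u) - H 3%N x)) => //.
  - by rewrite addr0 mul0r addr0 subrr.
  - move=> u.
    rewrite (_ : (fun _ => _) = fun t : R => H 2%N (x + t) -
      (H 2%N x + t * H 3%N x + t ^+ 2 / 2 * 0 + t ^+ 3 / 6 * 0)); last first.
      by apply/funext => t'; rewrite !mulr0 !addr0.
    have := is_derive_sub_cubic (H 2%N x) (H 3%N x) 0 0 (dHs 2%N x u isT).
    by rewrite (_ : H 3%N x + u * 0 + u ^+ 2 / 2 * 0 = H 3%N x) // !mulr0 !addr0.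
have g1 x t : `|H 1%N (x + t) - (H 1%N x + t * H 2%N x + t ^+ 2 / 2 * H 3%N x)| <= C * `|t| ^+ 3.
  apply: (@taylor_bound (fun t => H 1%N (x + t) - (H 1%N x + t * H 2%N x + t ^+ 2 / 2 * H 3%N x))
    (fun u => H 2%N (x + u) - (H 2%N x + u * H 3%N x))) => //.
  - by rewrite addr0 !expr0n/= !mul0r !addr0 subrr.
  - move=> u.
    rewrite (_ : (fun _ => _) = fun t : R => H 1%N (x + t) -
      (H 1%N x + t * H 2%N x + t ^+ 2 / 2 * H 3%N x + t ^+ 3 / 6 * 0)); last first.
      by apply/funext => t'; rewrite !mulr0 !addr0.
    have := is_derive_sub_cubic (H 1%N x) (H 2%N x) (H 3%N x) 0 (dHs 1%N x u isT).
    by rewrite (_ : H 2%N x + u * H 3%N x + u ^+ 2 / 2 * 0 = H 2%N x + u * H 3%N x) // mulr0 addr0.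
have g0 x t : `|H 0%N (x + t) - (H 0%N x + t * H 1%N x + t ^+ 2 / 2 * H 2%N x + t ^+ 3 / 6 * H 3%N x)| <= C * `|t| ^+ 4.
  apply: (@taylor_bound (fun t => H 0%N (x + t) - (H 0%N x + t * H 1%N x + t ^+ 2 / 2 * H 2%N x + t ^+ 3 / 6 * H 3%N x))
    (fun u => H 1%N (x + u) - (H 1%N x + u * H 2%N x + u ^+ 2 / 2 * H 3%N x))) => //.
  - by rewrite addr0 !expr0n/= !mul0r !addr0 subrr.
  - by move=> u; exact: (is_derive_sub_cubic _ _ _ _ (dHs 0%N x u isT)).
split.
- move=> k k4 x y.
  have E : y + (x - y) = x by rewrite addrC subrK.
  rewrite -[X in H k X - _]E -[X in C * X]expr1.
  apply: (@taylor_bound (fun t => H k (y + t) - H k y) (fun u => H k.+1 (y + u))).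
  + by rewrite addr0 subrr.
  + move=> u; exact: is_derive_eq (is_deriveB (dHs k y u k4) (is_derive_cst _ _ _)) (subr0 _).
  + by move=> u; rewrite expr0 mulr1; exact: hC.
- exact: (hC 1%N).
- exact: (hC 2%N).
- move=> x t; have := g0 x t; rewrite (_ : `|t| ^+ 4 = t ^+ 4)//.
  by rewrite -normrX ger0_norm// exprn_even_ge0.
- by move=> x t; have := g2 x t; rewrite (_ : `|t| ^+ 2 = t ^+ 2)// real_normK ?num_real.
Qed.

Lemma C4_jet h : C4_bounded_derivatives h ->
  exists C, jet C (fun k => h^`(k)%classic).
Proof.
move=> [dh _ bh].
pose H k : R -> R := h^`(k)%classic.
have [C1 b1] := bh 1%N isT; have [C2 b2] := bh 2%N isT.
have [C3 b3] := bh 3%N isT; have [C4 b4] := bh 4%N isT.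
pose C := `|C1| + `|C2| + `|C3| + `|C4|.
have hC k : (k < 4)%N -> forall x, `|H k.+1 x| <= C.
  have n1 := normr_ge0 C1; have n2 := normr_ge0 C2; have n3 := normr_ge0 C3; have n4 := normr_ge0 C4.
  have l1 := ler_norm C1; have l2 := ler_norm C2; have l3 := ler_norm C3; have l4 := ler_norm C4.
  case: k => [|[|[|[|//]]]] _ x; rewrite /C.
  - by apply: le_trans (b1 x) _; lra.
  - by apply: le_trans (b2 x) _; lra.
  - by apply: le_trans (b3 x) _; lra.
  - by apply: le_trans (b4 x) _; lra.
have dH k : (k < 4)%N -> forall x : R, is_derive x 1 (H k) (H k.+1 x).
  move=> k4 x; rewrite /H derive1nS derive1E.
  by apply: DeriveDef => //; exact: dh.
exists C; exact: taylor_jet dH hC.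
Qed.

End C4_jet.

Section normal_lip.
Context {R : realType}.

(** The scaling formula concerns nonnegative functions, so [f] is split into f + |f| and |f|, both
    Lipschitz. *)
Lemma Rintegral_normal_lip C (f : R -> R) (s : R) : 0 < s -> lip C f ->
  \int[normal_prob 0 s]_x f x = gs s f 0.
Proof.
move=> s0 fL.
have pos (g : R -> R) D : lip D g -> (forall x, 0 <= g x) ->
    (\int[normal_prob 0 s]_x (g x)%:E = (gs s g 0)%:E)%E.
  move=> gL g0.
  have mg : measurable_fun setT (fun x : measurableTypeR R => (g x)%:E).
    apply/measurable_EFinP; exact: lip_measurable gL.
  rewrite -(ge0_integral_normal_scale s0 mg (fun x => _)) ?lee_fin//.
  rewrite /gs /Rintegral fineK; last exact: (integrable_fin_num measurableT (gs_integrable _ _ gL)).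
  by apply: eq_integral => x _; rewrite add0r.
have int (g : R -> R) D : lip D g -> (forall x, 0 <= g x) ->
    (normal_prob 0 s).-integrable setT (EFin \o g).
  move=> gL g0; apply/integrableP; split.
    apply/measurable_EFinP; exact: lip_measurable gL.
  rewrite (_ : (\int[_]_x _)%E = (gs s g 0)%:E) ?ltry//.
  rewrite -(pos _ _ gL g0); apply: eq_integral => x _.
  by rewrite /= ger0_norm.
have nL := lipN fL; have pL := lipD fL nL.
have p0 x : 0 <= f x + `|f x| by rewrite -lerBlDl sub0r -normrN ler_norm.
have fE : f = (fun y => 1 * (f y + `|f y|) + (-1) * `|f y|).
  by apply/funext => y; rewrite mul1r mulN1r addrK.
rewrite [in RHS]fE (gs_comb _ _ _ _ pL nL) mul1r mulN1r.
rewrite [in LHS]fE; under eq_Rintegral do rewrite mul1r mulN1r.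
rewrite (RintegralB measurableT (int _ _ pL p0) (int _ _ nL (fun x => normr_ge0 (f x)))).
by rewrite /Rintegral (pos _ _ pL p0) (pos _ _ nL).
Qed.

End normal_lip.

(** The nested square root is alpha^(1/8), the scale s^(1/4) of the third differences for s =
    sqrt(alpha); after division by s it is the only factor left, and it tends to 0. *)
Lemma expansion_leading (R : realType) (law : R -> probability (measurableTypeR R) R)
    (gauss : probability (measurableTypeR R) R) (c K a1 : R) (h : R -> R) : 0 < a1 ->
  (forall alpha, 0 < alpha < a1 ->
    `|\int[law alpha]_y h y - \int[gauss]_y h y + c * Num.sqrt alpha|
    <= K * Num.sqrt alpha * Num.sqrt (Num.sqrt (Num.sqrt alpha))) ->
  (\int[law alpha]_y h y - \int[gauss]_y h y) / Num.sqrt alpha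
      @[alpha --> 0^'+] --> - c.
Proof.
move=> a10 H.
pose e (a : R) := Num.sqrt (Num.sqrt (Num.sqrt a)).
have e0 : K * e a @[a --> 0^'+] --> 0.
  rewrite -[X in _ --> X](mulr0 K); apply: cvgM; first exact: cvg_cst.
  have c2 : continuous (fun a : R => Num.sqrt (Num.sqrt a)).
    by move=> x; exact: (@continuous_comp _ _ _ (@Num.sqrt R) (@Num.sqrt R) x
      (@sqrt_continuous R x) (@sqrt_continuous R _)).
  have ce : continuous e.
    by move=> x; exact: (@continuous_comp _ _ _ (fun a : R => Num.sqrt (Num.sqrt a))
      (@Num.sqrt R) x (c2 x) (@sqrt_continuous R _)).
  apply: cvg_at_right_filter; rewrite -[X in _ --> X](_ : e 0 = 0).
    exact: ce.
  by rewrite /e !sqrtr0.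
apply/cvgrPdist_le => eps eps0.
near=> a.
have a0 : 0 < a by near: a; exact: nbhs_right_gt.
have aa1 : a < a1 by near: a; exact: nbhs_right_lt.
have s0 : 0 < Num.sqrt a by rewrite sqrtr_gt0.
have : K * e a <= eps.
  near: a; have /cvgrPdist_le /(_ _ eps0) := e0.
  by apply: filterS => a; rewrite sub0r normrN => /(le_trans (ler_norm _)).
apply: le_trans.
have := H a; rewrite a0 aa1 => /(_ isT).
move: (\int[law a]_y h y) (\int[gauss]_y h y) => x y Hxy.
rewrite -(ler_pM2r s0) -[X in _ * X](gtr0_norm s0) -normrM.
rewrite -normrN [X in `|X| <= _](_ : _ = x - y + c * Num.sqrt a); last first.
  by field; rewrite gt_eqF.
by apply: le_trans Hxy _; rewrite mulrAC.
Unshelve. all: by end_near. Qed.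

(** * Fair coin sequences *)

Notation coin_cylinders :=
  [set A : set (nat -> bool) | exists i b, A = [set w | w i = b]].
Notation coins := (g_sigma_algebraType coin_cylinders).

Section coin_space.
Implicit Types (w : coins) (b : bool).

Definition coin (i : nat) : coins -> bool := fun w => w i.
Definition ccons b : coins -> coins := fun w i => if i is j.+1 then w j else b.
Definition ctail : coins -> coins := fun w i => w i.+1.

Lemma measurable_to_coins d (T : measurableType d) (f : T -> coins) :
  (forall i, measurable_fun setT (fun x => f x i)) -> measurable_fun setT f.
Proof.
move=> mf; apply: (@measurability _ _ _ _ setT f coin_cylinders) => //.
move=> _ [_ [i [b ->]] <-].
rewrite (_ : _ @^-1` _ = (fun x => f x i) @^-1` [set b])//.
exact: mf.
Qed.

Lemma measurable_coin i : measurable_fun setT (coin i).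
Proof.
move=> _ B _; rewrite setTI.
rewrite (_ : _ @^-1` _ = (if true \in B then [set w : coins | w i = true] else set0) `|`
   (if false \in B then [set w : coins | w i = false] else set0)); last first.
  apply/seteqP; split => w /=; rewrite /coin.
    by case wi : (w i) => /mem_set -> ; [left|right].
  move=> [|]; (case: ifPn => // /set_mem Bb /=); by move=> ->.
by apply: measurableU; case: ifPn => // _; apply: sub_sigma_algebra; exists i; eexists.
Qed.

Lemma measurable_ccons b : measurable_fun setT (ccons b).
Proof.
apply: measurable_to_coins => -[|i] /=; first exact: measurable_cst.
exact: measurable_coin.
Qed.

Lemma measurable_ctail : measurable_fun setT ctail.
Proof. by apply: measurable_to_coins => i; exact: (measurable_coin i.+1). Qed.

End coin_space.

Section binary_digits.
Context {R : realType}.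
Local Notation mu := (@lebesgue_measure R).

(* Binary digits of a uniform point of [0, 1[ are fair coins. *)
Definition hbit (x : measurableTypeR R) : bool := 2^-1 <= x.
Definition hrem (x : measurableTypeR R) : measurableTypeR R := 2 * x - (hbit x)%:R.
Definition digits (x : measurableTypeR R) : coins := fun i => hbit (iter i hrem x).

Lemma measurable_hbit : measurable_fun setT hbit.
Proof. by apply: measurable_fun_ler. Qed.

Lemma measurable_hrem : measurable_fun setT hrem.
Proof.
apply: measurable_funB; first exact: measurable_funM.
rewrite (_ : (fun x => _) = fun x => if hbit x then 1 else 0); last first.
  by apply/funext => x; case: (hbit x).
by apply: measurable_fun_ifT => //; exact: measurable_hbit.
Qed.

Lemma measurable_digits : measurable_fun setT digits.
Proof.
apply: measurable_to_coins => i.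
have mi : measurable_fun setT (iter i hrem).
  elim: i => [|i IH]; first exact: measurable_id.
  exact: (measurableT_comp measurable_hrem IH).
exact: (measurableT_comp measurable_hbit mi).
Qed.

Lemma digits_half (b : bool) (x : R) : 0 <= x < 1 ->
  digits ((x + b%:R) / 2) = ccons b (digits x).
Proof.
move=> /andP[x0 x1]; have hb : hbit ((x + b%:R) / 2) = b.
  rewrite /hbit; case: b => /=; first by lra.
  by apply/negbTE; rewrite -ltNge; lra.
apply/funext => -[|i]; first exact: hb.
rewrite /digits iterSr /= /ccons; congr (hbit (iter i _ _)).
by rewrite /hrem hb; field.
Qed.

End binary_digits.

Section to_prob.
Context d (T : measurableType d) (R : realType).
Variable m : {measure set T -> \bar R}.
Hypothesis m1 : m setT = 1%E.

(** The proof that the total mass is 1 is an argument, so that the probability structure declared on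
    [prob_fun m1] can draw on it. *)
Definition prob_fun (_ : m setT = 1%E) : set T -> \bar R := m.

HB.instance Definition _ := isMeasure.Build _ _ _ (prob_fun m1)
  (measure0 m) (measure_ge0 m) (@measure_semi_sigma_additive _ _ _ m).
HB.instance Definition _ := Measure_isProbability.Build _ _ _ (prob_fun m1) m1.

Definition to_prob : probability T R := prob_fun m1.

End to_prob.

Section coin_measure.
Context {R : realType}.
Local Notation mu := (@lebesgue_measure R).

Definition unit_itv : set (measurableTypeR R) := `[0%R, 1%R[%classic.

Lemma measurable_unit_itv : measurable unit_itv.
Proof. exact: measurable_itv. Qed.

Definition coin_measure : {measure set coins -> \bar R} :=
  push_measure (mrestr mu measurable_unit_itv) measurable_digits.

Lemma coin_measureE A : coin_measure A = mu (digits @^-1` A `&` unit_itv).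
Proof. by []. Qed.

Lemma coin_measure_setT : coin_measure setT = 1%E.
Proof.
rewrite coin_measureE preimage_setT setTI lebesgue_measure_itv/= lte01.
by rewrite sube0.
Qed.

Definition coin_prob : probability coins R := to_prob coin_measure_setT.

Let half_itv (b : bool) : set (measurableTypeR R) := `[b%:R / 2, (b%:R + 1) / 2[%classic.

Lemma coin_measure_ccons b A : measurable A ->
  coin_measure (ccons b @^-1` A) = (2%:E * mu (digits @^-1` A `&` half_itv b))%E.
Proof.
move=> mA; rewrite coin_measureE.
have mdA : measurable (digits @^-1` A `&` half_itv b).
  apply: measurableI; last exact: measurable_itv.
  by rewrite -[_ @^-1` _]setTI; exact: measurable_digits.
have h0 : 0 < 2^-1 :> R by rewrite invr_gt0.
have := lebesgue_measure_affine (b%:R / 2) h0 mdA; rewrite invrK => <-.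
congr (mu _); apply/seteqP; split => x /=.
  move=> [Ax x01]; move: (x01); rewrite /unit_itv /half_itv/= !in_itv/= => x01'.
  rewrite /affine (_ : 2^-1 * x + b%:R / 2 = (x + b%:R) / 2); last by ring.
  rewrite digits_half//; split => //.
  by move: x01' => /andP[]; case: b {Ax mdA} => /= *; apply/andP; split; lra.
rewrite /affine (_ : 2^-1 * x + b%:R / 2 = (x + b%:R) / 2); last by ring.
rewrite /half_itv/= in_itv/= => -[Ax xb].
have x01 : 0 <= x < 1.
  by move: xb => /andP[]; case: b {Ax mdA} => /= *; apply/andP; split; lra.
by rewrite digits_half in Ax.
Qed.

(* Adding a leading binary digit halves [0, 1[, so the law of a sequence of fair
   coins is self-similar. *)
Lemma coin_prob_selfsim A : measurable A ->
  coin_prob A = (2^-1%:E * (coin_prob (ccons false @^-1` A) + coin_prob (ccons true @^-1` A)))%E.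
Proof.
move=> mA; rewrite /coin_prob !coin_measure_ccons//.
have mdA : measurable (digits @^-1` A : set (measurableTypeR R)).
  by rewrite -[_ @^-1` _]setTI; exact: measurable_digits.
have mh b : measurable (half_itv b) by exact: measurable_itv.
rewrite -ge0_muleDr// muleA -EFinM mulVf// mul1e -measureU//.
- rewrite coin_measureE -setIUr; congr (mu (_ `&` _)).
  apply/seteqP; split => x; rewrite /unit_itv /half_itv/= !in_itv/=.
    move=> /andP[x0 x1]; have [xh|xh] := ltP x 2^-1.
      by left; apply/andP; split; lra.
    by right; apply/andP; split; lra.
  by move=> [] /andP[? ?]; apply/andP; split; lra.
- exact: measurableI.
- exact: measurableI.
- apply/seteqP; split => x //=; rewrite /half_itv/= !in_itv/=.
  by move=> [[_ /andP[_ ?]] [_ /andP[? _]]]; lra.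
Qed.

End coin_measure.

(* Flipping a coin preserves the law, so an event that does not see a coin is
   independent of it; this replaces a product-measure construction. *)
Section coin_flip.
Context {R : realType}.
Local Notation P := (@coin_prob R).

(** Defined by recursion along the sequence, so that [flip i.+1] commutes with prepending a coin and
    self-similarity can drive the induction in [coin_prob_flip]; [flipE] gives the coordinatewise
    form. *)
Fixpoint flip (i : nat) (w : coins) : coins :=
  if i is j.+1 then ccons (w 0%N) (flip j (ctail w)) else ccons (~~ w 0%N) (ctail w).

Lemma flipE i w j : flip i w j = (if j == i then ~~ w j else w j).
Proof.
elim: i w j => [|i IH] w [|j] //=.
by rewrite IH /ctail eqSS.
Qed.

Lemma measurable_flip i : measurable_fun setT (flip i).
Proof.
apply: measurable_to_coins => j.
rewrite (_ : (fun w => _) = (fun w : coins => if j == i then ~~ w j else w j)); last first.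
  by apply/funext => w; rewrite flipE.
case: (j == i); last exact: measurable_coin.
by apply: (measurableT_comp (f := negb)) => //; exact: measurable_coin.
Qed.

(** [flip 0] exchanges the two halves of the self-similarity relation, and [flip i.+1] acts as
    [flip i] inside each half. *)
Lemma coin_prob_flip i A : measurable A -> P (flip i @^-1` A) = P A.
Proof.
have mF j B : measurable B -> measurable (flip j @^-1` B).
  by move=> mB; rewrite -[_ @^-1` _]setTI; exact: measurable_flip.
have mc b B : measurable B -> measurable (ccons b @^-1` B).
  by move=> mB; rewrite -[_ @^-1` _]setTI; exact: measurable_ccons.
elim: i A => [|i IH] A mA; rewrite [LHS]coin_prob_selfsim ?[RHS]coin_prob_selfsim//;
  try exact: mF.
  rewrite addeC; congr (_ * (_ + _))%E.
congr (_ * (_ + _))%E.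
  by rewrite -[RHS]IH//; exact: mc.
by rewrite -[RHS]IH//; exact: mc.
Qed.

End coin_flip.

(** * Iterated function systems and the invariant law *)

Section selfsim.
Context {R : realType}.

(* [m] is invariant under the iterated function system [F 0, ..., F n], each
   map being chosen with probability [1 / n.+1]. *)
Definition selfsim d (T : measurableType d) n (F : nat -> T -> T)
    (m : set T -> \bar R) : Prop :=
  forall A, measurable A ->
    m A = ((n.+1%:R)^-1%:E * \sum_(i < n.+1) m (F i @^-1` A))%E.

Context d (T : measurableType d) (n : nat) (F : nat -> T -> T).
Hypothesis mF : forall i, measurable_fun setT (F i).
Variable m : probability T R.
Hypothesis ssm : selfsim n F m.

Definition bmeas (g : T -> R) : Prop :=
  measurable_fun setT g /\ exists M, forall x, `|g x| <= M.

Lemma bmeas_integrable g : bmeas g -> m.-integrable setT (EFin \o g).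
Proof.
move=> [mg [M gM]]; apply: (measurable_bounded_integrable measurableT) => //.
- by rewrite (@le_lt_trans _ _ 1%E) ?probability_le1 ?ltry.
- exists M; split; first exact: num_real.
  by move=> x /ltW Mx y _; apply: le_trans Mx; exact: gM.
Qed.

Definition avg (g : T -> R) : T -> R :=
  fun x => (n.+1%:R)^-1 * \sum_(i < n.+1) g (F i x).

Lemma avg_bound g M : (forall x, `|g x| <= M) -> forall x, `|avg g x| <= M.
Proof.
move=> gM x; rewrite /avg normrM ger0_norm ?invr_ge0// ler_pdivrMl//.
apply: le_trans (ler_norm_sum _ _ _) _.
apply: (@le_trans _ _ (\sum_(i < n.+1) M)); first exact: ler_sum.
by rewrite sumr_const card_ord -[leLHS]mulr_natl.
Qed.

Lemma bmeas_avg g : bmeas g -> bmeas (avg g).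
Proof.
move=> [mg [M gM]]; split; last by exists M; exact: avg_bound.
apply: measurable_funM => //; apply: measurable_sum => i.
exact: (measurableT_comp mg (mF i)).
Qed.

Let ge0_selfsim_integral g : bmeas g -> (forall x, 0 <= g x) ->
  (\int[m]_x (g x)%:E = \int[m]_x (avg g x)%:E)%E.
Proof.
move=> bg g0; have [mg [M gM]] := bg.
have c0 : 0 <= (n.+1%:R)^-1 :> R by rewrite invr_ge0.
have mE : measurable_fun setT (EFin \o g) by exact/measurable_EFinP.
have mEF i : measurable_fun setT (fun x => (g (F i x))%:E).
  by apply/measurable_EFinP; exact: (measurableT_comp mg (mF i)).
have g0E : forall x, setT x -> (0 <= (EFin \o g) x)%E by move=> x _; rewrite lee_fin.
pose p i : {measure set T -> \bar R} := push_measure m (mF i).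
pose q : {measure set T -> \bar R} := mscale (NngNum c0) (msum p n.+1).
have -> : (\int[m]_x (g x)%:E = \int[q]_x (EFin \o g) x)%E.
  by apply: eq_measure_integral => A mA _; rewrite [LHS]ssm.
rewrite (ge0_integral_mscale _ measurableT _ mE g0E).
rewrite (ge0_integral_measure_sum _ measurableT g0E mE).
have -> : (\int[m]_x (avg g x)%:E =
    (n.+1%:R)^-1%:E * \int[m]_x \sum_(i < n.+1) (g (F i x))%:E)%E.
  rewrite -ge0_integralZl//.
  - by apply: eq_integral => x _; rewrite /avg EFinM sumEFin.
  - by apply: emeasurable_sum => i; exact: mEF.
  - by move=> x _; apply: sume_ge0 => i _; rewrite lee_fin.
congr (_ * _)%E.
rewrite (@ge0_integral_sum _ _ _ m setT measurableT _ (fun (i : 'I_n.+1) x => (g (F i x))%:E)) //; last first.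
  by move=> i x _; rewrite lee_fin.
apply: eq_bigr => i _.
have g0D : {in [set: T], forall y, (0 <= (EFin \o g) y)%E} by move=> x _; rewrite lee_fin.
exact: (ge0_integral_pushforward (mF i) m measurableT mE g0D).
Qed.

Lemma selfsim_integral g : bmeas g -> \int[m]_x g x = \int[m]_x avg g x.
Proof.
move=> bg; have [mg [M gM]] := bg.
pose g' x := g x + M.
have mg' : measurable_fun setT g' by exact: measurable_funD.
have bg' : bmeas g'.
  split => //; exists (M + M) => x; rewrite (le_trans (ler_normD _ _))// lerD//.
  by rewrite ger0_norm// (le_trans _ (gM x)).
have g'0 x : 0 <= g' x.
  by rewrite -lerBlDr sub0r; have := gM x; rewrite ler_norml => /andP[].
have avgE x : avg g' x = avg g x + M.
  rewrite /avg /g' big_split/= sumr_const card_ord mulrDr -[M *+ _]mulr_natl.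
  by rewrite mulKf// pnatr_eq0.
have bM : bmeas (fun=> M).
  split; first exact: measurable_cst.
  by exists M => x; rewrite ger0_norm// (le_trans _ (gM x)).
have : \int[m]_x g' x = \int[m]_x avg g' x.
  by rewrite /Rintegral ge0_selfsim_integral.
under [X in _ = X -> _]eq_Rintegral do rewrite avgE.
rewrite !RintegralD//; try exact: bmeas_integrable; last exact/bmeas_integrable/bmeas_avg.
exact: addIr.
Qed.

Lemma selfsim_integral_iter g k : bmeas g ->
  \int[m]_x g x = \int[m]_x iter k avg g x.
Proof.
move=> bg.
have bk j : bmeas (iter j avg g) by elim: j => //= j; exact: bmeas_avg.
by elim: k => // k -> /=; exact: selfsim_integral.
Qed.

End selfsim.

Section sgd_ifs.
Context {R : realType} d (Z : measurableType d).
Variables (alpha b : R) (xi : Z -> R) (n : nat) (nxt : nat -> Z -> Z).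
Let q := 1 - alpha.
Local Notation RZ := (R * Z)%type.

Hypothesis alpha01 : 0 < alpha < 1.
Hypothesis xib : forall z, `|xi z| <= b.
Hypothesis mxi : measurable_fun setT xi.
Hypothesis mnxt : forall i, measurable_fun setT (nxt i).

Let a0 : 0 < alpha. Proof. by case/andP: alpha01. Qed.
Let q0 : 0 < q. Proof. by rewrite subr_gt0; case/andP: alpha01. Qed.
Let q1 : q < 1. Proof. by rewrite /q ltrBlDr ltrDl. Qed.

Definition sgd_map i (w : RZ) : RZ := (q * w.1 + alpha * xi w.2, nxt i w.2).

Lemma measurable_sgd_map i : measurable_fun setT (sgd_map i).
Proof.
apply/measurable_fun_pairP; split => /=.
  apply: measurable_funD; apply: measurable_funM => //.
  exact: (measurableT_comp mxi measurable_snd).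
exact: (measurableT_comp (mnxt i) measurable_snd).
Qed.

Hypothesis coupling : forall i j z z', nxt i (nxt j z) = nxt i (nxt j z').

(** Nothing is asked of the dependence on z, so that products of a Lipschitz function of x with an
    indicator in z belong to the class. *)
Definition lipx (L : R) (g : RZ -> R) : Prop :=
  forall x x' z, `|g (x, z) - g (x', z)| <= L * `|x - x'|.

Local Notation avg := (avg n sgd_map).

Lemma lipx_avg L g : lipx L g -> lipx (q * L) (avg g).
Proof.
move=> gL x x' z; rewrite /avg -mulrBr -sumrB normrM ger0_norm ?invr_ge0// ler_pdivrMl//.
apply: le_trans (ler_norm_sum _ _ _) _.
apply: (@le_trans _ _ (\sum_(i < n.+1) (q * L * `|x - x'|))).
  apply: ler_sum => i _; apply: le_trans (gL _ _ _) _.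
  rewrite /= (_ : _ - _ = q * (x - x')); last by ring.
  by rewrite normrM (gtr0_norm q0) mulrCA mulrA.
by rewrite sumr_const card_ord -[leLHS]mulr_natl.
Qed.

(** Driven by the same two choices, both starting points reach the same second coordinate, after
    which the Lipschitz property in the first one applies. Each of the two noise differences is at
    most 2 b, whence 4 b. *)
Lemma avg_coupling L g x z x' z' : 0 <= L -> lipx L g ->
  `|avg (avg g) (x, z) - avg (avg g) (x', z')| <= L * (`|x - x'| + 4 * b).
Proof.
move=> L0 gL.
have b0 : 0 <= b by apply: le_trans (xib z).
have q01 : 0 <= q * q <= q by rewrite mulr_ge0 ?ler_piMl ?ltW.
have step i j : `|g (sgd_map j (sgd_map i (x, z))) - g (sgd_map j (sgd_map i (x', z')))|
    <= L * (`|x - x'| + 4 * b).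
  rewrite /sgd_map/= (coupling j i z z').
  apply: le_trans (gL _ _ _) _; rewrite ler_wpM2l//.
  rewrite (_ : _ - _ = q * q * (x - x') + (q * alpha) * (xi z - xi z') +
    alpha * (xi (nxt i z) - xi (nxt i z'))); last by ring.
  have a1 : alpha <= 1 by case/andP: alpha01 => _ /ltW.
  have qa : 0 <= q * alpha <= 1.
    by rewrite mulr_ge0 ?mulr_ile1 ?(ltW q0) ?(ltW a0) ?(ltW q1).
  have B u v : `|xi u - xi v| <= b + b by apply: le_trans (ler_normB _ _) _; rewrite lerD.
  rewrite (_ : 4 * b = (b + b) + (b + b)); last by ring.
  rewrite addrA; apply: le_trans (ler_normD _ _) _; apply: lerD.
    apply: le_trans (ler_normD _ _) _; apply: lerD.
      rewrite normrM ger0_norm; last by case/andP: q01.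
      rewrite ler_piMl//; case/andP: q01 => _ /le_trans; apply; exact: ltW.
    case/andP: qa => qa0 qa1; rewrite normrM (ger0_norm qa0).
    by apply: le_trans (B z z'); rewrite ler_piMl.
  rewrite normrM (gtr0_norm a0); apply: le_trans (B (nxt i z) (nxt i z')).
  by rewrite ler_piMl.
have avg_le (f f' : nat -> R) K : (forall i, `|f i - f' i| <= K) ->
    `|(n.+1%:R)^-1 * (\sum_(i < n.+1) f i) - (n.+1%:R)^-1 * (\sum_(i < n.+1) f' i)| <= K.
  move=> H; rewrite -mulrBr -sumrB normrM ger0_norm ?invr_ge0// ler_pdivrMl//.
  apply: le_trans (ler_norm_sum _ _ _) _.
  apply: (@le_trans _ _ (\sum_(i < n.+1) K)); first exact: ler_sum.
  by rewrite sumr_const card_ord -[leLHS]mulr_natl.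
apply: (avg_le (fun i => avg g (sgd_map i (x, z))) (fun i => avg g (sgd_map i (x', z')))) => i.
exact: (avg_le (fun j => g (sgd_map j (sgd_map i (x, z)))) (fun j => g (sgd_map j (sgd_map i (x', z'))))).
Qed.

Lemma iter_avg_cvg L g x z x' z' k : 0 <= L -> lipx L g ->
  `|iter k.+2 avg g (x, z) - iter k.+2 avg g (x', z')| <= q ^+ k * L * (`|x - x'| + 4 * b).
Proof.
move=> L0 gL.
have lk j : lipx (q ^+ j * L) (iter j avg g).
  by elim: j => [|j IH] /=; [rewrite expr0 mul1r|rewrite exprS -mulrA; exact: lipx_avg].
have := @avg_coupling (q ^+ k * L) (iter k avg g) x z x' z' _ (lk k).
by apply; rewrite mulr_ge0// exprn_ge0// ltW.
Qed.

(** By invariance [g] and its iterated averages have the same integral, and these averages become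
    constant in the limit. Their value at the single point [w] does not involve [m], which is the
    source of uniqueness. *)
Lemma selfsim_lipx_integral L g (m : probability RZ R) (w : RZ) :
  bmeas g -> 0 <= L -> lipx L g -> selfsim n sgd_map m ->
  iter k.+2 avg g w @[k --> \oo] --> \int[m]_x g x.
Proof.
move=> bg L0 gL ssm.
have bk j : bmeas (iter j avg g) by elim: j => //= j; apply: bmeas_avg; exact: measurable_sgd_map.
have [M gM] := bg.2.
have kM j x : `|iter j avg g x| <= M by elim: j x => [|j IH] x //=; exact: avg_bound.
pose f k x : R := iter k.+2 avg g x - iter k.+2 avg g w.
have fE k : \int[m]_x f k x = \int[m]_x g x - iter k.+2 avg g w.
  rewrite RintegralB//; last 2 first.
  - exact: bmeas_integrable.
  - exact: finite_measure_integrable_cst.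
  rewrite -(selfsim_integral_iter measurable_sgd_map ssm k.+2 bg).
  rewrite Rintegral_cst//; congr (_ - _).
  by rewrite [X in _ * X](_ : _ = 1) ?mulr1//; have /= -> := probability_setT m.
have mf k : measurable_fun setT (EFin \o f k).
  apply/measurable_EFinP; apply: measurable_funB => //; exact: (bk _).1.
have fcv (x : RZ) : [set: RZ] x -> (EFin \o f k) x @[k --> \oo] --> (0:R)%:E.
  move=> _; apply: cvg_EFin; first exact: nearW.
  apply/cvgr0Pnorm_le => e e0.
  have cv : q ^+ k * (L * (`|x.1 - w.1| + 4 * b)) @[k --> \oo] --> 0.
    rewrite -[X in _ --> X](mul0r (L * (`|x.1 - w.1| + 4 * b))).
    apply: cvgM; last exact: cvg_cst.
    by apply: cvg_expr; rewrite ger0_norm ?ltW.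
  move/cvgr0Pnorm_le : cv => /(_ _ e0); apply: filterS => k /= H.
  apply: le_trans (le_trans (ler_norm _) H); rewrite mulrA.
  by have := iter_avg_cvg x.1 x.2 w.1 w.2 k L0 gL; rewrite -!surjective_pairing.
have fdom (x : RZ) : forall k, [set: RZ] x -> (`|(EFin \o f k) x| <= (M + M)%:E)%E.
  by move=> k _; rewrite lee_fin (le_trans (ler_normB _ _))// lerD.
have mc0 : measurable_fun [set: RZ] (cst (0:R)%:E) by exact: measurable_cst.
have icM : m.-integrable [set: RZ] (cst (M + M)%:E) by exact: finite_measure_integrable_cst.
have [_ _ +] := @dominated_convergence _ _ _ m setT measurableT (fun k => EFin \o f k)
  (cst (0:R)%:E) (cst (M + M)%:E) mf mc0 (aeW _ fcv) icM (aeW _ fdom).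
rewrite integral0 => /fine_cvg cv.
have cv' : \int[m]_x g x - iter k.+2 avg g w @[k --> \oo] --> 0.
  rewrite (_ : (fun k => _) = fun k => \int[m]_x f k x); first exact: cv.
  by apply/funext => k; rewrite fE.
rewrite (_ : (fun k => _) = fun k => \int[m]_x g x - (\int[m]_x g x - iter k.+2 avg g w)).
  rewrite -[X in _ --> X]subr0; apply: cvgB cv'; exact: cvg_cst.
by apply/funext => k; rewrite opprB addrCA subrr addr0.
Qed.

End sgd_ifs.

Section sgd_unique.
Context {R : realType} d (Z : measurableType d).
Local Notation RZ := (R * Z)%type.

(** Lipschitz approximations from below of the indicator of the open half-line under t. *)
Let ramp (t : R) k (x : R) : R := Num.min 1 (k%:R * Num.max 0 (t - x)).

Let ramp_cvg t x : ramp t k x @[k --> \oo] --> (if x < t then 1 else 0 : R).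
Proof.
have [xt|tx] := ltP x t; last first.
  rewrite (_ : (fun k => _) = fun=> 0); first exact: cvg_cst.
  apply/funext => k; rewrite /ramp (_ : Num.max 0 (t - x) = 0) ?mulr0.
    by rewrite minEle ler10.
  by apply/eqP; rewrite eq_maxl subr_le0.
have tx0 : 0 < t - x by rewrite subr_gt0.
apply: cvg_near_cst; exists (Num.truncn (t - x)^-1).+1 => // k /= kx.
rewrite /ramp (_ : Num.max 0 (t - x) = t - x); last by apply/eqP; rewrite eq_maxr ltW.
apply/eqP; rewrite eq_minl -ler_pdivrMr// mul1r.
by rewrite ltW// (lt_le_trans (truncnS_gt _))// ler_nat.
Qed.

Let ramp01 t k x : 0 <= ramp t k x <= 1.
Proof.
rewrite /ramp ge_min lexx/= le_min ler01/= mulr_ge0// le_max lexx//.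
Qed.

Let ramp_lip t k x y : `|ramp t k x - ramp t k y| <= k%:R * `|x - y|.
Proof.
wlog xy : x y / x <= y.
  have [xy|/ltW yx] := leP x y; first exact.
  by move=> /(_ _ _ yx); rewrite distrC (distrC y).
rewrite /ramp.
have M : Num.max 0 (t - y) <= Num.max 0 (t - x) by rewrite ge_max !le_max lexx/= lerB ?orbT.
have M' : Num.max 0 (t - x) <= Num.max 0 (t - y) + (y - x).
  rewrite ge_max; apply/andP; split.
    by rewrite addr_ge0 ?subr_ge0// le_max lexx.
  rewrite (_ : t - x = t - y + (y - x)); last by ring.
  by rewrite lerD2r le_max lexx orbT.
move: M M'; move: (Num.max 0 (t - x)) (Num.max 0 (t - y)) => u v vu uv.
have k0 : 0 <= k%:R :> R by [].
rewrite distrC (ler0_norm (_ : x - y <= 0)) ?subr_le0// opprB.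
have ku : k%:R * v <= k%:R * u by rewrite ler_wpM2l.
have ku' : k%:R * u <= k%:R * v + k%:R * (y - x) by rewrite -mulrDr ler_wpM2l.
have xy0 : 0 <= k%:R * (y - x) by rewrite mulr_ge0// subr_ge0.
move: ku ku' xy0; move: (k%:R * u) (k%:R * v) (k%:R * (y - x)) => U V W VU UW W0.
rewrite ler_norml; apply/andP; split; rewrite !minEle; case: ifPn => h1; case: ifPn => h2; move: h1 h2; rewrite -?ltNge; lra.
Qed.

(** Ramps times indicators give equality on products of a half-line with [C]. For fixed [C] the
    half-lines determine the measure B -> m (B x C), and rectangles then determine the measure on
    the product. *)
Lemma lipx_measure_unique (m1 m2 : probability RZ R) :
  (forall L g, 0 <= L -> bmeas g -> lipx L g -> \int[m1]_x g x = \int[m2]_x g x) ->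
  forall A, measurable A -> m1 A = m2 A.
Proof.
move=> H.
have meas_ramp t k : measurable_fun setT (ramp t k : R -> R).
  apply: continuous_measurable_fun => x; apply/cvgrPdist_le => e e0.
  near=> y; apply: le_trans (ramp_lip _ _ _ _) _.
  apply: (@le_trans _ _ (k.+1%:R * `|x - y|)).
    by rewrite ler_wpM2r// ler_nat.
  rewrite -ler_pdivlMl//; near: y.
  by apply: (@cvgr_dist_le _ R^o); [exact: cvg_id|rewrite mulr_gt0 ?invr_gt0].
have half t C : measurable C ->
    m1 ([set x | x < t] `*` C) = m2 ([set x | x < t] `*` C).
  move=> mC; pose g k (w : RZ) : R := ramp t k w.1 * \1_C w.2.
  have mg k : measurable_fun setT (g k).
    apply: measurable_funM.
      exact: (measurableT_comp (meas_ramp t k) measurable_fst).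
    exact: (measurableT_comp (measurable_indic mC) measurable_snd).
  have g1 k w : `|g k w| <= 1.
    case/andP: (ramp01 t k w.1) => r0 r1; rewrite /g normrM (ger0_norm r0) mulr_ile1//.
    by rewrite indicE; case: (_ \in _); rewrite ?normr1 ?normr0.
  have bg k : bmeas (g k) by split => //; exists 1.
  have lg k : lipx k%:R (g k).
    move=> x x' z; rewrite /g/= -mulrBl normrM; apply: le_trans (ramp_lip t k x x').
    by rewrite ler_piMr// indicE; case: (_ \in _); rewrite ?normr1 ?normr0.
  have cvm (m : probability RZ R) :
      \int[m]_x g k x @[k --> \oo] --> fine (m ([set x | x < t] `*` C)).
    pose AC : set RZ := [set x : R | x < t] `*` C.
    rewrite -/AC; have mA : measurable AC.
      apply: measurableX => //.
      by rewrite (_ : [set x | x < t] = `]-oo, t[%classic)//; apply/seteqP; split => x /=; rewrite in_itv.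
    have gcv (w : RZ) : [set: RZ] w -> (EFin \o g k) w @[k --> \oo] -->
        (EFin \o (\1_AC : RZ -> R)) w.
      move=> _; apply: cvg_EFin; first exact: nearW.
      rewrite (_ : \1_AC w = (if w.1 < t then 1 else 0) * \1_C w.2).
        by apply: cvgM; [exact: ramp_cvg|exact: cvg_cst].
      rewrite !indicE; have [wt|wt] := ifPn.
        rewrite mul1r; congr (_%:R); congr (nat_of_bool _).
        by apply/idP/idP => [/set_mem[? ?]|/set_mem ?]; apply/mem_set.
      by rewrite mul0r memNset// => -[/= wt' _]; rewrite wt' in wt.
    have gdom (w : RZ) : forall k, [set: RZ] w -> (`|(EFin \o g k) w| <= 1%:E)%E.
      by move=> k _; rewrite lee_fin.
    have mi : measurable_fun [set: RZ] (\1_AC : RZ -> R) by exact: measurable_indic.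
    have m1A : measurable_fun [set: RZ] (EFin \o (\1_AC : RZ -> R)).
      exact/measurable_EFinP.
    have icM : m.-integrable [set: RZ] (cst (1:R)%:E) by exact: finite_measure_integrable_cst.
    have [_ _ +] := @dominated_convergence _ _ _ m setT measurableT (fun k => EFin \o g k)
      _ (cst 1%:E) (fun k => (measurable_EFinP _ _).2 (mg k)) m1A (aeW _ gcv)
      icM (aeW _ gdom).
    rewrite integral_indic// setIT => cv.
    by apply: fine_cvg; rewrite fineK ?fin_num_measure//; exact: cv.
  have e12 : fine (m1 ([set x | x < t] `*` C)) = fine (m2 ([set x | x < t] `*` C)).
    apply: (cvg_unique _ (cvm m1)) => //.
    rewrite (_ : (fun k => _) = fun k => \int[m2]_x g k x); first exact: cvm.
    by apply/funext => k; apply: (H k%:R).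
  have mH : measurable ([set x : R | x < t] `*` C).
    apply: measurableX => //.
    by rewrite (_ : [set x | x < t] = `]-oo, t[%classic)//; apply/seteqP; split => x /=; rewrite in_itv.
  have f1 := fin_num_measure m1 _ mH; have f2 := fin_num_measure m2 _ mH.
  by rewrite -(fineK f1) -(fineK f2) e12.
have rect B C : measurable B -> measurable C -> m1 (B `*` C) = m2 (B `*` C).
  move=> mB mC.
  have mSC : measurable ([set: R] `*` C) by exact: measurableX.
  pose n1 : {measure set R -> \bar R} := push_measure (mrestr m1 mSC) measurable_fst.
  pose n2 : {measure set R -> \bar R} := push_measure (mrestr m2 mSC) measurable_fst.
  have E (m : probability RZ R) (B' : set R) :
      push_measure (mrestr m mSC) measurable_fst B' = m (B' `*` C).
    rewrite /push_measure/= /pushforward /mrestr; congr (m _).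
    by apply/seteqP; split => [[x z]|[x z]] /=; tauto.
  have <- : n1 B = m1 (B `*` C) by exact: E.
  have <- : n2 B = m2 (B `*` C) by exact: E.
  pose G : set (set R) := @RGenInftyO.G R.
  pose gk k : set R := `]-oo, k%:R[%classic.
  have Gm : @measurable _ R = <<s G >> by exact: RGenInftyO.measurableE.
  have GI : setI_closed G.
    move=> _ _ [x ->] [y ->]; exists (Num.min x y).
    apply/seteqP; split => z /=; rewrite !in_itv/= lt_min; first by move=> [-> ->].
    by move=> /andP[-> ->].
  have Gg k : G (gk k) by exists k%:R.
  have gc : \bigcup_k (gk k) = setT.
    apply/seteqP; split => // x _; exists (Num.truncn x).+1 => //=.
    by rewrite /gk/= in_itv/= truncnS_gt.
  have n12 A : G A -> n1 A = n2 A.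
    move=> [x ->]; apply: etrans (E m1 _) (etrans _ (esym (E m2 _))).
    rewrite (_ : `]-oo, x[%classic = [set y | y < x]); first exact: half.
    by apply/seteqP; split => y /=; rewrite in_itv.
  have nfin k : (n1 (gk k) < +oo)%E.
    have -> : n1 (gk k) = m1 (gk k `*` C) by exact: E.
    apply: (@le_lt_trans _ _ 1%E); last exact: ltry.
    by apply: probability_le1; apply: measurableX => //; exact: measurable_itv.
  exact: (@measure_unique _ R R G gk Gm GI Gg gc n1 n2 n12 nfin B mB).
pose G : set (set RZ) := [set A `*` B | A in measurable & B in measurable].
have Gm : @measurable _ RZ = <<s G >> by exact: measurable_prod_measurableType.
have GI : setI_closed G.
  move=> _ _ [A mA [B mB <-]] [A' mA' [B' mB' <-]].
  by exists (A `&` A'); [exact: measurableI|exists (B `&` B'); [exact: measurableI|rewrite setXI]].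
have Gg (k : nat) : G ((fun=> setT) k).
  by exists setT => //; exists setT => //; rewrite setXTT.
have gc : \bigcup_(k in [set: nat]) ((fun=> [set: RZ]) k) = setT.
  by apply/seteqP; split => // x _; exists 0%N.
have n12 A : G A -> m1 A = m2 A by move=> [A' mA [B mB <-]]; exact: rect.
have nfin (k : nat) : (m1 ((fun=> [set: RZ]) k) < +oo)%E by rewrite probability_setT ltry.
move=> A mA; exact: (@measure_unique _ R RZ G (fun=> setT) Gm GI Gg gc m1 m2 n12 nfin A mA).
Unshelve. all: by end_near. Qed.

Variables (alpha b : R) (xi : Z -> R) (n : nat) (nxt : nat -> Z -> Z).
Hypothesis alpha01 : 0 < alpha < 1.
Hypothesis xib : forall z, `|xi z| <= b.
Hypothesis mxi : measurable_fun setT xi.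
Hypothesis mnxt : forall i, measurable_fun setT (nxt i).
Hypothesis coupling : forall i j z z', nxt i (nxt j z) = nxt i (nxt j z').

Lemma sgd_selfsim_unique (z0 : Z) (m1 m2 : probability RZ R) :
  selfsim n (sgd_map alpha xi nxt) m1 -> selfsim n (sgd_map alpha xi nxt) m2 ->
  forall A, measurable A -> m1 A = m2 A.
Proof.
move=> s1 s2; apply: lipx_measure_unique => L g L0 bg gL.
have c m := @selfsim_lipx_integral R d Z alpha b xi n nxt alpha01 xib mxi mnxt coupling L g m (0, z0) bg L0 gL.
by apply: (cvg_unique _ (c m1 s1) (c m2 s2)).
Qed.

End sgd_unique.

(** * The two-coin chain *)

Section uniform_points.
Context d (T : measurableType d) (R : realType) (n : nat) (t : nat -> T).

Let ge0 : 0 <= (n.+1%:R)^-1 :> R. Proof. by rewrite invr_ge0. Qed.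

Definition unif_measure : {measure set T -> \bar R} :=
  mscale (NngNum ge0) (msum (fun i => \d_(t i)) n.+1).

Lemma unif_measureE A :
  unif_measure A = ((n.+1%:R)^-1 * \sum_(i < n.+1) (t i \in A)%:R)%:E.
Proof.
rewrite /unif_measure/= /mscale/= /msum EFinM -sumEFin; congr (_ * _)%E.
Qed.

Lemma unif_measure_setT : unif_measure setT = 1%E.
Proof.
rewrite unif_measureE (eq_bigr (fun=> 1)); last by move=> i _; rewrite in_setT.
by rewrite sumr_const card_ord mulVf ?pnatr_eq0.
Qed.

Definition unif_prob : probability T R := to_prob unif_measure_setT.

Lemma unif_probE A :
  unif_prob A = ((n.+1%:R)^-1 * \sum_(i < n.+1) (t i \in A)%:R)%:E.
Proof. exact: unif_measureE. Qed.

Lemma ge0_integral_unif_prob (f : T -> \bar R) : measurable_fun setT f ->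
  (forall x, 0 <= f x)%E ->
  (\int[unif_prob]_x f x = (n.+1%:R)^-1%:E * \sum_(i < n.+1) f (t i))%E.
Proof.
move=> mf f0.
have -> : (\int[unif_prob]_x f x = \int[unif_measure]_x f x)%E.
  by apply: eq_measure_integral.
rewrite /unif_measure (ge0_integral_mscale _ measurableT _ mf (fun x _ => f0 x)).
rewrite (ge0_integral_measure_sum _ measurableT (fun x _ => f0 x) mf).
congr (_ * _)%E; apply: eq_bigr => i _.
by rewrite integral_dirac// diracT mul1e.
Qed.

End uniform_points.

(** A separate name for the pairs of coins, to carry the discrete topology and metric. *)
Definition zt : Type := (bool * bool)%type.

HB.instance Definition _ := Choice.on zt.
HB.instance Definition _ := isPointed.Build zt (false, false).
HB.instance Definition _ := hasNbhs.Build zt principal_filter.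
HB.instance Definition _ := Discrete_ofNbhs.Build zt erefl.
HB.instance Definition _ := DiscreteUniform_ofNbhs.Build zt.
HB.instance Definition _ (R : numDomainType) := @DiscretePseudoMetric_ofUniform.Build R zt.

(** The diagonal is an entourage of the discrete uniformity, so a Cauchy filter contains a set with
    at most one point. *)
Lemma zt_cauchy_cvg (F : set_system zt) : ProperFilter F -> cauchy F -> cvg F.
Proof.
move=> FF cF; have /cF [[A B] /= [FA FB] AB] : entourage (range (fun x : zt => (x, x))).
  by rewrite uniform_discrete.
have [x Ax] := filter_ex FA.
apply/cvg_ex; exists x; apply/discrete_cvg; apply: filterS FB => y By /=.
by have [z _ [-> ->]] := AB (x, y) (conj Ax By).
Qed.

HB.instance Definition _ := Uniform_isComplete.Build zt zt_cauchy_cvg.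

Section discrete_chain_kernel.
Context {R : realType}.

Definition Zc : completePseudoMetricType R := zt.
Notation BZ := (borelType Zc).

Lemma polish_Zc : polish Zc.
Proof.
split; first exact: (@discrete_hausdorff zt).
exists setT; last by move=> O O0 _; rewrite setIT.
exact: (@countableP (bool * bool)%type).
Qed.

Lemma measurable_BZ (A : set BZ) : measurable A.
Proof. by apply: sub_sigma_algebra; exact: (@discrete_open zt). Qed.

Lemma measurable_fun_BZ d (T : measurableType d) (f : BZ -> T) : measurable_fun setT f.
Proof. by move=> _ B _; exact: measurable_BZ. Qed.

(** The index carries the randomness: its parity is the new coin of [nxt2], and for [nxt4] the
    indices 0 to 3 run through all pairs of fresh coins. *)
Definition nxt2 (i : nat) (z : BZ) : BZ := (z.2, odd i).
Definition nxt4 (i : nat) (z : BZ) : BZ := (odd i, (1 < i)%N).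

(* The state is (previous coin, current coin). *)
Definition xi_ (z : BZ) : R := (if z.2 then 1 else -1) * (if z.1 then 1 else 2).

Definition Pk (z : BZ) : {measure set BZ -> \bar R} := unif_prob R 1 (nxt2^~ z).

Lemma Pk_kernel U : measurable U -> measurable_fun [set: BZ] (Pk ^~ U).
Proof. by move=> _; exact: measurable_fun_BZ. Qed.

HB.instance Definition _ := isKernel.Build _ _ _ _ _ Pk Pk_kernel.

Lemma Pk_prob z : Pk z setT = 1%E. Proof. exact: unif_measure_setT. Qed.

HB.instance Definition _ := Kernel_isProbability.Build _ _ _ _ _ Pk Pk_prob.

Definition pi_ : probability BZ R := unif_prob R 3 (nxt4^~ (false, false)).

Lemma PkE z A : Pk z A = (2^-1 * ((z.2, false) \in A)%:R + 2^-1 * ((z.2, true) \in A)%:R)%:E.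
Proof. by rewrite [LHS]unif_probE !big_ord_recl big_ord0 addr0/= mulrDr. Qed.

Lemma pi_E A : pi_ A = (4^-1 * (((false, false) \in A)%:R + ((true, false) \in A)%:R +
  ((false, true) \in A)%:R + ((true, true) \in A)%:R))%:E.
Proof. by rewrite [LHS]unif_probE !big_ord_recl big_ord0 addr0/= !addrA. Qed.

Lemma Pk_pi z A : (\int[Pk z]_y Pk y A = pi_ A)%E.
Proof.
rewrite ge0_integral_unif_prob//; last exact: measurable_fun_BZ.
rewrite !big_ord_recl big_ord0 adde0 !PkE/= [RHS]pi_E -EFinD -EFinM; congr EFin.
by field.
Qed.

Lemma pi_invariant : invariant_prob Pk pi_.
Proof.
move=> B mB; rewrite ge0_integral_unif_prob//; last exact: measurable_fun_BZ.
rewrite !big_ord_recl big_ord0 adde0 !PkE/= [RHS]pi_E -!EFinD -EFinM; congr EFin.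
by field.
Qed.

Lemma kernel_iter_ge2 k z B : kernel_iter Pk k.+2 z B = pi_ B.
Proof.
elim: k z => [|k IH] z.
  rewrite -(Pk_pi z B) /=; apply: eq_integral => y _.
  rewrite (ge0_integral_unif_prob 1); [|exact: measurable_fun_BZ|by move=> x; rewrite diracE].
  by rewrite PkE !big_ord_recl big_ord0 adde0 !diracE/= -!EFinD -EFinM mulrDr.
rewrite [LHS]/=.
transitivity (\int[Pk z]_y (cst (pi_ B) y))%E; first by apply: eq_integral => y _; exact: IH.
by rewrite integral_cst// Pk_prob mule1.
Qed.

Lemma kernel_iter01 k z B : (k < 2)%N -> (0 <= kernel_iter Pk k z B <= 1)%E.
Proof.
have d01 y : (0 <= (\d_y : set BZ -> \bar R) B <= 1)%E.
  by rewrite diracE !lee_fin; case: (_ \in _); rewrite ?lexx ler01.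
case: k => [|[|//]] _ /=; first exact: d01.
apply/andP; split; first by apply: integral_ge0 => y _; case/andP: (d01 y).
rewrite (ge0_integral_unif_prob 1); [|exact: measurable_fun_BZ|by move=> y; case/andP: (d01 y)].
rewrite !big_ord_recl big_ord0 adde0 !diracE/= -!EFinD -EFinM lee_fin.
by do 2 case: (_ \in _) => /=; lra.
Qed.

Lemma Pk_ergodic : uniformly_ergodic Pk pi_.
Proof.
split; first exact: pi_invariant.
(* From k = 2 on the distance is 0; for k = 0 and k = 1 the bound 2 * 2^-k is at least 1, which
   majorizes every total variation distance. *)
exists 2, 2^-1; split; first by apply/andP; split; lra.
move=> k; apply: ge_ereal_sup => _ [z _ <-]; apply: ge_ereal_sup => _ [B mB <-].
have [k2|k2] := ltnP k 2; last first.
  case: k k2 => [|[|k]]// _; rewrite kernel_iter_ge2 subee ?fin_num_measure//.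
  by rewrite abse0 lee_fin mulr_ge0// exprn_ge0.
have /andP[x0 x1] := kernel_iter01 z B k2.
have p0 : (0 <= pi_ B)%E by [].
have p1 : (pi_ B <= 1)%E by exact: probability_le1.
apply: (@le_trans _ _ 1%E); last first.
  rewrite lee_fin; move: k2; rewrite -[(k < 2)%N]/(k <= 1)%N; case: k x0 x1 => [|[|//]] _ _ _.
    by rewrite expr0; lra.
  by rewrite expr1; lra.
move: x0 x1 p0 p1; case: (kernel_iter _ _ _ _) => [x| |]//; case: (pi_ B) => [y| |]//.
rewrite !lee_fin => x0 x1 y0 y1; rewrite /= ?lee_fin ler_norml; apply/andP; split; lra.
Qed.

Lemma xi_bound z : `|xi_ z| <= 2.
Proof.
case: z => -[] -[]; rewrite /xi_/= ?mul1r ?mulr1 ?mulN1r ?normrN ?normr1 ?ger0_norm//; lra.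
Qed.

Let adde_cancel (x : \bar R) (r : R) :
  (x \is a fin_num -> x + r%:E = r%:E -> x = 0)%E.
Proof.
move=> /fineK <-; rewrite -EFinD => H; congr EFin.
by apply: (@addIr _ r); rewrite add0r; exact: EFin_inj H.
Qed.

Lemma xi_centered : centered_bounded_noise pi_ xi_.
Proof.
split; first exact: measurable_fun_BZ; last by exists 2; exact: xi_bound.
(* Integrals against the uniform law are evaluated for nonnegative functions; the shift by the bound
   2 makes the noise one. *)
have m2 : measurable_fun [set: BZ] (EFin \o (fun z => xi_ z + 2)) by exact: measurable_fun_BZ.
have x2 (z : BZ) : (0 <= (EFin \o (fun z => xi_ z + 2)%R) z)%E.
  by rewrite lee_fin; have := xi_bound z; rewrite ler_norml => /andP[]; lra.
have E : (\int[pi_]_z (xi_ z + 2)%R%:E = 2%:E)%E.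
  rewrite (ge0_integral_unif_prob _ _ m2 x2) !big_ord_recl big_ord0 adde0 /xi_/=.
  by rewrite -!EFinD -EFinM; congr EFin; field.
have Ix : pi_.-integrable setT (EFin \o xi_).
  by apply: bmeas_integrable; split; [exact: measurable_fun_BZ|exists 2; exact: xi_bound].
move: E; under eq_integral do rewrite EFinD.
rewrite integralD//; last exact: finite_measure_integrable_cst.
rewrite (_ : (\int[pi_]_x 2%:E)%E = 2%:E); last first.
  have c2 : forall x : BZ, (0 <= cst (2:R)%:E x)%E by move=> x; rewrite lee_fin.
  rewrite (ge0_integral_unif_prob _ _ (measurable_cst _) c2).
  by rewrite !big_ord_recl big_ord0 adde0 -!EFinD -EFinM; congr EFin; field.
exact: adde_cancel (integrable_fin_num measurableT Ix).
Qed.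

End discrete_chain_kernel.

(** * Stationary laws of the SGD recursion *)

Section fixed_point.
Context {R : realType} d (Omega : measurableType d).
Variables (alpha b : R) (S : Omega -> Omega) (x : Omega -> R).
Let q := 1 - alpha.
Hypothesis alpha01 : 0 < alpha < 1.
Hypothesis mS : measurable_fun setT S.
Hypothesis mx : measurable_fun setT x.
Hypothesis xb : forall w, `|x w| <= b.

Let a0 : 0 < alpha. Proof. by case/andP: alpha01. Qed.
Let q0 : 0 < q. Proof. by rewrite subr_gt0; case/andP: alpha01. Qed.

(** Iteration of the fixed-point equation from the constant [b], an upper bound of the noise: the
    iterates decrease and stay above - b, so they converge pointwise to a measurable limit. *)
Fixpoint fp_iter k (w : Omega) : R :=
  if k is j.+1 then q * fp_iter j (S w) + alpha * x w else b.

Let fp_ge k w : - b <= fp_iter k w.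
Proof.
elim: k w => [|k IH] w /=.
  by have := le_trans (normr_ge0 _) (xb w); lra.
have x0 : - b <= x w by have := xb w; rewrite ler_norml => /andP[].
rewrite (_ : - b = q * - b + alpha * - b); last by rewrite /q; ring.
by apply: lerD; apply: ler_wpM2l => //; apply: ltW.
Qed.

Let fp_dec k w : fp_iter k.+1 w <= fp_iter k w.
Proof.
elim: k w => [|k IH] w.
  have x0 : x w <= b by have := xb w; rewrite ler_norml => /andP[].
  rewrite /= -[leRHS](_ : q * b + alpha * b = b); last by rewrite /q; ring.
  by rewrite lerD2l ler_wpM2l// ltW.
rewrite [leLHS]/= [leRHS]/= lerD2r ler_wpM2l ?(ltW q0)//; exact: IH.
Qed.

Let fp_cvg w : cvgn (fun k => fp_iter k w).
Proof.
apply: nonincreasing_is_cvgn.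
  by apply/nonincreasing_seqP => k; exact: fp_dec.
by exists (- b) => _ [k _ <-]; exact: fp_ge.
Qed.

Let measurable_fp k : measurable_fun setT (fp_iter k).
Proof.
elim: k => [|k IH] /=; first exact: measurable_cst.
apply: measurable_funD; apply: measurable_funM => //.
exact: (measurableT_comp IH mS).
Qed.

Lemma sgd_fixed_point : exists W : Omega -> R,
  [/\ measurable_fun setT W, forall w, W w = q * W (S w) + alpha * x w
    & forall w, `|W w| <= b].
Proof.
exists (fun w => limn (fun k => fp_iter k w)); split.
- apply: (measurable_fun_cvg measurable_fp) => w _; exact: fp_cvg.
- move=> w; apply/cvg_lim => //.
  rewrite -cvg_shiftS /=; apply: cvgD; last exact: cvg_cst.
  by apply: cvgM; [exact: cvg_cst|exact: fp_cvg].
- move=> w; rewrite ler_norml; apply/andP; split.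
    by apply: limr_ge => //; apply: nearW => k.
  apply: limr_le => //; apply: nearW; elim=> [//|k IH].
  exact: le_trans (fp_dec k w) IH.
Qed.

End fixed_point.

Section sgd_kernel.
Context {R : realType}.
Notation BZ := (borelType (@Zc R)).

Definition half_sqr (x : R) : R := x ^+ 2 / 2.

Lemma half_sqr_derive (x : R) : is_derive x 1 half_sqr x.
Proof.
rewrite /half_sqr; apply: is_derive_eq; rewrite /GRing.scale/=.
by field.
Qed.

Lemma half_sqr_derive1 : half_sqr^`()%classic = id.
Proof. by apply/funext => x; rewrite derive1E; have [_ ->] := half_sqr_derive x. Qed.

Lemma half_sqr_derive2 : half_sqr^`(2)%classic = cst 1.
Proof.
rewrite derive1nS derive1n1 half_sqr_derive1; apply/funext => x.
by rewrite derive1E derive_id.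
Qed.

Lemma half_sqr_strongly_convex : strongly_convex_C2 half_sqr.
Proof.
split.
- move=> [|[|//]] x _; first by rewrite derive1n0; have [] := half_sqr_derive x.
  rewrite derive1n1 half_sqr_derive1; exact: derivable_id.
- rewrite half_sqr_derive2 => x; exact: cvg_cst.
- exists 1, 1, 0; rewrite half_sqr_derive2 ltr01 lexx; split => //.
  by move=> x y; rewrite /= subrr normr0 mul0r.
Qed.

Lemma half_sqr_min : unique_minimizer half_sqr 0.
Proof.
split=> [x|y /(_ 0)]; rewrite /half_sqr.
  by rewrite expr0n mul0r mulr_ge0 ?sqr_ge0.
rewrite expr0n/= mul0r pmulr_lle0 ?invr_gt0// => y0.
by apply/eqP; rewrite -sqrf_eq0 eq_le y0 sqr_ge0.
Qed.

(** The derivative of [half_sqr] is the identity, so one step is affine, and integrating over a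
    uniform kernel amounts to averaging over the maps [sgd_map]. *)
Lemma sgd_invariantE n (nxt : nat -> BZ -> BZ) (K : BZ -> {measure set BZ -> \bar R})
    alpha (mu : probability (R * BZ)%type R) :
  (forall z A, K z A = unif_prob R n (nxt^~ z) A) ->
  sgd_invariant half_sqr xi_ K alpha mu <-> selfsim n (sgd_map alpha xi_ nxt) mu.
Proof.
move=> KE; have mF i : measurable_fun setT (sgd_map alpha (@xi_ R) nxt i).
  by apply: measurable_sgd_map => *; exact: measurable_fun_BZ.
suff E A : measurable A ->
    (\int[mu]_w K w.2 (xsection A (sgd_step half_sqr xi_ alpha w)) =
    (n.+1%:R)^-1%:E * \sum_(i < n.+1) mu (sgd_map alpha xi_ nxt i @^-1` A))%E.
  split => H A mA; first by rewrite -(H A mA) E.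
  by rewrite E// -H.
move=> mA.
have mFA i : measurable (sgd_map alpha xi_ nxt i @^-1` A).
  by rewrite -[_ @^-1` _]setTI; exact: mF.
transitivity (\int[mu]_w ((n.+1%:R)^-1%:E *
    \sum_(i < n.+1) (\1_(sgd_map alpha xi_ nxt i @^-1` A) w)%:E))%E.
  apply: eq_integral => w _; rewrite KE unif_probE EFinM -sumEFin.
  congr (_ * _)%E; apply: eq_bigr => i _; rewrite indicE; congr (_%:R%:E); congr nat_of_bool.
  rewrite mem_xsection /sgd_map /sgd_step half_sqr_derive1/=.
  apply/idP/idP => /set_mem H; apply/mem_set; move: H => /=; congr (A (_, _)); ring.
have mi (i : 'I_n.+1) : measurable_fun [set: R * BZ]
    (fun w => ((\1_(sgd_map alpha xi_ nxt i @^-1` A) : R * BZ -> R) w)%:E).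
  by apply/measurable_EFinP; exact: (measurable_indic (mFA i)).
have i0 (i : 'I_n.+1) (w : R * BZ) : [set: R * BZ] w ->
    (0 <= ((\1_(sgd_map alpha xi_ nxt i @^-1` A) : R * BZ -> R) w)%:E)%E by rewrite lee_fin.
have c0 : (0 <= (n.+1%:R^-1 : R)%:E)%E by rewrite lee_fin invr_ge0.
have mSum := emeasurable_sum (index_enum 'I_n.+1) mi.
rewrite (ge0_integralZl mu measurableT mSum _ c0); last first.
  by move=> w _; apply: sume_ge0 => i _; exact: i0.
congr (_ * _)%E.
rewrite (ge0_integral_sum mu measurableT mi i0).
by apply: eq_bigr => i _; rewrite integral_indic// setIT.
Qed.

Lemma sgd_selfsim_stationary n (nxt : nat -> BZ -> BZ) (K : BZ -> {measure set BZ -> \bar R})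
    alpha (mu : probability (R * BZ)%type R) : 0 < alpha < 1 ->
  (forall i j z z', nxt i (nxt j z) = nxt i (nxt j z')) ->
  (forall z A, K z A = unif_prob R n (nxt^~ z) A) ->
  selfsim n (sgd_map alpha xi_ nxt) mu ->
  sgd_stationary_law half_sqr xi_ K alpha mu.
Proof.
move=> a01 cp KE ss; split; first exact/(sgd_invariantE _ _ KE).
move=> nu /(sgd_invariantE _ _ KE) ss'.
have mx : measurable_fun setT (@xi_ R) by exact: measurable_fun_BZ.
have mn i : measurable_fun setT (nxt i) by exact: measurable_fun_BZ.
move=> A mA.
exact: (@sgd_selfsim_unique R _ BZ alpha 2 xi_ n nxt a01 (@xi_bound R) mx mn cp (false, false) nu mu ss' ss A mA).
Qed.

End sgd_kernel.

Section sgd_law.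
Context {R : realType} d (Omega : measurableType d) (P : probability Omega R).
Notation BZ := (borelType (@Zc R)).
Variables (n : nat) (T : nat -> Omega -> Omega) (S : Omega -> Omega)
  (zeta : Omega -> BZ) (nxt : nat -> BZ -> BZ).
Hypothesis mS : measurable_fun setT S.
Hypothesis mzeta : measurable_fun setT zeta.
Hypothesis ST : forall i w, S (T i w) = w.
Hypothesis zetaT : forall i w, zeta (T i w) = nxt i (zeta w).
Hypothesis ssP : selfsim n T P.

Lemma sgd_law_exists alpha : 0 < alpha < 1 ->
  exists (mu : probability (R * BZ)%type R) (W : Omega -> R),
  [/\ selfsim n (sgd_map alpha xi_ nxt) mu, measurable_fun setT W,
      forall w, `|W w| <= 2,
      forall i w, W (T i w) = (1 - alpha) * W w + alpha * xi_ (nxt i (zeta w))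
    & forall A, measurable A -> mu A = P [set w | A (W (S w), zeta w)]].
Proof.
move=> a01.
have mxz : measurable_fun setT (fun w => @xi_ R (zeta w)).
  by apply: (measurableT_comp _ mzeta); exact: measurable_fun_BZ.
have [W [mW WE Wb]] := sgd_fixed_point a01 mS mxz (fun w => xi_bound (zeta w)).
(* In a state (X_k, Z_k) the iterate has not yet absorbed xi(Z_k), so [W] is evaluated after [S] has
   dropped the newest coins. With this choice [Phi] intertwines [T i] and [sgd_map i]. *)
pose Phi (w : Omega) : (R * BZ)%type := (W (S w), zeta w).
have mPhi : measurable_fun setT Phi.
  apply/measurable_fun_pairP; split => //=; exact: (measurableT_comp mW mS).
have m1 : push_measure P mPhi setT = 1%E by exact: probability_setT.
exists (to_prob m1), W; split => //.
- move=> A mA; rewrite [LHS](_ : _ = P (Phi @^-1` A))//.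
  rewrite ssP; last by rewrite -[Phi @^-1` A]setTI; exact (mPhi measurableT A mA).
  congr (_ * _)%E; apply: eq_bigr => i _.
  rewrite [RHS](_ : _ = P (Phi @^-1` (sgd_map alpha xi_ nxt i @^-1` A)))//.
  have E w : Phi (T i w) = sgd_map alpha xi_ nxt i (Phi w).
    by rewrite /Phi /sgd_map /= ST zetaT -WE.
  congr (P _); apply/seteqP; split => w; rewrite /preimage/=.
    by rewrite -E.
  by rewrite -E.
- by move=> i w; rewrite WE ST zetaT.
Qed.

End sgd_law.

(** * Moments of the noise *)

Section zt_moments.
Context {R : realType} d (Omega : measurableType d) (Pr : probability Omega R).
Notation BZ := (borelType (@Zc R)).

Lemma mem_set1 (T : eqType) (x y : T) : (x \in [set y]) = (x == y).
Proof. by apply/idP/eqP => [/set_mem|->] //; exact: mem_set. Qed.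

Lemma mem_preimg T U (f : T -> U) (B : set U) x : (x \in f @^-1` B) = (f x \in B).
Proof. by apply/idP/idP => /set_mem H; apply/mem_set. Qed.

Lemma zt_preimage (f : Omega -> BZ) B : measurable_fun setT f -> measurable (f @^-1` B).
Proof.
by move=> mf; rewrite -[_ @^-1` _]setTI; apply: mf => //; exact: measurable_BZ.
Qed.

Definition zpts : seq zt := [:: (false, false); (true, false); (false, true); (true, true)].

Lemma zt_sum_indic (F : zt -> R) z : \sum_(p <- zpts) F p * (z == p)%:R = F z.
Proof.
by rewrite !big_cons big_nil; case: z => -[] -[]; rewrite /= ?mulr0 ?mulr1 ?add0r ?addr0.
Qed.

Lemma indic_integrable A : measurable A ->
  Pr.-integrable setT (EFin \o (\1_A : Omega -> R)).
Proof.
move=> mA; apply: bmeas_integrable; split; first exact: measurable_indic.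
by exists 1 => w; rewrite indicE; case: (_ \in _); rewrite ?normr1 ?normr0.
Qed.

Lemma Rintegral_simple (I : Type) (s : seq I) (c : I -> R) (A : I -> set Omega) :
  (forall i, measurable (A i)) ->
  Pr.-integrable setT (EFin \o (fun w => \sum_(i <- s) c i * \1_(A i) w)) /\
  \int[Pr]_w (\sum_(i <- s) c i * \1_(A i) w) = \sum_(i <- s) c i * fine (Pr (A i)).
Proof.
move=> mA; pose s' := [seq (c i, (\1_(A i) : Omega -> R)) | i <- s].
have sE : (fun w => \sum_(i <- s) c i * \1_(A i) w) = (fun w => \sum_(p <- s') p.1 * p.2 w).
  by apply/funext => w; rewrite big_map.
have [|ig E] := @Rintegral_comb _ _ _ Pr s'.
  by rewrite /s'; elim: s {s' sE} => //= i s IH; split => //; exact: indic_integrable.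
rewrite sE; split => //; rewrite E big_map; apply: eq_bigr => i _.
by rewrite /Rintegral integral_indic// setIT.
Qed.

Lemma expectation_simple (I : Type) (s : seq I) (c : I -> R) (A : I -> set Omega)
    (X : Omega -> R) : (forall i, measurable (A i)) ->
  (forall w, X w = \sum_(i <- s) c i * \1_(A i) w) ->
  ('E_Pr[X] = (\sum_(i <- s) c i * fine (Pr (A i)))%:E)%E.
Proof.
move=> mA XE; have [ig E] := Rintegral_simple s c mA.
rewrite (funext XE : X = _) -E unlock /Rintegral fineK//.
exact: integrable_fin_num ig.
Qed.

Lemma zt_expectation (f : Omega -> BZ) (F : zt -> R) : measurable_fun setT f ->
  ('E_Pr[fun w => F (f w)] = (\sum_(p <- zpts) F p * fine (Pr (f @^-1` [set (p : BZ)])))%:E)%E.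
Proof.
move=> mf; apply: expectation_simple => [p|w]; first exact: zt_preimage.
rewrite -[LHS]zt_sum_indic; apply: eq_bigr => p _.
by rewrite indicE mem_preimg (@mem_set1 zt).
Qed.

Lemma zt_expectation2 (f g : Omega -> BZ) (H : zt -> zt -> R) :
  measurable_fun setT f -> measurable_fun setT g ->
  ('E_Pr[fun w => H (f w) (g w)] = (\sum_(p <- zpts) \sum_(r <- zpts)
     H p r * fine (Pr (f @^-1` [set (p : BZ)] `&` g @^-1` [set (r : BZ)])))%:E)%E.
Proof.
move=> mf mg.
rewrite (@expectation_simple _ [seq (p, r) | p <- zpts, r <- zpts] (fun z => H z.1 z.2)
  (fun z => f @^-1` [set (z.1 : BZ)] `&` g @^-1` [set (z.2 : BZ)])).
- by rewrite big_allpairs.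
- by move=> p; apply: measurableI; exact: zt_preimage.
move=> w; rewrite big_allpairs/= -[LHS](zt_sum_indic (fun p => H p (g w))).
apply: eq_bigr => p _; rewrite -(zt_sum_indic (H p)) mulr_suml; apply: eq_bigr => r _.
by rewrite indicE in_setI !mem_preimg !(@mem_set1 zt) -mulnb natrM -mulrA (mulrC (_ == r)%:R).
Qed.

Lemma zt_measure_sum (f : Omega -> BZ) A B : measurable_fun setT f -> measurable A ->
  Pr (A `&` f @^-1` B) =
  (\sum_(p <- zpts) ((p : BZ) \in B)%:R * fine (Pr (A `&` f @^-1` [set (p : BZ)])))%:E.
Proof.
move=> mf mA.
have mAB : measurable (A `&` f @^-1` B) by apply: measurableI => //; exact: zt_preimage.
rewrite -(@expectation_simple _ zpts (fun p => ((p : BZ) \in B)%:R)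
  (fun p => A `&` f @^-1` [set (p : BZ)]) (\1_(A `&` f @^-1` B))).
- by rewrite unlock integral_indic// setIT.
- by move=> p; apply: measurableI => //; exact: zt_preimage.
- move=> w; rewrite indicE in_setI mem_preimg.
  transitivity ((w \in A)%:R * ((f w : BZ) \in B)%:R : R); first by rewrite -mulnb natrM.
  rewrite -(zt_sum_indic (fun z => ((z : BZ) \in B)%:R)) mulr_sumr; apply: eq_bigr => p _.
  by rewrite indicE in_setI mem_preimg (@mem_set1 zt) -mulnb natrM mulrCA.
Qed.

End zt_moments.

Section chain_moments.
Context {R : realType} d (Omega : measurableType d) (Pr : probability Omega R).
Notation BZ := (borelType (@Zc R)).
Variable Zs : int -> Omega -> BZ.
Hypothesis chain : stationary_chain (@Pk R) pi_ Pr Zs.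

Let mZ k : measurable_fun setT (Zs k). Proof. by have [] := chain. Qed.

Lemma chain_marginal k (z : zt) : Pr (Zs k @^-1` [set (z : BZ)]) = (4^-1)%:E.
Proof.
have [_ H _] := chain; rewrite H; last exact: measurable_BZ.
rewrite pi_E !(@mem_set1 zt); congr EFin.
by case: z => -[] -[]; rewrite /= ?addr0 ?add0r mulr1.
Qed.

Lemma Pk1 (y z : zt) : Pk (y : BZ) [set (z : BZ)] = (2^-1 * (y.2 == z.1)%:R :> R)%:E.
Proof.
rewrite PkE !(@mem_set1 zt); congr EFin.
by case: y => -[] -[]; case: z => -[] -[]; rewrite /= ?mulr0 ?mulr1 ?addr0 ?add0r.
Qed.

Lemma chain_joint (p r : zt) :
  Pr (Zs 0 @^-1` [set (p : BZ)] `&` Zs 1 @^-1` [set (r : BZ)]) = (8^-1 * (p.2 == r.1)%:R)%:E.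
Proof.
have [_ _ H] := chain.
have E1 : Zs 1 = Zs (0 + 1) by rewrite add0r.
rewrite E1 H; last 2 first.
- by apply: sub_sigma_algebra; exists 0, [set (p : BZ)]; split => //; exact: measurable_BZ.
- exact: measurable_BZ.
transitivity (\int[Pr]_(w in Zs 0 @^-1` [set (p : BZ)]) cst (2^-1 * (p.2 == r.1)%:R : R)%:E w)%E.
  by apply: eq_integral => w /set_mem /= ->; rewrite Pk1.
rewrite integral_cst; last exact: zt_preimage.
rewrite [X in (_ * X)%E](_ : _ = (4^-1)%:E); last exact: chain_marginal.
by rewrite -EFinM; congr EFin; case: (_ == _); rewrite /= ?mulr1 ?mulr0 ?mul0r//; field.
Qed.

(** Whatever the past, the kernel gives equal mass to both values of the newest coin of [Zs l], and
    [Zs k] belongs to that past. *)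
Lemma chain_joint_sym k l (p : zt) a b : k < l ->
  Pr (Zs k @^-1` [set (p : BZ)] `&` Zs l @^-1` [set ((a, b) : BZ)]) =
  Pr (Zs k @^-1` [set (p : BZ)] `&` Zs l @^-1` [set ((a, true) : BZ)]).
Proof.
move=> kl; have [_ _ H] := chain.
rewrite -(subrK 1 l) !H; try exact: measurable_BZ; last 2 first.
- by apply: sub_sigma_algebra; exists k, [set (p : BZ)]; split => //; [lia|exact: measurable_BZ].
- by apply: sub_sigma_algebra; exists k, [set (p : BZ)]; split => //; [lia|exact: measurable_BZ].
by apply: eq_integral => w _; rewrite !Pk1.
Qed.

(** Reversing the current coin changes the sign of the noise and permutes four equally likely
    states. *)
Lemma chain_noise_symmetric (B : set R) : measurable B ->
  Pr ((fun w => xi_ (Zs 0 w)) @^-1` B) = Pr ((fun w => - xi_ (Zs 0 w)) @^-1` B).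
Proof.
move=> mB; have [_ H _] := chain.
rewrite -[_ @^-1` B]/(Zs 0 @^-1` (xi_ @^-1` B)) -[RHS]/(Pr (Zs 0 @^-1` ((fun z => - xi_ z) @^-1` B))).
rewrite !H; try exact: measurable_BZ.
rewrite !pi_E.
have m1 (f : BZ -> R) (z : zt) : ((z : BZ) \in f @^-1` B) = (f z \in B) by exact: mem_preimg.
rewrite (m1 _ (false, false)) (m1 _ (true, false)) (m1 _ (false, true)) (m1 _ (true, true)).
rewrite (m1 _ (false, false)) (m1 _ (true, false)) (m1 _ (false, true)) (m1 _ (true, true)).
have e (z : zt) : - xi_ (z : BZ) = xi_ ((z.1, ~~ z.2) : BZ) :> R.
  by case: z => -[] -[]; rewrite /xi_/=; ring.
cbv beta.
rewrite (e (false, false)) (e (true, false)) (e (false, true)) (e (true, true)) /=; congr (_ * _)%:E.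
by ring.
Qed.

Lemma chain_noise_cube : ('E_Pr[fun w => (xi_ (Zs 0 w) ^+ 3)%R] = 0)%E.
Proof.
rewrite (zt_expectation Pr (fun z => xi_ (z : BZ) ^+ 3) (@mZ 0)) !big_cons big_nil !chain_marginal /xi_/=.
by congr EFin; field.
Qed.

(** Exchanging the newest coin of the later state reverses its noise and, by [chain_joint_sym],
    preserves the joint law. *)
Lemma chain_noise_lt k l : k < l ->
  ('E_Pr[fun w => (xi_ (Zs k w) * xi_ (Zs l w))%R] = 0)%E.
Proof.
move=> kl; rewrite (zt_expectation2 Pr (fun z z' => xi_ (z : BZ) * xi_ (z' : BZ)) (@mZ k) (@mZ l)).
congr EFin; apply: big1 => p _; rewrite !big_cons big_nil !(chain_joint_sym p _ false kl) /xi_/=.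
by ring.
Qed.

Lemma chain_noise_white l : l != 0 ->
  ('E_Pr[fun w => (xi_ (Zs 0 w) * xi_ (Zs l w))%R] = 0)%E.
Proof.
rewrite neq_lt => /orP[l0|l0]; last exact: chain_noise_lt.
rewrite -[RHS](chain_noise_lt l0); congr expectation.
by apply/funext => w; rewrite mulrC.
Qed.

(** The product is s_0 c(s_(-1)) c(s_0)^2; c has mean 3/2 and s c(s)^2 has mean (1 - 4) / 2 = -
    3/2. *)
Lemma chain_mixed_moment :
  ('E_Pr[fun w => (xi_ (Zs 0 w) * xi_ (Zs 1 w) ^+ 2)%R] = (- (9 / 4))%:E)%E.
Proof.
rewrite (zt_expectation2 Pr (fun z z' => xi_ (z : BZ) * xi_ (z' : BZ) ^+ 2) (@mZ 0) (@mZ 1)).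
rewrite !big_cons !big_nil !chain_joint /xi_/=.
by congr EFin; field.
Qed.

End chain_moments.

(** * Realisation of the stationary chain by coins *)

Section coin_chain.
Context {R : realType}.
Notation BZ := (borelType (@Zc R)).
Local Notation P := (@coin_prob R).

Lemma measurable_coin1 i b : measurable [set w : coins | coin i w = b].
Proof. by have := @measurable_coin i measurableT [set b]; rewrite setTI; apply. Qed.

(** The flip preserves [A] and exchanges the two values of coin i, which therefore carry equal
    mass. *)
Lemma coin_prob_half i b A : measurable A -> flip i @^-1` A = A ->
  P (A `&` [set w | coin i w = b]) = (2^-1%:E * P A)%E.
Proof.
move=> mA fA.
have mAc c : measurable (A `&` [set w : coins | coin i w = c]).
  by apply: measurableI => //; exact: measurable_coin1.
have E c : P (A `&` [set w | coin i w = c]) = P (A `&` [set w | coin i w = ~~ c]).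
  rewrite -(@coin_prob_flip R i (A `&` [set w | coin i w = c]))//.
  congr (P _); rewrite preimage_setI fA; congr (_ `&` _).
  apply/seteqP; split => w /=; rewrite /coin flipE eqxx; first by move<-; rewrite negbK.
  by move->; rewrite negbK.
have -> : P A = (P (A `&` [set w | coin i w = b]) + P (A `&` [set w | coin i w = ~~ b]))%E.
  rewrite -measureU//; last first.
    by apply/seteqP; split => w //= [[_ ->] [_]]; case: b.
  rewrite -setIUr; congr (P _); apply/seteqP; split => [w Aw|w [] //].
  by split => //=; case: (coin i w); case: b; tauto.
rewrite -E -(fineK (fin_num_measure P _ (mAc b))) -EFinD -EFinM; congr EFin.
by field.
Qed.

(* [pickle] indexes the coins of the bi-infinite sequence by nat. *)
Definition zchain (k : int) (w : coins) : BZ := (coin (pickle (k - 1)) w, coin (pickle k) w).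

Lemma measurable_zchain k : measurable_fun setT (zchain k).
Proof.
rewrite /zchain.
have -> : (fun w => (coin (pickle (k - 1)) w, coin (pickle k) w) : BZ) = fun w =>
    if coin (pickle (k - 1)) w then (if coin (pickle k) w then (true, true) : BZ else (true, false))
    else (if coin (pickle k) w then (false, true) : BZ else (false, false)).
  by apply/funext => w; case: (coin _ w); case: (coin _ w).
by apply: measurable_fun_ifT; try exact: measurable_coin;
  (apply: measurable_fun_ifT; [exact: measurable_coin|exact: measurable_cst|exact: measurable_cst]).
Qed.

Lemma coin_flip_neq i j b : i != j ->
  flip i @^-1` [set w : coins | coin j w = b] = [set w | coin j w = b].
Proof.
by move=> ij; apply/seteqP; split => w /=; rewrite /coin flipE eq_sym (negbTE ij).
Qed.

Lemma pickle_neq (k l : int) : k != l -> pickle k != pickle l.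
Proof. by apply: contraNN => /eqP /(pcan_inj (@pickleK int)) ->. Qed.

(** Measurability and invariance under the flip are stable under the operations of a sigma-algebra.
    They hold for the generators because the chain at a time j <= k reads only coins j - 1 and j. *)
Lemma past_zchain k A : past zchain k A ->
  measurable A /\ flip (pickle (k + 1)) @^-1` A = A.
Proof.
move: A; apply: smallest_sub.
  split.
  - by split; [exact: measurable0|rewrite preimage_set0].
  - move=> A [mA fA]; split; first by rewrite setTD; exact: measurableC.
    by rewrite setTD -preimage_setC fA.
  - move=> F mF; split; first by apply: bigcupT_measurable => i; case: (mF i).
    by rewrite preimage_bigcup; apply: eq_bigcup => // i _; case: (mF i).
move=> _ [j [B [jk mB ->]]]; split.
  by rewrite -[_ @^-1` _]setTI; exact: measurable_zchain.
have n1 : pickle (j - 1) != pickle (k + 1) by apply: pickle_neq; lia.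
have n2 : pickle j != pickle (k + 1) by apply: pickle_neq; lia.
by apply/seteqP; split => w; rewrite /preimage/= /zchain /coin !flipE (negbTE n1) (negbTE n2).
Qed.

Lemma zchain_cell k z : zchain k @^-1` [set (z : BZ)] =
  [set w | coin (pickle (k - 1)) w = z.1] `&` [set w | coin (pickle k) w = z.2].
Proof. by case: z => a b; apply/seteqP; split => w /=; rewrite /zchain => -[-> ->]. Qed.

(** Coin k + 1 is fair given the past up to k. A past event is split by the value of coin k, on
    which the kernel evaluated along the chain is constant. *)
Lemma zchain_stationary : stationary_chain (@Pk R) pi_ P zchain.
Proof.
split; first exact: measurable_zchain.
- move=> k B _; rewrite -[X in P X]setTI (zt_measure_sum P _ (measurable_zchain k) measurableT).
  have H (p : zt) : fine (P (setT `&` zchain k @^-1` [set (p : BZ)])) = 4^-1.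
    have n : pickle k != pickle (k - 1) by apply: pickle_neq; lia.
    rewrite setTI zchain_cell coin_prob_half; last exact: coin_flip_neq.
    - rewrite -[X in P X]setTI coin_prob_half//.
      by rewrite [X in fine (_ * (_ * X))](_ : _ = 1%E); [rewrite mule1/=; field|exact: probability_setT].
    - exact: measurable_coin1.
  rewrite !big_cons big_nil !H pi_E; congr EFin; by ring.
move=> k A B /past_zchain[mA fA] _.
have mc b : measurable (A `&` [set w : coins | coin (pickle k) w = b]).
  by apply: measurableI => //; exact: measurable_coin1.
pose x b := fine (P (A `&` [set w | coin (pickle k) w = b])).
have xE b : P (A `&` [set w | coin (pickle k) w = b]) = (x b)%:E.
  by rewrite /x fineK ?fin_num_measure.
have H (p : zt) : fine (P (A `&` zchain (k + 1) @^-1` [set (p : BZ)])) = 2^-1 * x p.1.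
  have n : pickle (k + 1) != pickle k by apply: pickle_neq; lia.
  rewrite zchain_cell addrK setIA coin_prob_half//; first by rewrite xE.
  by rewrite preimage_setI fA coin_flip_neq.
rewrite (zt_measure_sum P _ (measurable_zchain (k + 1)) mA) !big_cons big_nil !H.
have AE : A = (A `&` [set w | coin (pickle k) w = false]) `|` (A `&` [set w | coin (pickle k) w = true]).
  rewrite -setIUr; apply/seteqP; split => [w Aw|w [] //].
  by split => //=; case: (coin _ w); tauto.
have mPk : measurable_fun [set: coins] (fun w => Pk (zchain k w) B).
  exact: (measurableT_comp (Pk_kernel (measurable_BZ B)) (measurable_zchain k)).
have I b : (\int[P]_(w in A `&` [set w | coin (pickle k) w = b]) Pk (zchain k w) B =
   (2^-1 * (((b, false) : BZ) \in B)%:R + 2^-1 * (((b, true) : BZ) \in B)%:R)%:E * (x b)%:E)%E.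
  rewrite -xE -integral_cst//; apply: eq_integral => w /set_mem[_ /= wb].
  by rewrite PkE /zchain/= wb.
rewrite [in RHS]AE ge0_integral_setU//.
- by rewrite !I -!EFinM -EFinD; congr EFin => /=; ring.
- by apply: (measurable_funS _ _ mPk) => //; exact: measurableT.
- by rewrite disj_set2E; apply/eqP/seteqP; split => w //= [[_ ->] [_]].
Qed.

End coin_chain.

(** * Expansion of the law of the scaled iterate *)

Section coin_ifs.
Context {R : realType}.
Notation BZ := (borelType (@Zc R)).
Local Notation P := (@coin_prob R).

Definition coin_pair (w : coins) : BZ := (coin 1 w, coin 0 w).

Lemma measurable_coin_pair : measurable_fun setT coin_pair.
Proof.
rewrite (_ : coin_pair = fun w => if coin 1 w then (if coin 0 w then (true, true) : BZ else (true, false))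
    else (if coin 0 w then (false, true) : BZ else (false, false))); last first.
  by apply/funext => w; rewrite /coin_pair; case: (coin _ w); case: (coin _ w).
by apply: measurable_fun_ifT; try exact: measurable_coin;
  (apply: measurable_fun_ifT; [exact: measurable_coin|exact: measurable_cst|exact: measurable_cst]).
Qed.

Definition ccons1 (i : nat) : coins -> coins := ccons (odd i).
(** The order of the two new coins is such that [coin_pair] of the result is the pair chosen by
    [nxt4 i]. *)
Definition ccons2 (i : nat) : coins -> coins := ccons (1 < i)%N \o ccons (odd i).

Lemma measurable_ccons_preimage b A : measurable A -> measurable (ccons b @^-1` A).
Proof. by move=> mA; rewrite -[_ @^-1` _]setTI; exact: measurable_ccons. Qed.

Lemma coin_prob_selfsim1 : selfsim 1 ccons1 P.
Proof.
by move=> A mA; rewrite !big_ord_recl big_ord0 adde0 [LHS]coin_prob_selfsim.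
Qed.

Lemma coin_prob_selfsim2 : selfsim 3 ccons2 P.
Proof.
move=> A mA; rewrite [LHS]coin_prob_selfsim//.
have E b : P (ccons b @^-1` A) = (2^-1%:E * (P ((ccons b \o ccons false) @^-1` A) +
    P ((ccons b \o ccons true) @^-1` A)))%E.
  by rewrite [LHS]coin_prob_selfsim//; exact: measurable_ccons_preimage.
have mcc b c : measurable ((ccons b \o ccons c) @^-1` A).
  exact: (measurable_ccons_preimage c (measurable_ccons_preimage b mA)).
pose x b c := fine (P ((ccons b \o ccons c) @^-1` A)).
have F b c : P ((ccons b \o ccons c) @^-1` A) = (x b c)%:E by rewrite fineK// fin_num_measure.
rewrite !E !F (eq_bigr (fun i : 'I_4 => (x (1 < i)%N (odd i))%:E)); last first.
  by move=> i _; exact: F.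
rewrite !big_ord_recl big_ord0 /=.
rewrite -?EFinD -?EFinM -?EFinD -?EFinM; congr EFin.
by field.
Qed.

Definition ctail2 : coins -> coins := ctail \o ctail.

Lemma measurable_ccons1 i : measurable_fun setT (ccons1 i).
Proof. exact: measurable_ccons. Qed.

Lemma measurable_ctail2 : measurable_fun setT ctail2.
Proof. exact: (measurableT_comp measurable_ctail measurable_ctail). Qed.

End coin_ifs.

Section laws.
Context {R : realType}.
Notation BZ := (borelType (@Zc R)).
Local Notation P := (@coin_prob R).
Let law alpha (mu : probability (R * BZ)%type R) : probability (measurableTypeR R) R :=
  distribution mu (scaled_iterate 0 alpha).

(** Stated for an arbitrary random variable with law [m], because the i.i.d. law is later
    represented in two ways, with and without a reflection. *)
Lemma law_integral (m : probability (measurableTypeR R) R) d (Omega : measurableType d)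
    (Pr : probability Omega R) (Y : Omega -> R) (g : R -> R) :
  measurable_fun setT Y -> measurable_fun setT g ->
  (forall B, measurable B -> m B = Pr (Y @^-1` B)) -> bmeas (g \o Y) ->
  m.-integrable setT (EFin \o g) /\ \int[m]_y g y = \int[Pr]_w g (Y w).
Proof.
move=> mY mg mE bg.
have mY' : measurable_fun [set: Omega] (Y : Omega -> measurableTypeR R) by exact: mY.
have mg' : measurable_fun [set: measurableTypeR R] (EFin \o g) by exact/measurable_EFinP.
have ig : Pr.-integrable ((Y : Omega -> measurableTypeR R) @^-1` setT) ((EFin \o g) \o Y).
  by rewrite preimage_setT; exact: bmeas_integrable bg.
pose m' : {measure set (measurableTypeR R) -> \bar R} := push_measure Pr mY'.
have I1 : m'.-integrable setT (EFin \o g).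
  by apply: integrable_pushforward => //; exact: measurableT.
have E1 : (\int[m']_y (EFin \o g) y = \int[Pr]_w (g (Y w))%:E)%E.
  rewrite (_ : (\int[Pr]_w _)%E = (\int[Pr]_(x in (Y : Omega -> measurableTypeR R) @^-1` setT)
    ((EFin \o g) \o Y) x)%E); last by rewrite preimage_setT.
  by apply: integral_pushforward => //; exact: measurableT.
have mm B : measurable B -> B `<=` setT -> m' B = m B by move=> mB _; rewrite mE.
split.
  apply/integrableP; split => //.
  have /integrableP[_] := I1; rewrite (eq_measure_integral m) //.
rewrite /Rintegral -E1; congr fine; apply: eq_measure_integral => B mB _; exact: mE.
Qed.

Lemma sgd_law_choice (Q : R -> probability (R * BZ)%type R -> Prop) :
  (forall alpha, 0 < alpha < 1 -> exists mu, Q alpha mu) ->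
  exists mu : R -> probability (R * BZ)%type R, forall alpha, 0 < alpha < 1 -> Q alpha (mu alpha).
Proof.
(* [mu0] is the default value for stepsizes outside the open unit interval. *)
move=> H; have [mu0 _] : exists mu, Q 2^-1 mu by apply: H; apply/andP; split; lra.
suff /boolp.choice[mu Hmu] : forall alpha, exists mu, 0 < alpha < 1 -> Q alpha mu by exists mu.
move=> alpha.
have [/H[mu Qmu]|na] := boolP (0 < alpha < 1); first by exists mu.
by exists mu0.
Qed.

(** [W] has already absorbed the newest noise, whereas the first coordinate under [mu] has not. By
    stationarity both have the same law, and [W] is the form in which the last absorbed coin is
    [coin 0]. *)
Definition markov_law alpha (mu : probability (R * BZ)%type R) : Prop :=
  selfsim 1 (sgd_map alpha xi_ nxt2) mu /\
  exists W : coins -> R, [/\ measurable_fun setT W, forall w, `|W w| <= 2,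
    forall i w, W (ccons1 i w) = (1 - alpha) * W w + alpha * xi_ (nxt2 i (coin_pair w))
    & forall B, measurable B ->
        law alpha mu B = P ((fun w => W w / Num.sqrt alpha) @^-1` B)].

Lemma markov_law_exists alpha : 0 < alpha < 1 -> exists mu, markov_law alpha mu.
Proof.
move=> a01.
have [mu [W [ss mW Wb WE muE]]] := @sgd_law_exists R _ coins P 1 ccons1 ctail coin_pair nxt2
  measurable_ctail measurable_coin_pair (fun _ _ => erefl) (fun _ _ => erefl)
  coin_prob_selfsim1 alpha a01.
exists mu; split => //; exists W; split => // B mB.
have mY : measurable_fun setT (fun w => W w / Num.sqrt alpha) by exact: measurable_funM.
have mYS : measurable_fun setT (fun w => W (ctail w) / Num.sqrt alpha).
  exact: (measurableT_comp mY measurable_ctail).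
transitivity (mu (scaled_iterate 0 alpha @^-1` B)); first by [].
rewrite muE; last first.
  by rewrite -[_ @^-1` _]setTI; exact: measurable_scaled_iterate.
have E w : scaled_iterate 0 alpha (W (ctail w), coin_pair w) = W (ctail w) / Num.sqrt alpha.
  by rewrite /scaled_iterate/= subr0.
transitivity (P ((fun w => W (ctail w) / Num.sqrt alpha) @^-1` B)).
  by congr (P _); apply: eq_set => w; rewrite /preimage/mkset E.
(* [ctail] undoes both maps [ccons1], so dropping the newest coin does not change the law. *)
rewrite coin_prob_selfsim1; last by rewrite -[_ @^-1` _]setTI; exact: mYS.
have mYB : measurable ((fun w => W w / Num.sqrt alpha) @^-1` B).
  by rewrite -[_ @^-1` _]setTI; exact: mY.
rewrite (eq_bigr (fun=> P ((fun w => W w / Num.sqrt alpha) @^-1` B))); last by [].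
rewrite !big_ord_recl big_ord0 adde0 -(fineK (fin_num_measure P _ mYB)) -EFinD -EFinM.
by congr EFin; field.
Qed.

Lemma lip_bounded_comp d (Omega : measurableType d) (Y : Omega -> R) C f b :
  measurable_fun setT Y -> (forall w, `|Y w| <= b) -> lip C f -> bmeas (fun w => f (Y w)).
Proof.
move=> mY Yb fL; split; first exact: (measurableT_comp (lip_measurable fL) mY).
exists (`|f 0| + C * b) => w; apply: le_trans (lip_growth _ fL) _.
by rewrite lerD2l ler_wpM2l// (lip_ge0 fL).
Qed.

Lemma markov_law_scaled_bound alpha (W : coins -> R) : 0 < alpha < 1 ->
  (forall w, `|W w| <= 2) -> forall w, `|W w / Num.sqrt alpha| <= 2 / Num.sqrt alpha.
Proof.
move=> /andP[a0 a1] Wb w; have s0 : 0 < Num.sqrt alpha by rewrite sqrtr_gt0.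
by rewrite normrM normfV (gtr0_norm s0) ler_pM2r// invr_gt0.
Qed.

Lemma markov_law_lip alpha mu C f : 0 < alpha < 1 -> markov_law alpha mu -> lip C f ->
  (law alpha mu).-integrable setT (EFin \o f).
Proof.
move=> a01 [_ [W [mW Wb _ muE]]] fL.
have mY : measurable_fun setT (fun w => W w / Num.sqrt alpha) by exact: measurable_funM.
have [] // := law_integral mY (lip_measurable fL) muE.
exact: (lip_bounded_comp mY (markov_law_scaled_bound a01 Wb) fL).
Qed.

Lemma markov_law_expansion alpha mu C (h : nat -> R -> R) : 0 < alpha < 1 ->
  markov_law alpha mu -> jet C h ->
  `|\int[law alpha mu]_y h 0%N y - \int[normal_prob 0 (Num.sqrt (5 / 4))]_y h 0%N y +
    3 / 8 * \int[normal_prob 0 (Num.sqrt (5 / 4))]_y h 3%N y * Num.sqrt alpha|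
  <= K3 * C * Num.sqrt alpha * Num.sqrt (Num.sqrt (Num.sqrt alpha)).
Proof.
move=> a01 [_ [W [mW Wb WE muE]]] hj.
have a0 : 0 < alpha by case/andP: a01.
set s := Num.sqrt alpha; have s0 : 0 < s by rewrite sqrtr_gt0.
have s2 : s ^+ 2 = alpha by rewrite sqr_sqrtr// ltW.
pose Y w := W w / s.
have mY : measurable_fun setT Y by exact: measurable_funM.
have Yb := markov_law_scaled_bound a01 Wb.
have stat F : okF F -> pair_mean P Y (coin 0) F = pair_mean P Y (coin 0) (fun y b =>
    (F ((1 - alpha) * y + s * scl b) true + F ((1 - alpha) * y - s * scl b) false) / 2).
  move=> okFF.
  have bF : bmeas (fun w => F (Y w) (coin 0 w)).
    have [C0 L0] := okFF false; have [C1 L1] := okFF true.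
    have [m0 [b0 B0]] := lip_bounded_comp mY Yb L0.
    have [m1 [b1 B1]] := lip_bounded_comp mY Yb L1.
    split.
      rewrite (_ : (fun w => _) = fun w => if coin 0 w then F (Y w) true else F (Y w) false).
        by apply: measurable_fun_ifT => //; exact: measurable_coin.
      by apply/funext => w; case: (coin 0 w).
    exists (Num.max b0 b1) => w; rewrite le_max; case: (coin 0 w).
      by rewrite B1 orbT.
    by rewrite B0.
  rewrite /pair_mean (selfsim_integral measurable_ccons1 coin_prob_selfsim1 bF).
  apply: eq_Rintegral => w _; rewrite /avg !big_ord_recl big_ord0 addr0 /Y !WE /xi_/=.
  rewrite -[coin 0 (ccons1 _ w)]/false -[coin 0 (ccons1 (bump _ _) w)]/true.
  rewrite mulrC addrC /scl mul1r mulN1r mulrN.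
  have E (x c : R) : ((1 - alpha) * x + alpha * c) / s = (1 - alpha) * (x / s) + s * c.
    by rewrite -[in alpha * c]s2; field; rewrite gt_eqF.
  have E' (x c : R) : ((1 - alpha) * x - alpha * c) / s = (1 - alpha) * (x / s) - s * c.
    by rewrite -[in alpha * c]s2; field; rewrite gt_eqF.
  by rewrite !E !E'.
(* The scale e = s^(1/4) of the third differences. *)
have e4 : Num.sqrt (Num.sqrt s) ^+ 4 = s.
  by rewrite (exprM _ 2 2) !sqr_sqrtr// ?sqrtr_ge0// ltW.
have e0 : 0 < Num.sqrt (Num.sqrt s) by rewrite !sqrtr_gt0.
have := interp_expansion a01 mY (measurable_coin 0) Yb stat hj e0 e4.
have [hL _ _ _ _] := hj.
have sg0 : 0 < Num.sqrt (5 / 4 : R) by rewrite sqrtr_gt0; lra.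
rewrite !(Rintegral_normal_lip sg0 (hL _ _))// /interp_lim /siginf.
(* At index 0 the smoothing width vanishes and q^0 = 1, so the interpolant is the mean of [h 0]
   under the law of Y. *)
rewrite /interp /pair_mean /sig muln0 expr0 subrr mulr0 sqrtr0.
under eq_Rintegral do rewrite gs0 mul1r.
have [_ ->] := law_integral mY (lip_measurable (hL 0%N isT)) muE (lip_bounded_comp mY Yb (hL 0%N isT)).
by rewrite mulrAC.
Qed.

End laws.

(** * Independent noise with the same marginal *)

Section iid.
Context {R : realType}.
Notation BZ := (borelType (@Zc R)).
Local Notation P := (@coin_prob R).

Lemma iid_law_exists alpha : 0 < alpha < 1 ->
  exists mu : probability (R * BZ)%type R, selfsim 3 (sgd_map alpha xi_ nxt4) mu.
Proof.
move=> a01.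
have [mu [W [ss _ _ _ _]]] := @sgd_law_exists R _ coins P 3 ccons2 ctail2 coin_pair nxt4
  measurable_ctail2 measurable_coin_pair (fun _ _ => erefl) (fun _ _ => erefl)
  coin_prob_selfsim2 alpha a01.
by exists mu.
Qed.

Definition reflect_state (w : R * BZ) : R * BZ := (- w.1, (w.2.1, ~~ w.2.2)).

Lemma measurable_reflect_state : measurable_fun setT reflect_state.
Proof.
apply/measurable_fun_pairP; split => /=.
  exact: (measurableT_comp (@oppr_measurable R setT) measurable_fst).
exact: (measurableT_comp (@measurable_fun_BZ R _ BZ (fun z => (z.1, ~~ z.2))) measurable_snd).
Qed.

Lemma xi_reflect (z : BZ) : xi_ ((z.1, ~~ z.2) : BZ) = - xi_ z :> R.
Proof. by case: z => -[] -[]; rewrite /xi_/=; ring. Qed.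

Lemma iid_law_symmetric alpha (mu : probability (R * BZ)%type R) A : 0 < alpha < 1 ->
  selfsim 3 (sgd_map alpha xi_ nxt4) mu -> measurable A ->
  mu A = mu (reflect_state @^-1` A).
Proof.
move=> a01 ss mA.
have m1 : push_measure mu measurable_reflect_state setT = 1%E by exact: probability_setT.
pose nu : probability (R * BZ)%type R := to_prob m1.
have mx : measurable_fun setT (@xi_ R) by exact: measurable_fun_BZ.
have mn i : measurable_fun setT (@nxt4 R i) by exact: measurable_fun_BZ.
have mr B : measurable B -> measurable (reflect_state @^-1` B).
  by move=> mB; rewrite -[_ @^-1` _]setTI; exact: measurable_reflect_state.
have nuE B : nu B = mu (reflect_state @^-1` B) by [].
rewrite -nuE; apply: (@sgd_selfsim_unique R _ BZ alpha 2 xi_ 3 nxt4 a01 (@xi_bound R) mx mn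
  (fun _ _ _ _ => erefl) (false, false) mu nu ss _ A mA).
move=> B mB; rewrite nuE (ss _ (mr _ mB)); congr (_ * _)%E.
have E i j w : nxt4 j w.2 = ((nxt4 i w.2).1, ~~ (nxt4 i w.2).2) :> BZ ->
    reflect_state (sgd_map alpha xi_ nxt4 i w) = sgd_map alpha xi_ nxt4 j (reflect_state w).
  move=> ij; rewrite /reflect_state /sgd_map /= xi_reflect.
  by congr (_, _); [ring|rewrite -ij].
have F i j : (forall w : R * BZ, nxt4 j w.2 = ((nxt4 i w.2).1, ~~ (nxt4 i w.2).2) :> BZ) ->
    mu (sgd_map alpha xi_ nxt4 i @^-1` (reflect_state @^-1` B)) = nu (sgd_map alpha xi_ nxt4 j @^-1` B).
  move=> ij; rewrite nuE; congr (mu _); apply: eq_set => w.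
  by rewrite /preimage/mkset (E _ j).
(* Reversing the newest coin exchanges the maps of index 0 and 2, and those of index 1 and 3. *)
rewrite !big_ord_recl !big_ord0 !adde0 (F _ 2%N)// (F _ 3%N)// (F _ 0%N)// (F _ 1%N)//.
by rewrite addeA addeC -addeA.
Qed.

End iid.

(** * The sine as test function *)

Section sine.
Context {R : realType}.

Lemma derive1_sin : (@sin R)^`()%classic = cos.
Proof. by apply/funext => x; rewrite derive1E; have [_ ->] := is_derive_sin x. Qed.

Lemma derive1_cos : (@cos R)^`()%classic = (fun x => - sin x).
Proof. by apply/funext => x; rewrite derive1E; have [_ ->] := is_derive_cos x. Qed.

Lemma is_deriveN_sin (x : R) : is_derive x 1 (fun y => - sin y) (- cos x).
Proof. exact: is_deriveN. Qed.

Lemma is_deriveN_cos (x : R) : is_derive x 1 (fun y => - cos y) (sin x).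
Proof. by rewrite -[sin x]opprK; exact: is_deriveN. Qed.

Lemma sin_derive3 : (@sin R)^`(3)%classic = (fun x => - cos x).
Proof.
rewrite !derive1nS derive1n0 derive1_sin derive1_cos.
by apply/funext => x; rewrite derive1E; have [_ ->] := is_deriveN_sin x.
Qed.

Lemma sin_norm_le1 (x : R) : `|sin x| <= 1.
Proof. by rewrite ler_norml sin_geN1 sin_le1. Qed.

Lemma cos_norm_le1 (x : R) : `|cos x| <= 1.
Proof. by rewrite ler_norml cos_geN1 cos_le1. Qed.

Lemma sin_C4 : C4_bounded_derivatives (@sin R).
Proof.
have d4 : (@sin R)^`(4)%classic = sin.
  rewrite derive1nS sin_derive3; apply/funext => x.
  by rewrite derive1E; have [_ ->] := is_deriveN_cos x.
have d2 : (@sin R)^`(2)%classic = (fun x => - sin x).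
  by rewrite !derive1nS derive1n0 derive1_sin derive1_cos.
have d1 : (@sin R)^`(1)%classic = cos by rewrite derive1n1 derive1_sin.
split.
- move=> [|[|[|[|//]]]] x _; rewrite ?derive1n0 ?d1 ?d2 ?sin_derive3.
  + by have [] := is_derive_sin x.
  + by have [] := is_derive_cos x.
  + by have [] := is_deriveN_sin x.
  + by have [] := is_deriveN_cos x.
- by rewrite d4; exact: continuous_sin.
- move=> [//|[|[|[|[|//]]]]] _; exists 1 => x; rewrite ?d1 ?d2 ?sin_derive3 ?d4 ?normrN;
  by rewrite ?sin_norm_le1 ?cos_norm_le1.
Qed.

Lemma is_derive_lip C (f df : R -> R) : (forall x : R, is_derive x 1 f (df x)) ->
  (forall x, `|df x| <= C) -> lip C f.
Proof.
move=> fd dC; suff H x y : x <= y -> `|f y - f x| <= C * `|y - x|.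
  move=> x y; have [xy|/ltW yx] := leP x y; last exact: H.
  by rewrite distrC (distrC x); exact: H.
move=> xy; have [|c _ ->] := @MVT_segment R f df x y xy.
  apply: continuous_subspaceT => z; apply: differentiable_continuous.
  by apply/derivable1_diffP; have [] := fd z.
by rewrite normrM ler_wpM2r.
Qed.

Lemma lip_sin : lip 1 (@sin R).
Proof. exact: (is_derive_lip (@is_derive_sin R) cos_norm_le1). Qed.

Lemma lip_Ncos : lip 1 (fun x : R => - cos x).
Proof. exact: (is_derive_lip is_deriveN_cos sin_norm_le1). Qed.

Lemma sin_lipschitz : 1.-lipschitz_setT (@sin R).
Proof. by move=> [x y] _; exact: lip_sin. Qed.

(** From cos x = 1 - 2 sin^2 (x / 2) and |sin u| <= |u|. *)
Lemma cos_ge_quadratic (x : R) : 1 - x ^+ 2 / 2 <= cos x.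
Proof.
have -> : cos x = 1 - 2 * sin (x / 2) ^+ 2.
  have {1}-> : x = (x / 2) *+ 2 by rewrite -mulr_natr; field.
  by rewrite cos_mulr2n cos2sin2 -[X in X - 1]mulr_natr; ring.
have := lip_sin (x / 2) 0; rewrite sin0 !subr0 mul1r => H.
have : `|sin (x / 2)| ^+ 2 <= `|x / 2| ^+ 2 by rewrite ler_sqr ?nnegrE.
by rewrite !real_normK ?num_real// => H2; rewrite -lerN2 in H2; nra.
Qed.

Lemma gauss_Ncos : \int[normal_prob 0 (Num.sqrt (5 / 4))]_x - (cos (x : R)) <= - (3 / 8).
Proof.
have sg0 : 0 < Num.sqrt (5 / 4 : R) by rewrite sqrtr_gt0; lra.
have sg2 : Num.sqrt (5 / 4 : R) ^+ 2 = 5 / 4 by rewrite sqr_sqrtr; lra.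
rewrite (Rintegral_normal_lip sg0 lip_Ncos) /gs.
pose g : probability (measurableTypeR R) R := normal_prob 0 1.
have i2 : g.-integrable setT (EFin \o (fun x : R => x ^+ 2)).
  apply: (@integrable_normal_quartic R _ 1 1); first exact: measurable_funX.
  move=> x; rewrite ger0_norm ?sqr_ge0// -[x ^+ 4]/(x ^+ (2 * 2)) exprM.
  by have := sqr_ge0 (x ^+ 2 - 1); move: (x ^+ 2) => y; rewrite sqrrB1; nra.
have [//|i3 E3] := @Rintegral_comb _ _ _ g [:: (5 / 8, (fun x : R => x ^+ 2)); (-1, fun=> 1)].
  by do !split => //; exact: integrable_cst.
have := @le_Rintegral _ _ _ g setT _ _ measurableT (gs_integrable _ 0 lip_Ncos) i3.
rewrite E3 !big_cons big_nil Rintegral_cstP Rintegral_normal_sqr => H.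
apply: (le_trans (H (Num.sqrt (5 / 4)) _)); last by rewrite /=; lra.
move=> x _; rewrite !big_cons big_nil/= add0r.
have := cos_ge_quadratic (Num.sqrt (5 / 4) * x); rewrite exprMn sg2.
by move: (cos _) (x ^+ 2) => c y; lra.
Qed.

End sine.

Section iid_sin.
Context {R : realType}.
Notation BZ := (borelType (@Zc R)).

Lemma iid_law_sin alpha (mu : probability (R * BZ)%type R) : 0 < alpha < 1 ->
  selfsim 3 (sgd_map alpha xi_ nxt4) mu ->
  (\int[distribution mu (scaled_iterate 0 alpha)]_y (sin y)%:E = 0)%E.
Proof.
move=> a01 ss; pose Y : R * BZ -> R := scaled_iterate 0 alpha.
have mY : measurable_fun setT Y by exact: measurable_scaled_iterate.
have mYr : measurable_fun setT (Y \o reflect_state).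
  exact: (measurableT_comp mY measurable_reflect_state).
have msin := lip_measurable (@lip_sin R).
have bs (X : R * BZ -> R) : measurable_fun setT X -> bmeas (@sin R \o X).
  by move=> mX; split; [exact: (measurableT_comp msin mX)|exists 1 => w; exact: sin_norm_le1].
pose m : probability (measurableTypeR R) R := distribution mu (scaled_iterate 0 alpha).
have mE B : measurable B -> m B = mu (Y @^-1` B) by [].
have mEr B : measurable B -> m B = mu ((Y \o reflect_state) @^-1` B).
  move=> mB; rewrite mE// (iid_law_symmetric a01 ss)//.
  by rewrite -[_ @^-1` _]setTI; exact: mY.
have [ig E1] := law_integral mY msin mE (bs _ mY).
have [_ E2] := law_integral mYr msin mEr (bs _ mYr).
have E3 : \int[mu]_w sin ((Y \o reflect_state) w) = - \int[mu]_w sin (Y w).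
  rewrite -mulN1r -RintegralZl//; last exact: bmeas_integrable (bs _ mY).
  apply: eq_Rintegral => w _; rewrite mulN1r -sinN; congr sin.
  by rewrite /Y /scaled_iterate/= !subr0 mulNr.
rewrite -(fineK (integrable_fin_num measurableT ig)); congr EFin.
have : \int[m]_y sin y = - \int[m]_y sin y by rewrite {1}E2 E3 E1.
by rewrite /Rintegral; move: (fine _) => x; lra.
Qed.

End iid_sin.

Theorem theorem2 (R : realType) :
  exists (c0 alpha0 : R) (f : R -> R) (xstar : R)
    (Z : completePseudoMetricType R)
    (P : R.-pker (borelType Z) ~> (borelType Z))
    (pi : probability (borelType Z) R) (xi : borelType Z -> R)
    (mu mu_iid : R -> probability (R * borelType Z)%type R),
  let gauss : probability (measurableTypeR R) R := normal_prob 0 (Num.sqrt (5 / 4)) in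
  let law (alpha : R) : probability (measurableTypeR R) R :=
    distribution (mu alpha) (scaled_iterate xstar alpha) in
  let law_iid (alpha : R) : probability (measurableTypeR R) R :=
    distribution (mu_iid alpha) (scaled_iterate xstar alpha) in
  (0 < c0 /\ 0 < alpha0) /\
  [/\ strongly_convex_C2 f, unique_minimizer f xstar, polish Z,
      uniformly_ergodic P pi & centered_bounded_noise pi xi] /\
  (forall alpha, 0 < alpha <= alpha0 ->
    [/\ sgd_stationary_law f xi P alpha (mu alpha),
        finite_first_moment (law alpha)
      & ((c0 * Num.sqrt alpha)%:E <= W1 (law alpha) gauss)%E]) /\
  (exists (d : measure_display) (Omega : measurableType d)
     (Pr : probability Omega R) (Zs : int -> Omega -> borelType Z),
     stationary_chain P pi Pr Zs) /\
  (forall (d : measure_display) (Omega : measurableType d)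
     (Pr : probability Omega R) (Zs : int -> Omega -> borelType Z),
     stationary_chain P pi Pr Zs ->
     let noise (k : int) (w : Omega) : R := xi (Zs k w) in
     let mixed_moment := 'E_Pr[fun w => (noise 0 w * noise 1 w ^+ 2)%R]%E in
     [/\ forall B : set R, measurable B ->
           Pr (noise 0 @^-1` B) = Pr ((fun w => - noise 0 w) @^-1` B),
         'E_Pr[fun w => (noise 0 w ^+ 3)%R]%E = 0%E,
         forall l : int, l != 0 ->
           'E_Pr[fun w => (noise 0 w * noise l w)%R]%E = 0%E,
         mixed_moment = (- (9 / 4))%:E
       & leading_correction law gauss
           (fine mixed_moment / f^`(2)%classic xstar)]) /\
  (1.-lipschitz_setT (@sin R) /\ forall x : R, `|sin x| <= 1) /\
  (forall alpha, 0 < alpha <= alpha0 ->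
    sgd_stationary_law f xi (fun=> pi) alpha (mu_iid alpha) /\
    (\int[law_iid alpha]_y (sin y)%:E = 0)%E).
Proof.
have [mu Hmu] := sgd_law_choice (@markov_law_exists R).
have [mu_iid Hiid] := sgd_law_choice (@iid_law_exists R).
pose gauss : probability (measurableTypeR R) R := normal_prob 0 (Num.sqrt (5 / 4)).
pose law alpha : probability (measurableTypeR R) R :=
  distribution (mu alpha) (scaled_iterate 0 alpha).
have correction h : C4_bounded_derivatives h ->
    (\int[law alpha]_y h y - \int[gauss]_y h y) / Num.sqrt alpha @[alpha --> 0^'+] -->
    - (3 / 8 * \int[gauss]_y h^`(3)%classic y).
  move=> /C4_jet[C hj]; apply: (@expansion_leading R law gauss _ (K3 * C) 1) => // alpha a01.
  by have := markov_law_expansion a01 (Hmu alpha a01) hj; rewrite derive1n0.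
(* 9/64 is the coefficient 3/8 of the expansion times the lower bound 3/8 for the Gaussian mean of
   cos. *)
have gauss_sin : 9 / 64 <= - (3 / 8 * \int[gauss]_y (@sin R)^`(3)%classic y).
  by rewrite sin_derive3; have := @gauss_Ncos R; rewrite -/gauss; lra.
have [delta delta0 lower] : exists2 delta : R, 0 < delta & forall alpha, 0 < alpha < delta ->
    Num.sqrt alpha / 16 <= \int[law alpha]_y sin y - \int[gauss]_y sin y.
  (* With tolerance 1/16 the quotient stays above 9/64 - 1/16 = 5/64, which still exceeds the
     constant 1/16 chosen for c0. *)
  have e0 : 0 < 1 / 16 :> R by lra.
  have /cvgrPdist_lt/(_ _ e0)/nbhs_ballP[delta /= delta0 H] := correction _ sin_C4.
  exists delta => // alpha /andP[a0 ad]; have s0 : 0 < Num.sqrt alpha by rewrite sqrtr_gt0.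
  have := H alpha; rewrite /ball/= sub0r normrN gtr0_norm// => /(_ ad a0).
  move: gauss_sin; move: (\int[gauss]_y _^`(3)%classic y) => k k9.
  move: (\int[law alpha]_y _ - _) => D; rewrite ltr_norml => /andP[_ Dk].
  have : 1 / 16 < D / Num.sqrt alpha by lra.
  by rewrite ltr_pdivlMr// => /ltW; lra.
(* Halving turns the strict bounds alpha < delta and alpha < 1 into the non-strict bound of the
   statement. *)
pose alpha0 := Num.min (delta / 2) (1 / 2).
have alpha0_gt0 : 0 < alpha0 by rewrite lt_min; apply/andP; split; lra.
have alpha0_lt alpha : 0 < alpha <= alpha0 -> 0 < alpha < 1 /\ 0 < alpha < delta.
  rewrite le_min => /andP[a0 /andP[ad a1]]; rewrite a0 /=; split; lra.
exists (1 / 16), alpha0, half_sqr, 0, Zc, Pk, pi_, xi_, mu, mu_iid => /=.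
split; first by split => //; lra.
split.
  split; [exact: half_sqr_strongly_convex|exact: half_sqr_min|exact: polish_Zc
         |exact: Pk_ergodic|exact: xi_centered].
split.
  move=> alpha /alpha0_lt[a01 ad]; have muP := Hmu alpha a01; have [ss _] := muP.
  split.
  - exact: (@sgd_selfsim_stationary R 1 nxt2 (@Pk R) alpha (mu alpha) a01
      (fun _ _ _ _ => erefl) (fun _ _ => erefl) ss).
  - have idL : lip 1 (@id R) by move=> x y; rewrite mul1r.
    exact: (markov_law_lip a01 muP idL).
  - have il : (law alpha).-integrable setT (EFin \o (@sin R)).
      exact: (markov_law_lip a01 muP lip_sin).
    have ig : gauss.-integrable setT (EFin \o (@sin R)).
      apply: bmeas_integrable; split; last by exists 1; exact: sin_norm_le1.
      exact: (lip_measurable lip_sin).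
    apply: (@le_trans _ _ `|\int[law alpha]_y (sin y)%:E - \int[gauss]_y (sin y)%:E|%E); last first.
      by apply: ereal_sup_ubound; exists (@sin R) => //; exact: sin_lipschitz.
    rewrite -(fineK (integrable_fin_num measurableT il)) -(fineK (integrable_fin_num measurableT ig)).
    rewrite -EFinB abse_EFin lee_fin; apply: le_trans (ler_norm _).
    by have := lower alpha ad; rewrite /Rintegral /=; lra.
split.
  by exists _, coins, coin_prob, zchain; exact: zchain_stationary.
split.
  move=> d Omega Pr Zs chain; rewrite (chain_mixed_moment chain); split.
  - by move=> B mB; exact: (chain_noise_symmetric chain mB).
  - exact: (chain_noise_cube chain).
  - by move=> l l0; exact: (chain_noise_white chain l0).
  - by [].
  - move=> h hC; have d2 : (@half_sqr R)^`(2)%classic 0 = 1 by rewrite half_sqr_derive2.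
    rewrite [X in - (9 / 4) / X](_ : _ = 1); last exact: d2.
    (* (- 9/4) / 6 = - 3/8: the coefficient predicted by the mixed moment is the one found by the
       expansion. *)
    rewrite (_ : - (9 / 4) / 1 / 6 * _ = - (3 / 8 * \int[gauss]_y h^`(3)%classic y)).
      exact: correction.
    by rewrite -/gauss; move: (\int[gauss]_y _) => k; field.
split.
  by split; [exact: sin_lipschitz|exact: sin_norm_le1].
move=> alpha /alpha0_lt[a01 _]; have ss := Hiid alpha a01; split.
  exact: (@sgd_selfsim_stationary R 3 nxt4 (fun=> pi_) alpha (mu_iid alpha) a01
    (fun _ _ _ _ => erefl) (fun _ _ => erefl) ss).
exact: (iid_law_sin a01 ss).
Qed.
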